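(* Let $p\in[1,\infty)$, let $\Omega\subset\mathbb{R}^{2d}$ be measurable with $0<|\Omega|<\infty$, and let $S\in\mathcal{S}^2$. Then the supremum $$\sup_{T\in\mathcal{S}^2\setminus\{0\}}\frac{\left(\int_\Omega |T\star\check{S}(z)|^p\,dz\right)^{1/p}}{\|T\|_{\mathcal{S}^2}}$$ is attained, and the corresponding concentration functional $\mathcal{S}^2\ni T\mapsto\left(\int_\Omega|T\star\check{S}(z)|^p\,dz\right)^{1/p}$ is sequentially weakly continuous. Moreover, $$\sup_{T\in\mathcal{S}^2\setminus\{0\}}\frac{\left(\int_\Omega|T\star\check{T}(z)|^p\,dz\right)^{1/p}}{\|T\|_{\mathcal{S}^2}^2}=|\Omega|^{1/p},$$ but this supremum is not attained.
   Context: $\mathcal{S}^2$ is the Hilbert space of Hilbert--Schmidt operators on the complex Hilbert space $L^2(\mathbb{R}^d)$, with inner product $\langle T,S\rangle=\operatorname{tr}(TS^* )$. For $z=(x,\xi)\in\mathbb{R}^{2d}$, $\pi(z)f(y)=e^{2\pi i\xi\cdot y}f(y-x)$, and $\alpha_z(A)=\pi(z)A\pi(z)^*$ for an operator $A$. With $Pf(y)=f(-y)$, set $\check{A}=PAP$. The operator convolution is $T\star S(z)=\operatorname{tr}(T\alpha_z(\check{S}))$, so that $T\star\check{S}(z)=\operatorname{tr}(T\alpha_z(S))$ for $z\in\mathbb{R}^{2d}$. *)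

(* Defs.v *)
From HB Require Import structures.
From mathcomp Require Import all_boot all_order all_algebra complex.
From mathcomp Require Import all_classical all_reals all_analysis measurable_realfun.
From mathcomp Require Import ring lra.

Set Implicit Arguments.
Unset Strict Implicit.
Unset Printing Implicit Defensive.

Import Order.TTheory GRing.Theory Num.Theory numFieldNormedType.Exports.

Local Open Scope classical_set_scope.
Local Open Scope ring_scope.
Local Open Scope complex_scope.
Local Open Scope quotient_scope.

Notation euclid R d := (d.-tuple (measurableTypeR R)).

Section Lebesgue.
Variable R : realType.

Definition tcons n (u : measurableTypeR R * euclid R n) : euclid R n.+1 :=
  [tuple of u.1 :: u.2].

Lemma measurable_tcons n : measurable_fun [set: _] (@tcons n).
Proof. exact: measurable_cons. Qed.

Section step.
Variables (n : nat) (mu : {sigma_finite_measure set (euclid R n) -> \bar R}).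

Definition leb_step : set (euclid R n.+1) -> \bar R :=
  pushforward (@lebesgue_measure R \x mu)%E (@tcons n).

Let leb_step0 : leb_step set0 = 0%E.
Proof. by rewrite /leb_step /pushforward preimage_set0 measure0. Qed.

Let leb_step_ge0 A : (0 <= leb_step A)%E.
Proof. by rewrite /leb_step /pushforward measure_ge0. Qed.

Let leb_step_sigma_additive : semi_sigma_additive leb_step.
Proof.
have mpre A : measurable A -> measurable (@tcons n @^-1` A).
  by move=> mA; rewrite -[X in measurable X]setTI; exact: measurable_tcons.
move=> F mF tF mUF; rewrite /leb_step /pushforward preimage_bigcup.
apply: measure_semi_sigma_additive.
- by move=> k; exact: mpre.
- apply/trivIsetP => /= i j _ _ ij; rewrite -preimage_setI.
  by move/trivIsetP : tF => /(_ _ _ _ _ ij) ->//; rewrite preimage_set0.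
- by rewrite -preimage_bigcup; exact: mpre.
Qed.

HB.instance Definition _ := isMeasure.Build _ _ _ leb_step
  leb_step0 leb_step_ge0 leb_step_sigma_additive.

Let leb_step_sigma_finite : sigma_finite setT leb_step.
Proof.
have /sigma_finiteP[F [TF ndF Foo]] := sigma_finiteT (@lebesgue_measure R).
have /sigma_finiteP[G [TG ndG Goo]] := sigma_finiteT mu.
pose unc (t : euclid R n.+1) : measurableTypeR R * euclid R n :=
  (thead t, [tuple of behead t]).
have munc : measurable_fun [set: _] unc.
  apply/measurable_fun_pairP; split; first exact: measurable_tnth.
  exact: measurable_behead.
have uncK : cancel (@tcons n) unc.
  by move=> [a t]; rewrite /unc theadE; congr pair; exact: val_inj.
exists (fun k => unc @^-1` (F k `*` G k)).
  rewrite -preimage_bigcup -(preimage_setT unc); congr (_ @^-1` _).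
  rewrite -setXTT TF TG predeqE => -[x y]; split.
    move=> [/= [k _ Fkx] [l _ Gly]]; exists (maxn k l) => //; split.
    - by move: x Fkx; exact/subsetPset/ndF/leq_maxl.
    - by move: y Gly; exact/subsetPset/ndG/leq_maxr.
  by move=> [k _ []/= ? ?]; split; exists k.
move=> k; have [mFk Fk] := Foo k; have [mGk Gk] := Goo k; split.
  by rewrite -[X in measurable X]setTI; apply: munc => //; exact: measurableX.
rewrite /leb_step /pushforward.
rewrite (_ : @tcons n @^-1` _ = F k `*` G k); last first.
  have unctcons : unc \o @tcons n = id by apply/funext => u; exact: uncK.
  by rewrite -comp_preimage unctcons preimage_id.
by rewrite product_measure1E// lte_mul_pinfty// ge0_fin_numE.
Qed.

HB.instance Definition _ := @Measure_isSigmaFinite.Build _ _ _ leb_step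
  leb_step_sigma_finite.

End step.

Fixpoint leb d : {sigma_finite_measure set (euclid R d) -> \bar R} :=
  if d is n.+1 then leb_step (leb n) else dirac [tuple].

Definition leb_prod d :
  {measure set (euclid R d * euclid R d)%type -> \bar R} := (leb d \x leb d)%E.

(* R^2d is R^d x R^d with completed Lebesgue measure: the measurable sets of *)
(* phase d are the Lebesgue measurable ones, not just the Borel sets.         *)
Definition phase d : measurableType _ := caratheodory_type (leb_prod d)^*%mu.

Definition leb2 d : {measure set (phase d) -> \bar R} :=
  @completed_measure_extension _ _ R (leb_prod d).

End Lebesgue.

Section L2.
Variables (R : realType) (d : nat).
Implicit Types f g : euclid R d -> R[i].

Definition square_integrable f : Prop :=
  [/\ measurable_fun [set: _] (fun x => complex.Re (f x)),
      measurable_fun [set: _] (fun x => complex.Im (f x)) &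
      (\int[leb R d]_x (Normc.normc (f x) ^+ 2)%:E < +oo)%E].

Lemma sqr_normc_parts (z : R[i]) :
  Normc.normc z ^+ 2 = complex.Re z ^+ 2 + complex.Im z ^+ 2.
Proof. by case: z => a b; rewrite sqr_sqrtr// addr_ge0// sqr_ge0. Qed.

Lemma re_axpy (a u v : R[i]) : complex.Re (a * u + v) =
  complex.Re a * complex.Re u - complex.Im a * complex.Im u + complex.Re v.
Proof. by case: a u v => [? ?] [? ?] [? ?]. Qed.

Lemma im_axpy (a u v : R[i]) : complex.Im (a * u + v) =
  complex.Re a * complex.Im u + complex.Im a * complex.Re u + complex.Im v.
Proof. by case: a u v => [? ?] [? ?] [? ?]. Qed.

Lemma measurable_sqr_normc f :
  measurable_fun [set: _] (fun x => complex.Re (f x)) ->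
  measurable_fun [set: _] (fun x => complex.Im (f x)) ->
  measurable_fun [set: _] (fun x => (Normc.normc (f x) ^+ 2)%:E : \bar R).
Proof.
move=> mr mi; apply/measurable_EFinP.
under eq_fun do rewrite sqr_normc_parts.
by apply: measurable_funD; exact: measurable_funX.
Qed.

Definition l2fun : {pred euclid R d -> R[i]} := mem [set f | square_integrable f].

Lemma l2fun_submod_closed : submod_closed l2fun.
Proof.
split.
  rewrite inE /=; split; try exact: measurable_cst.
  under eq_integral do rewrite Normc.normc0 expr0n /=.
  by rewrite integral0.
move=> a f g; rewrite !inE /= => -[fr fi fo] [gr gi go].
have er x : complex.Re ((a *: f + g) x) =
    complex.Re a * complex.Re (f x) - complex.Im a * complex.Im (f x)
    + complex.Re (g x) by exact: re_axpy.
have ei x : complex.Im ((a *: f + g) x) =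
    complex.Re a * complex.Im (f x) + complex.Im a * complex.Re (f x)
    + complex.Im (g x) by exact: im_axpy.
have mr : measurable_fun [set: _] (fun x => complex.Re ((a *: f + g) x)).
  under eq_fun do rewrite er.
  apply: measurable_funD => //; apply: measurable_funB;
  by apply: measurable_funM => //; exact: measurable_cst.
have mi : measurable_fun [set: _] (fun x => complex.Im ((a *: f + g) x)).
  under eq_fun do rewrite ei.
  apply: measurable_funD => //; apply: measurable_funD;
  by apply: measurable_funM => //; exact: measurable_cst.
split => //.
pose A := 2 * Normc.normc a ^+ 2.
pose F x := (A%:E * (Normc.normc (f x) ^+ 2)%:E
             + 2%:E * (Normc.normc (g x) ^+ 2)%:E)%E.
have A0 : 0 <= A by rewrite mulr_ge0// sqr_ge0.
have mf := measurable_sqr_normc fr fi.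
have mg := measurable_sqr_normc gr gi.
apply: (@le_lt_trans _ _ (\int[leb R d]_x F x)%E).
  apply: ge0_le_integral => //.
  - by move=> x _; rewrite lee_fin sqr_ge0.
  - exact: measurable_sqr_normc.
  - by apply: emeasurable_funD; exact: measurable_funeM.
  - move=> x _; rewrite /F -!EFinM -EFinD lee_fin /A !sqr_normc_parts er ei.
    move: (complex.Re a) (complex.Im a) (complex.Re (f x)) (complex.Im (f x))
      (complex.Re (g x)) (complex.Im (g x)) => a1 a2 f1 f2 g1 g2.
    rewrite -subr_ge0.
    have -> : 2 * (a1 ^+ 2 + a2 ^+ 2) * (f1 ^+ 2 + f2 ^+ 2)
      + 2 * (g1 ^+ 2 + g2 ^+ 2)
      - ((a1 * f1 - a2 * f2 + g1) ^+ 2 + (a1 * f2 + a2 * f1 + g2) ^+ 2)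
      = (a1 * f1 - a2 * f2 - g1) ^+ 2 + (a1 * f2 + a2 * f1 - g2) ^+ 2 :> R.
      by ring.
    by rewrite addr_ge0// sqr_ge0.
rewrite ge0_integralD//=; last 4 first.
- by move=> x _; rewrite -EFinM lee_fin mulr_ge0// sqr_ge0.
- exact: measurable_funeM.
- by move=> x _; rewrite -EFinM lee_fin mulr_ge0// sqr_ge0.
- exact: measurable_funeM.
rewrite !ge0_integralZl//; try by move=> x _; rewrite lee_fin sqr_ge0.
by rewrite lte_add_pinfty// lte_mul_pinfty.
Qed.

HB.instance Definition _ := GRing.isSubmodClosed.Build _ _ l2fun
  l2fun_submod_closed.

Record l2fun_type := L2fun { l2_fun :> euclid R d -> R[i] ; _ : l2_fun \in l2fun }.

HB.instance Definition _ := [isSub for l2_fun].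
HB.instance Definition _ := [Choice of l2fun_type by <:].
HB.instance Definition _ := [SubChoice_isSubLmodule of l2fun_type by <:].

Definition l2null : {pred l2fun_type} :=
  mem [set f : l2fun_type | {ae leb R d, forall x, f x = 0}].

Lemma l2null_submod_closed : submod_closed l2null.
Proof.
split; first by rewrite inE /=; exact: aeW.
move=> a f g; rewrite !inE /=; apply: filterS2 => x fx gx.
by change (a * f x + g x = 0); rewrite fx gx mulr0 addr0.
Qed.

HB.instance Definition _ := GRing.isSubmodClosed.Build _ _ l2null
  l2null_submod_closed.

(* L^2(R^d): square-integrable functions modulo equality almost everywhere.   *)
Definition L2 : Type := Quotient.quot l2null.
HB.instance Definition _ := Choice.on L2.
HB.instance Definition _ := GRing.Zmodule.on L2.
HB.instance Definition _ := EqQuotient.on L2.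

Definition L2_scale (a : R[i]) (u : L2) : L2 :=
  \pi_L2 (a *: (repr u : l2fun_type)).

Lemma pi_L2P (f g : l2fun_type) : (\pi_L2 f = \pi_L2 g) <-> f - g \in l2null.
Proof.
split=> [/eqP|] h; last apply/eqP.
  by rewrite eqmodE in h.
by rewrite eqmodE.
Qed.

Lemma pi_L2D (f g : l2fun_type) : \pi_L2 (f + g) = \pi_L2 f + \pi_L2 g.
Proof. exact: (Quotient.pi_add). Qed.

Lemma pi_L2Z (a : R[i]) (f : l2fun_type) :
  \pi_L2 (a *: f) = L2_scale a (\pi_L2 f).
Proof.
apply/pi_L2P; rewrite -scalerBr rpredZ//; apply/pi_L2P.
by rewrite reprK.
Qed.

Let L2_scaleA a b (u : L2) : L2_scale a (L2_scale b u) = L2_scale (a * b) u.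
Proof. by rewrite -[u]reprK -(pi_L2Z b) -(pi_L2Z a) -pi_L2Z scalerA. Qed.

Let L2_scale1 : left_id 1 L2_scale.
Proof. by move=> u; rewrite -[u]reprK -pi_L2Z scale1r. Qed.

Let L2_scaleDr : right_distributive L2_scale +%R.
Proof.
by move=> a u v; rewrite -[u]reprK -[v]reprK -pi_L2D -!pi_L2Z scalerDr pi_L2D.
Qed.

Let L2_scaleDl (u : L2) : {morph L2_scale^~ u : a b / a + b}.
Proof. by move=> a b; rewrite -[u]reprK -!pi_L2Z scalerDl pi_L2D. Qed.

HB.instance Definition _ := GRing.Zmodule_isLmodule.Build R[i] L2
  L2_scaleA L2_scale1 L2_scaleDr L2_scaleDl.

Definition l2rep (u : L2) : euclid R d -> R[i] := l2_fun (repr u : l2fun_type).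

(* The class of f in L^2; defined to be 0 when f is not square-integrable.    *)
Definition toL2 (f : euclid R d -> R[i]) : L2 :=
  \pi_L2 (insubd (0 : l2fun_type) f).

Lemma l2repK : cancel l2rep toL2.
Proof. by move=> u; rewrite /toL2 /l2rep valKd reprK. Qed.

(* Inner product int f conj(g), linear in the first argument.                 *)
Definition inner (u v : L2) : R[i] :=
  let h x := l2rep u x * (l2rep v x)^* in
  Complex (\int[leb R d]_x complex.Re (h x))%R
          (\int[leb R d]_x complex.Im (h x))%R.

Definition L2norm (u : L2) : R := Num.sqrt (complex.Re (inner u u)).

End L2.

Section Operators.
Variables (R : realType) (d : nat).
Local Notation H := (L2 R d).
Implicit Types (A B S T : H -> H) (e : nat -> H) (z : phase R d).

Definition bounded_operator A : Prop :=
  linear A /\ exists M : R, forall u, L2norm (A u) <= M * L2norm u.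

(* The operator B with <A u, v> = <u, B v>; unique, and existing for every    *)
(* bounded A (the default value 0 is then not used).                          *)
Definition adjoint A : H -> H :=
  xget (fun=> 0) [set B | forall u v, inner (A u) v = inner u (B v)].

(* L^2(R^d) is separable and, for d > 0, infinite-dimensional: its            *)
(* orthonormal bases are sequences.                                           *)
Definition orthonormal_basis e : Prop :=
  (forall m n, inner (e m) (e n) = (m == n)%:R) /\
  (forall u, (forall n, inner u (e n) = 0) -> u = 0).

(* tr A is the common value of sum_n <A e_n, e_n> over all orthonormal bases; *)
(* it exists exactly for the trace class operators, and is 0 by convention    *)
(* for the other bounded operators.                                           *)
Definition trace A : R[i] :=
  xget 0 [set t : R[i] | forall e, orthonormal_basis e ->
    (series (fun n => inner (A (e n)) (e n)) : nat -> R[i]^o) @ \oo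
      --> (t : R[i]^o)].

(* The space S^2; the finiteness and the value of the sum do not depend on e. *)
Definition hilbert_schmidt : set (H -> H) := [set A | bounded_operator A /\
  exists e, orthonormal_basis e /\
    (\sum_(0 <= n <oo) (L2norm (A (e n)) ^+ 2)%:E < +oo)%E].

Definition hs_inner T S : R[i] := trace (T \o adjoint S).

Definition hs_norm T : R := Num.sqrt (complex.Re (hs_inner T T)).

Definition weakly_converges (T_ : nat -> H -> H) T : Prop :=
  forall A, hilbert_schmidt A ->
    ((fun n => hs_inner (T_ n) A) : nat -> R[i]^o) @ \oo
      --> (hs_inner T A : R[i]^o).

Definition dot (x y : euclid R d) : R :=
  \sum_(i < d) (tnth x i : R) * (tnth y i : R).

(* pi(z) f (y) = exp(2 i pi xi.y) f(y - x), for z = (x, xi)                   *)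
Definition time_freq_shift z (u : H) : H :=
  toL2 (fun y : euclid R d =>
    let t := 2 * pi * dot z.2 y in
    Complex (cos t) (sin t) *
    l2rep u [tuple ((tnth y i : R) - (tnth z.1 i : R)) | i < d]).

Definition parity (u : H) : H :=
  toL2 (fun y : euclid R d => l2rep u [tuple (- (tnth y i : R)) | i < d]).

Definition alpha z A : H -> H :=
  time_freq_shift z \o A \o adjoint (time_freq_shift z).

Definition op_check A : H -> H := parity \o A \o parity.

Definition op_conv T S z : R[i] := trace (T \o alpha z (op_check S)).

(* (int_Omega |F(z)|^p dz)^(1/p), in [0, +oo]                                 *)
Definition Lp_on (p : R) (Omega : set (phase R d)) (F : phase R d -> R[i]) :
    \bar R :=
  ((\int[leb2 R d]_(z in Omega) (Normc.normc (F z) `^ p)%:E) `^ p^-1)%E.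

Definition concentration p Omega S T : \bar R :=
  Lp_on p Omega (op_conv T (op_check S)).

Definition conc_ratio p Omega S T : \bar R :=
  (concentration p Omega S T / (hs_norm T)%:E)%E.

Definition self_conc_ratio p Omega T : \bar R :=
  (concentration p Omega T T / (hs_norm T ^+ 2)%:E)%E.

Definition hs_nonzero : set (H -> H) :=
  [set T | hilbert_schmidt T /\ T <> (fun=> 0)].

End Operators.

(* Main.v *)
(* For T, S in S^2, T * check(S)(z) = <T, alpha_z(S)^*>, which Cauchy-Schwarz   *)
(* bounds by |T| |S|.  A weakly convergent sequence T_n is bounded, and        *)
(* T_n * check(S) converges pointwise, so dominated convergence on Omega makes *)
(* the functional weakly continuous; weak compactness of the unit ball then    *)
(* turns a normalized maximizing sequence into a maximizer.                    *)
(*   In the self case the same bound gives |Omega|^(1/p).  The operator with   *)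
(* kernel 1{|s_i| <= L, |t_i| <= L, |s_i - t_i| <= delta} is self-adjoint and  *)
(* almost invariant under alpha_z, uniformly for z in a bounded set, once      *)
(* delta is small and L large; so the bound is approached.  If it were reached *)
(* at T, equality in Cauchy-Schwarz for almost every z in Omega would make T   *)
(* proportional to alpha_z(T^* ) and to alpha_w(T^* ) for some z, w in Omega   *)
(* with different first position coordinates.  The Hilbert-Schmidt mass of T^* *)
(* in the half space {y_0 >= a} would then be periodic in a, so T^* = 0.       *)
(*   Hilbert space arguments use the real inner product Re<u, v>, which        *)
(* determines <u, v> = Re<u, v> + i Re<u, i v>.                                *)

From HB Require Import structures.
Require Import Defs.
From mathcomp Require Import all_boot all_order all_algebra complex.
From mathcomp Require Import all_classical all_reals all_analysis measurable_realfun.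
From mathcomp Require Import ring lra.

Set Implicit Arguments.
Unset Strict Implicit.
Unset Printing Implicit Defensive.

Import Order.TTheory GRing.Theory Num.Theory numFieldNormedType.Exports.

Local Open Scope classical_set_scope.
Local Open Scope ring_scope.
Local Open Scope complex_scope.

(** * Real inner product spaces *)

(** Everything rests on [op_convE]: the convolution at $z$ is the inner product of $T$ with the
    adjoint of $\alpha_z(S)$. It is therefore weakly continuous in $T$, and since adjoints and
    $\alpha_z$ preserve the norm, its modulus is at most [hs_norm T * hs_norm S] ([normc_op_conv]).

    For fixed $S$, a weakly convergent sequence is bounded ([weakly_converges_bounded]), so
    dominated convergence on the finite measure set $\Omega$ gives [concentration_cvg]. A maximizing
    sequence scaled to norm one has a weak limit of norm at most one ([hs_weak_compactness]). The
    functional at this limit equals the supremum, and rescaling a nonzero limit to norm one can only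
    increase the value. This is [conc_ratio_sup_attained].

    For $S=T$ the pointwise bound gives [self_conc_ratio_le]. The operators of [almost_invariant]
    satisfy $|T\star\check{T}(z)|\ge(1-\epsilon)\|T\|^2$ on any prescribed bounded set of $z$.
    Exhausting $\Omega$ by bounded pieces and letting $\epsilon$ tend to $0$ gives
    [self_conc_ratio_sup].

    An operator attaining the bound has equality in Cauchy--Schwarz for almost every $z\in\Omega$
    ([self_conc_ratio_eq_ae]), hence is a unimodular multiple of $\alpha_z$ of its adjoint
    ([op_conv_norm_eq]). Two such points with different first coordinates force the operator to
    vanish ([ae_two_points], [alpha_proportional_eq0]).

    The functional analysis (completeness, Riesz representation, uniform boundedness, weak
    compactness) is done for an abstract [real_ip] and used twice: for $L^2$ through [reip], and for
    the Hilbert--Schmidt operators through [hsip]. *)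

Lemma cvg_sumR (R : realType) (T : Type) (F : set_system T) (FF : Filter F)
    (I : Type) (r : seq I) (P : pred I) (f : I -> T -> R) (l : I -> R) :
  (forall i, P i -> f i x @[x --> F] --> l i) ->
  \sum_(i <- r | P i) f i x @[x --> F] --> \sum_(i <- r | P i) l i.
Proof. by apply: cvg_big => //; exact: add_continuous. Qed.

(** A value rather than a structure on [V], so that one theory serves both [reip] and [hsip], whose
    definition depends on a chosen orthonormal basis. *)
Record real_ip (R : realType) (V : lmodType R) := RealIp {
  rip :> V -> V -> R;
  ripC : forall u v, rip u v = rip v u;
  rip_lin : forall a u v w, rip (a *: u + v) w = a * rip u w + rip v w;
  rip_ge0 : forall u, 0 <= rip u u;
  rip_eq0 : forall u, rip u u = 0 -> u = 0 }.

Arguments rip {R V} r u v : simpl never.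

Section RealIpTheory.
Variables (R : realType) (V : lmodType R) (B : real_ip V).
Implicit Types (u v w : V) (x : nat -> V).

Definition nrm u := Num.sqrt (B u u).

Lemma rip0l w : B 0 w = 0.
Proof.
have := rip_lin B (-1) 0 0 w; rewrite scaler0 addr0 => h.
by move: h; rewrite mulN1r addNr.
Qed.

Lemma ripDl u v w : B (u + v) w = B u w + B v w.
Proof. by have := rip_lin B 1 u v w; rewrite scale1r mul1r. Qed.

Lemma ripZl a u w : B (a *: u) w = a * B u w.
Proof. by have := rip_lin B a u 0 w; rewrite addr0 rip0l addr0. Qed.

Lemma ripNl u w : B (- u) w = - B u w.
Proof. by rewrite -scaleN1r ripZl mulN1r. Qed.

Lemma ripBl u v w : B (u - v) w = B u w - B v w.
Proof. by rewrite ripDl ripNl. Qed.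

Lemma rip0r w : B w 0 = 0. Proof. by rewrite ripC rip0l. Qed.

Lemma ripDr u v w : B w (u + v) = B w u + B w v.
Proof. by rewrite !(ripC B w) ripDl. Qed.

Lemma ripZr a u w : B w (a *: u) = a * B w u.
Proof. by rewrite !(ripC B w) ripZl. Qed.

Lemma ripNr u w : B w (- u) = - B w u.
Proof. by rewrite !(ripC B w) ripNl. Qed.

Lemma ripBr u v w : B w (u - v) = B w u - B w v.
Proof. by rewrite ripDr ripNr. Qed.

Lemma rip_suml (I : Type) (r : seq I) (P : pred I) (F : I -> V) w :
  B (\sum_(i <- r | P i) F i) w = \sum_(i <- r | P i) B (F i) w.
Proof. by elim/big_ind2 : _ => [|a b c e <- <-|]//; rewrite ?rip0l ?ripDl. Qed.

Lemma polar u v : B u v = 4^-1 * (B (u + v) (u + v) - B (u - v) (u - v)).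
Proof.
rewrite !ripDl !ripDr !ripNl !ripNr (ripC B v u).
by field.
Qed.

Lemma parallelogram u v :
  B (u + v) (u + v) + B (u - v) (u - v) = 2 * B u u + 2 * B v v.
Proof. by rewrite !ripDl !ripDr !ripNl !ripNr (ripC B v u); ring. Qed.

Lemma cauchy_schwarz u v : B u v ^+ 2 <= B u u * B v v.
Proof.
have [v0|v0] := eqVneq (B v v) 0.
  by rewrite (rip_eq0 v0) !rip0r mulr0 expr0n.
have vp : 0 < B v v by rewrite lt_neqAle eq_sym v0 rip_ge0.
(* The square norm of this vector is [B v v] times the defect in the inequality, which avoids
   dividing by [B v v]; [cauchy_schwarz_eq] reuses the vector. *)
have := rip_ge0 B (B v v *: u - B u v *: v).
rewrite !ripBl !ripBr !ripZl !ripZr (ripC B v u).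
have -> : B v v * (B v v * B u u) - B v v * (B u v * B u v)
    - (B u v * (B v v * B u v) - B u v * (B u v * B v v))
  = B v v * (B u u * B v v - B u v ^+ 2) by ring.
by rewrite pmulr_rge0// subr_ge0.
Qed.

Lemma cauchy_schwarz_eq u v : B u v ^+ 2 = B u u * B v v ->
  B v v *: u = B u v *: v.
Proof.
move=> e; apply/eqP; rewrite -subr_eq0; apply/eqP/(@rip_eq0 _ _ B).
rewrite !ripBl !ripBr !ripZl !ripZr (ripC B v u).
have -> : B v v * (B v v * B u u) - B v v * (B u v * B u v)
    - (B u v * (B v v * B u v) - B u v * (B u v * B v v))
  = B v v * (B u u * B v v - B u v ^+ 2) by ring.
by rewrite e subrr mulr0.
Qed.

(* The complex Cauchy-Schwarz inequality: for w' = i w, the left-hand side is  *)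
(* the square of the modulus of the complex inner product of u and w.         *)
Lemma cauchy_schwarz2 u w w' : B w w' = 0 -> B w' w' = B w w ->
  B u w ^+ 2 + B u w' ^+ 2 <= B u u * B w w.
Proof.
move=> ww' w'w'; set s := _ + _.
have s0 : 0 <= s by rewrite addr_ge0 ?sqr_ge0.
have := cauchy_schwarz u (B u w *: w + B u w' *: w').
rewrite ripDl !ripDr !ripZl !ripZr (ripC B w' w) ww' w'w' !mulr0 addr0 add0r.
rewrite -!expr2 !mulrA -!expr2 -mulrDl -/s.
have [->|sn0] := eqVneq s 0; first by rewrite mulr_ge0 ?rip_ge0.
by rewrite expr2 mulrCA ler_pM2l// lt_neqAle eq_sym sn0.
Qed.

(** The right-hand side [v] is [B w w] times the projection of [u] to the plane of [w] and [w']. The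
    hypothesis is then equality in the ordinary inequality for [u] and [v], from which the common
    factor [s] cancels; if [s] is zero, so are [w] and [w']. *)
Lemma cauchy_schwarz2_eq u w w' : B w w' = 0 -> B w' w' = B w w ->
  B u u != 0 -> B u w ^+ 2 + B u w' ^+ 2 = B u u * B w w ->
  B w w *: u = B u w *: w + B u w' *: w'.
Proof.
move=> ww' w'w' u0; set s := _ + _ => e.
set v := (_ + _ : V).
have uv : B u v = s by rewrite /v ripDr !ripZr -!expr2.
have vv : B v v = s * B w w.
  rewrite /v ripDl !ripDr !ripZl !ripZr (ripC B w' w) ww' w'w' !mulr0 addr0 add0r.
  by rewrite !mulrA -!expr2 -mulrDl.
have [s0|s0] := eqVneq s 0.
  move/esym/eqP : e; rewrite s0 mulf_eq0 (negbTE u0) /= => /eqP w0.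
  have w'0 : w' = 0 by apply: (@rip_eq0 _ _ B); rewrite w'w'.
  by rewrite w0 scale0r /v (rip_eq0 w0) w'0 !scaler0 addr0.
have := @cauchy_schwarz_eq u v; rewrite uv vv => h.
have /h : s ^+ 2 = B u u * (s * B w w) by rewrite mulrCA -e expr2.
by rewrite -scalerA => /(scalerI s0).
Qed.

Lemma nrm_ge0 u : 0 <= nrm u. Proof. exact: sqrtr_ge0. Qed.

Lemma sqr_nrm u : nrm u ^+ 2 = B u u.
Proof. by rewrite sqr_sqrtr// rip_ge0. Qed.

Lemma nrm0 : nrm 0 = 0. Proof. by rewrite /nrm rip0l sqrtr0. Qed.

Lemma nrm_eq0 u : nrm u = 0 -> u = 0.
Proof. by move=> u0; apply: (@rip_eq0 _ _ B); rewrite -sqr_nrm u0 expr0n. Qed.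

Lemma nrm_le u M : 0 <= M -> (nrm u <= M) = (B u u <= M ^+ 2).
Proof. by move=> M0; rewrite -sqr_nrm ler_sqr ?nnegrE ?nrm_ge0. Qed.

Lemma nrmZ a u : nrm (a *: u) = `|a| * nrm u.
Proof.
by rewrite /nrm ripZl ripZr mulrA -expr2 sqrtrM ?sqr_ge0// sqrtr_sqr.
Qed.

Lemma nrmN u : nrm (- u) = nrm u.
Proof. by rewrite -scaleN1r nrmZ normrN1 mul1r. Qed.

Lemma nrm_distC u v : nrm (u - v) = nrm (v - u).
Proof. by rewrite -nrmN opprB. Qed.

Lemma normr_rip u v : `|B u v| <= nrm u * nrm v.
Proof.
rewrite -(ler_sqr (x := `|B u v|)) ?nnegrE ?mulr_ge0 ?nrm_ge0//.
by rewrite exprMn !sqr_nrm -normrX ger0_norm ?sqr_ge0// cauchy_schwarz.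
Qed.

Lemma nrmD u v : nrm (u + v) <= nrm u + nrm v.
Proof.
rewrite nrm_le ?addr_ge0 ?nrm_ge0// ripDl !ripDr (ripC B v u) sqrrD !sqr_nrm.
have := le_trans (ler_norm _) (normr_rip u v).
by move: (nrm u * nrm v) => c ?; rewrite mulr2n; lra.
Qed.

Lemma nrm_tri w u v : nrm (u - v) <= nrm (u - w) + nrm (w - v).
Proof. by rewrite -[u - v](subrKA w) nrmD. Qed.

Definition ip_cvg x v := nrm (x n - v) @[n --> \oo] --> 0.

Lemma ip_cvgP x v : ip_cvg x v <->
  forall e, 0 < e -> exists N, forall n, (N <= n)%N -> nrm (x n - v) < e.
Proof.
split=> [/cvgrPdist_lt h e e0|h].
  have [N _ hN] := h e e0; exists N => n /hN /=.
  by rewrite sub0r normrN ger0_norm// nrm_ge0.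
apply/cvgrPdist_lt => e e0; have [N hN] := h e e0.
by exists N => // n /hN /=; rewrite sub0r normrN ger0_norm// nrm_ge0.
Qed.

Lemma ip_cvg_rip x v w : ip_cvg x v -> B (x n) w @[n --> \oo] --> B v w.
Proof.
move=> h; apply/cvgrPdist_le => e e0.
have [N hN] := (ip_cvgP x v).1 h (e / (nrm w + 1))
  (divr_gt0 e0 (ltr_wpDl (nrm_ge0 w) ltr01)).
exists N => // n /hN /ltW /= hn; rewrite distrC -ripBl.
apply: (le_trans (normr_rip _ _)).
apply: (@le_trans _ _ (e / (nrm w + 1) * (nrm w + 1))); last first.
  by rewrite divfK// gt_eqF// ltr_wpDl// nrm_ge0.
by apply: ler_pM; rewrite ?nrm_ge0// lerDl.
Qed.

Lemma ip_cvg_sqr x v : ip_cvg x v -> B (x n) (x n) @[n --> \oo] --> B v v.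
Proof.
move=> h; have hn : nrm (x n) @[n --> \oo] --> nrm v.
  apply/cvgrPdist_lt => e e0; have [N hN] := (ip_cvgP x v).1 h e e0.
  exists N => // n /hN /= hn; rewrite ltr_norml.
  have := nrm_tri (x n) v 0; have := nrm_tri v (x n) 0; rewrite !subr0.
  by rewrite (nrm_distC v); lra.
rewrite -sqr_nrm; under eq_fun do rewrite -sqr_nrm.
by rewrite expr2; under eq_fun do rewrite expr2; exact: cvgM.
Qed.

Lemma ip_cvg_unique x v w : ip_cvg x v -> ip_cvg x w -> v = w.
Proof.
move=> hv hw; apply/eqP; rewrite -subr_eq0; apply/eqP/nrm_eq0/eqP.
rewrite eq_le nrm_ge0 andbT; apply/ler_addgt0Pr => e e0; rewrite add0r.
have e2 : 0 < e / 2 by rewrite divr_gt0.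
have [N hN] := (ip_cvgP _ _).1 hv _ e2; have [M hM] := (ip_cvgP _ _).1 hw _ e2.
have := hN (N + M)%N (leq_addr _ _); have := hM (N + M)%N (leq_addl _ _).
by have := nrm_tri (x (N + M)%N) v w; rewrite (nrm_distC v (x _)); lra.
Qed.

Lemma ip_cvgZ a x v : ip_cvg x v -> ip_cvg (fun n => a *: x n) (a *: v).
Proof.
rewrite /ip_cvg => h; under eq_fun do rewrite -scalerBr nrmZ.
have : `|a| * nrm (x n - v) @[n --> \oo] --> `|a| * 0.
  by apply: cvgM => //; exact: cvg_cst.
by rewrite mulr0.
Qed.

Lemma ip_cvg_lin a x y v w : ip_cvg x v -> ip_cvg y w ->
  ip_cvg (fun n => a *: x n + y n) (a *: v + w).
Proof.
move=> xv yw; apply/ip_cvgP => e e0.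
have a1 : 0 < `|a| + 1 by rewrite ltr_wpDl.
have [N hN] := (ip_cvgP _ _).1 xv _ (divr_gt0 (divr_gt0 e0 (ltr0Sn R 1)) a1).
have [M hM] := (ip_cvgP _ _).1 yw _ (divr_gt0 e0 (ltr0Sn R 1)).
exists (maxn N M) => n; rewrite geq_max => /andP[/hN hn /hM hm].
have -> : a *: x n + y n - (a *: v + w) = a *: (x n - v) + (y n - w).
  by rewrite scalerBr opprD addrACA.
apply: (le_lt_trans (nrmD _ _)); rewrite nrmZ.
suff : `|a| * nrm (x n - v) <= e / 2 by lra.
move: hn; rewrite ltr_pdivlMr// => /ltW; apply: le_trans.
by rewrite mulrC ler_wpM2l ?nrm_ge0// lerDl.
Qed.

Lemma fast_dist x : (forall k, nrm (x k.+1 - x k) <= 2^-1 ^+ k) ->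
  forall k m, nrm (x (k + m)%N - x k) <= 2 * 2^-1 ^+ k.
Proof.
move=> xk k m; have p2 j : 0 <= (2^-1 : R) ^+ j by rewrite exprn_ge0// invr_ge0.
have : nrm (x (k + m)%N - x k) <= 2 * 2^-1 ^+ k * (1 - 2^-1 ^+ m).
  elim: m => [|m IH].
    by rewrite addn0 subrr nrm0 expr0 subrr mulr0.
  rewrite addnS; apply: (le_trans (nrm_tri (x (k + m)%N) _ _)).
  apply: (le_trans (lerD (xk _) IH)).
  rewrite exprS exprD le_eqVlt; apply/orP; left; apply/eqP.
  by field.
by move/le_trans; apply; rewrite ler_piMr ?mulr_ge0// gerBl.
Qed.

Lemma ip_cvg_bound x v M : ip_cvg x v ->
  (\forall n \near \oo, nrm (x n) <= M) -> nrm v <= M.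
Proof.
move=> /ip_cvgP h [K _ hK]; apply/ler_addgt0Pr => e e0.
have [N hN] := h e e0; have := hN (N + K)%N (leq_addr _ _).
have := hK (N + K)%N (leq_addl _ _) => /=.
have := nrm_tri (x (N + K)%N) v 0; rewrite !subr0 (nrm_distC v); lra.
Qed.

(** Completeness for rapidly Cauchy sequences only: these are the ones for which almost everywhere
    convergence can be shown directly. The general case is [cauchy_ip_cvg]. *)
Definition ip_complete := forall x,
  (forall k, nrm (x k.+1 - x k) <= 2^-1 ^+ k) -> exists v, ip_cvg x v.

Lemma cauchy_ip_cvg x : ip_complete ->
  (forall e, 0 < e -> exists N, forall m n, (N <= m)%N -> (N <= n)%N ->
    nrm (x m - x n) < e) ->
  exists v, ip_cvg x v.
Proof.
move=> cpl cx.
have e2 k : 0 < (2^-1 : R) ^+ k by rewrite exprn_gt0// invr_gt0.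
pose N k := projT1 (cid (cx _ (e2 k))).
have NP k m n : (N k <= m)%N -> (N k <= n)%N -> nrm (x m - x n) < 2^-1 ^+ k.
  by rewrite /N; case: cid => //= K; exact.
(* Summing the thresholds makes the chosen indices nondecreasing while keeping [s k] above [N k]. *)
pose s k := \sum_(i < k.+1) N i.
have sN k : (N k <= s k)%N by rewrite /s big_ord_recr/= leq_addl.
have [|v hv] := cpl (x \o s).
  move=> k; rewrite ltW// NP// (leq_trans (sN k))//.
  by rewrite [leqRHS]/s big_ord_recr/= leq_addr.
exists v; apply/ip_cvgP => e e0.
have [K hK] := (ip_cvgP _ _).1 hv _ (divr_gt0 e0 (ltr0Sn R 1)).
have [K' hK'] : exists K', (2^-1 : R) ^+ K' < e / 2.
  have /cvgrPdist_lt/(_ _ (divr_gt0 e0 (ltr0Sn R 1))) :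
      ((2^-1 : R) ^+ n) @[n --> \oo] --> 0.
    by apply: cvg_expr; rewrite ger0_norm ?invr_ge0// invf_lt1// ltr1n.
  move=> [M _ hM]; exists M; have := hM M (leqnn M) => /=.
  by rewrite sub0r normrN ger0_norm// ltW.
exists (N (K + K')%N) => n hn.
have h1 := hK (K + K')%N (leq_addr _ _).
have h2 := NP (K + K')%N n (s (K + K')%N) hn (sN _).
have h3 : (2^-1 : R) ^+ (K + K') <= 2^-1 ^+ K'.
  by rewrite addnC ler_wiXn2l// ?leq_addr// ?invr_ge0// invf_le1// ler1n.
have := nrm_tri (x (s (K + K')%N)) (x n) v.
move: h1 h2 h3 hK' => /=; lra.
Qed.

End RealIpTheory.
Arguments ip_cvg_rip {R V B x v} w.

(** * Orthonormal sequences: Riesz--Fischer, Parseval and Riesz representation *)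

Section Orthonormal.
Variables (R : realType) (V : lmodType R) (B : real_ip V).
Implicit Types (u v w : V) (x : nat -> V) (c : nat -> R).

(* The nonzero members of the sequence are orthonormal; allowing zeros avoids *)
(* reindexing when the natural index set is not nat.                          *)
Definition orthonormal0 (b : nat -> V) :=
  forall m n, B (b m) (b n) = ((m == n) && (b n != 0))%:R.

Definition ip_total (b : nat -> V) :=
  forall u, (forall n, B u (b n) = 0) -> u = 0.

Variable b : nat -> V.
Hypothesis ob : orthonormal0 b.

Definition psum c N := \sum_(n < N) c n *: b n.

Lemma psum_rip c N m : B (psum c N) (b m) = (m < N)%:R * c m * (b m != 0)%:R.
Proof.
rewrite /psum rip_suml.
under eq_bigr => i _ do rewrite ripZl ob.
case: ltnP => [mN|Nm].
  rewrite (bigD1 (Ordinal mN))//= eqxx andTb big1 ?addr0 ?mul1r// => i.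
  by move=> /negP im; case: eqP => [e|_]; rewrite ?mulr0//; case: im; apply/eqP/val_inj.
rewrite big1 ?mul0r// => i _; rewrite (_ : (i == m :> nat) = false) ?mulr0//.
by apply/negbTE; rewrite neq_ltn (leq_trans (ltn_ord i) Nm).
Qed.

Lemma psum_sqr c N : (forall n, b n = 0 -> c n = 0) ->
  B (psum c N) (psum c N) = \sum_(n < N) c n ^+ 2.
Proof.
move=> c0; rewrite {1}/psum rip_suml; apply: eq_bigr => i _.
rewrite ripZl ripC psum_rip ltn_ord mul1r.
by have [/c0 ->|_] := eqVneq (b i) 0; rewrite ?mul0r ?expr0n// mulr1 expr2.
Qed.

(** A difference of partial sums is itself a partial sum with truncated coefficients, so [psum_sqr]
    computes its norm. *)
Lemma psumB c m n : (m <= n)%N ->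
  psum c n - psum c m = psum (fun k => (m <= k)%:R * c k) n.
Proof.
move=> mn; rewrite /psum -(big_mkord xpredT (fun k => c k *: b k)).
rewrite -(big_mkord xpredT (fun k => c k *: b k)).
rewrite -(big_mkord xpredT (fun k => ((m <= k)%:R * c k) *: b k)).
rewrite (big_cat_nat (leq0n m) mn)//= addrAC subrr add0r.
rewrite [RHS](big_cat_nat (leq0n m) mn)//= [X in _ = X + _]big1_seq ?add0r.
  by apply: eq_big_nat => k /andP[-> _]; rewrite mul1r.
by move=> k; rewrite mem_index_iota /= ltnNge => /negbTE ->; rewrite mul0r scale0r.
Qed.

Hypothesis cpl : ip_complete B.

(** By orthogonality the squared distance of two partial sums is a difference of partial sums of the
    convergent series of the [c n ^+ 2], so they form a Cauchy sequence. The first hypothesis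
    handles the zero members of [b]. *)
Lemma riesz_fischer c M : (forall n, b n = 0 -> c n = 0) ->
  (forall N, \sum_(n < N) c n ^+ 2 <= M) ->
  exists w, [/\ forall n, B w (b n) = c n, B w w <= M & ip_cvg B (psum c) w].
Proof.
move=> c0 cM; pose s N := \sum_(n < N) c n ^+ 2.
have s_nd : nondecreasing_seq s.
  by apply/nondecreasing_seqP => n; rewrite /s big_ord_recr/= lerDl sqr_ge0.
have scvg : cvgn s.
  by apply: nondecreasing_is_cvgn => //; exists M => _ [n _ <-]; exact: cM.
have dist m n : (m <= n)%N -> nrm B (psum c n - psum c m) ^+ 2 = s n - s m.
  move=> mn; rewrite sqr_nrm psumB// psum_sqr.
    rewrite /s -(big_mkord xpredT (fun k => c k ^+ 2)).
    rewrite -(big_mkord xpredT (fun k => c k ^+ 2)).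
    rewrite -(big_mkord xpredT (fun k => ((m <= k)%:R * c k) ^+ 2)).
    rewrite !(big_cat_nat (leq0n m) mn)//= big1_seq ?add0r.
      rewrite addrAC subrr add0r; apply: eq_big_nat => k /andP[-> _].
      by rewrite mul1r.
    move=> k; rewrite mem_index_iota /= ltnNge => /negbTE ->.
    by rewrite mul0r expr0n.
  by move=> k /c0 ->; rewrite mulr0.
have [|w hw] := cauchy_ip_cvg (x := psum c) cpl.
  move=> e e0; have e2 : 0 < e ^+ 2 / 2 by rewrite divr_gt0// exprn_gt0.
  move/cvgrPdist_lt : scvg => /(_ _ e2)[N _ hN]; exists N.
  have aux m n : (m <= n)%N -> (N <= m)%N -> (N <= n)%N ->
      nrm B (psum c n - psum c m) < e.
    move=> mn Nm Nn.
    rewrite -(ltr_sqr (x := nrm B _)) ?nnegrE ?nrm_ge0 ?(ltW e0)// dist//.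
    have := hN _ Nm; have := hN _ Nn => /=; rewrite !ltr_norml.
    by move=> /andP[? ?] /andP[? ?]; lra.
  move=> m n Nm Nn; have [mn|/ltnW nm] := leqP m n; last exact: aux.
  by rewrite nrm_distC aux.
exists w; split => //.
- move=> n; rewrite -(cvg_lim (@Rhausdorff R) (ip_cvg_rip (b n) hw)).
  apply: cvg_lim => //; apply: cvg_near_cst; exists n.+1 => // N /= nN.
  rewrite psum_rip nN mul1r; have [/c0 ->|_] := eqVneq (b n) 0.
    by rewrite mul0r.
  by rewrite mulr1.
- have M0 : 0 <= M by have := cM 0%N; rewrite big_ord0.
  rewrite -(sqr_sqrtr M0) -nrm_le ?sqrtr_ge0//.
  apply: (ip_cvg_bound hw); apply: nearW => n.
  by rewrite nrm_le ?sqrtr_ge0// sqr_sqrtr// psum_sqr.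
Qed.

Hypothesis tb : ip_total b.

Definition fourier u n := B u (b n).

Lemma fourier0 u n : b n = 0 -> fourier u n = 0.
Proof. by rewrite /fourier => ->; rewrite rip0r. Qed.

Lemma rip_psum u c N : B u (psum c N) = \sum_(n < N) c n * B u (b n).
Proof.
rewrite ripC rip_suml; apply: eq_bigr => i _.
by rewrite ripZl (ripC B (b i)).
Qed.

Lemma bessel u N : \sum_(n < N) fourier u n ^+ 2 <= B u u.
Proof.
have := rip_ge0 B (u - psum (fourier u) N).
rewrite !ripBl !ripBr (ripC B _ u) rip_psum psum_sqr; last exact: fourier0.
have -> : \sum_(n < N) fourier u n * B u (b n) = \sum_(n < N) fourier u n ^+ 2.
  by apply: eq_bigr => i _; rewrite expr2.
lra.
Qed.

Lemma psum_cvg u : ip_cvg B (psum (fourier u)) u.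
Proof.
have [w [wb _ wc]] := riesz_fischer (@fourier0 u) (bessel u).
suff uw : u = w by rewrite [X in ip_cvg _ _ X]uw.
apply/eqP; rewrite -subr_eq0; apply/eqP/tb => n.
by rewrite ripBl wb subrr.
Qed.

Lemma parseval u v :
  \sum_(n < N) B u (b n) * B v (b n) @[N --> \oo] --> B u v.
Proof.
have := ip_cvg_rip v (psum_cvg u).
apply: cvg_trans; apply: near_eq_cvg; apply: nearW => N /=.
by rewrite [LHS]ripC rip_psum.
Qed.

(** The representing vector has coefficients [f (b n)]. At the partial sum with these coefficients
    [f] takes the value $s$, the sum of their squares, so $s\le M\sqrt{s}$ and they are
    square-summable. Continuity of [f] along Fourier sums gives the identity. *)
Lemma riesz_representation (f : V -> R) M :
  (forall a u v, f (a *: u + v) = a * f u + f v) ->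
  (forall u, `|f u| <= M * nrm B u) ->
  exists w, forall u, f u = B u w.
Proof.
move=> fl fM.
have f0 : f 0 = 0.
  by have := fl (-1) 0 0; rewrite scaler0 addr0 => h; move: h; rewrite mulN1r addNr.
have fsum c N : f (psum c N) = \sum_(n < N) c n * f (b n).
  rewrite /psum; elim/big_ind2 : _ => //[x1 x2 y1 y2 <- <-|i _].
    by have := fl 1 x2 y2; rewrite scale1r mul1r.
  by have := fl (c i) (b i) 0; rewrite !addr0 f0 addr0.
have c0 n : b n = 0 -> f (b n) = 0 by move=> ->.
have [|w [wb _ _]] := riesz_fischer (M := M ^+ 2) c0.
  move=> N; set s := \sum_(n < N) _.
  have s0 : 0 <= s by apply: sumr_ge0 => i _; exact: sqr_ge0.
  have : s <= M * Num.sqrt s.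
    have := le_trans (ler_norm _) (fM (psum (f \o b) N)).
    by rewrite fsum /nrm psum_sqr.
  have [->|s1] := eqVneq s 0; first by rewrite sqr_ge0.
  have sp : 0 < Num.sqrt s by rewrite sqrtr_gt0 lt_neqAle eq_sym s1.
  rewrite -{1}(sqr_sqrtr s0) expr2 ler_pM2r// => h.
  by rewrite -(sqr_sqrtr s0) ler_sqr// nnegrE ?(le_trans _ h) ?sqrtr_ge0.
exists w => u; rewrite ripC.
have h1 : f (psum (fourier u) N) @[N --> \oo] --> f u.
  apply/cvgrPdist_lt => e e0.
  have M1 : 0 < `|M| + 1 by rewrite ltr_wpDl.
  have [N hN] := (ip_cvgP _ _ _).1 (psum_cvg u) _ (divr_gt0 e0 M1).
  exists N => // n /hN /= hn; rewrite distrC.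
  have -> : f (psum (fourier u) n) - f u = f (psum (fourier u) n - u).
    by rewrite [X in _ = f X]addrC -[- u]scaleN1r fl mulN1r addrC.
  apply: (le_lt_trans (fM _)); rewrite ltr_pdivlMr// mulrC in hn.
  apply: le_lt_trans hn; rewrite ler_wpM2r ?nrm_ge0//.
  by rewrite (le_trans (ler_norm _))// lerDl.
have h2 := ip_cvg_rip w (psum_cvg u).
rewrite ripC -(cvg_lim (@Rhausdorff R) h1) -(cvg_lim (@Rhausdorff R) h2); congr (lim (_ @ \oo)).
apply/funext => N; rewrite fsum [RHS]ripC rip_psum.
by apply: eq_bigr => i _; rewrite wb.
Qed.

End Orthonormal.
Arguments parseval {R V B b} _ _ _ u v.

(** * The uniform boundedness principle *)

Section UniformBoundedness.
Variables (R : realType) (V : lmodType R) (B : real_ip V).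
Hypothesis cpl : ip_complete B.

Let third : R := 3^-1.

(* Sokal's gliding hump: [y k.+1] moves [y k] by [3^-k] in the direction of   *)
(* [x k], with the sign that makes [B (x k) (y k.+1)] large; the later moves  *)
(* are too small to undo this.                                                *)
Let sgn1 (r : R) : R := if 0 <= r then 1 else -1.

Let hump (x : nat -> V) := fix F k : V :=
  if k is k'.+1 then
    F k' + (sgn1 (B (x k') (F k')) * third ^+ k' * (nrm B (x k'))^-1) *: x k'
  else 0.

Lemma uniform_boundedness (x : nat -> V) :
  (forall y, exists M, forall n, `|B (x n) y| <= M) ->
  exists M, forall n, nrm B (x n) <= M.
Proof.
move=> bx; apply: contrapT => /forallNP ub.
(* The step of length $3^{-k}$ makes the pairing with [y k.+1] at least $2(k+1)$ in modulus. The
   later steps have total length at most $3^{-k}/2$ and can destroy at most half of the guaranteed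
   size, so at least $k+1$ remains at the limit. *)
have {}ub k : {n | (k.+1%:R * 2 * 3 ^+ k) < nrm B (x n)}.
  apply: cid; have /existsNP[n] := ub (k.+1%:R * 2 * 3 ^+ k).
  by move=> /negP; rewrite -ltNge; exists n.
pose z k := x (projT1 (ub k)).
have zb k : k.+1%:R * 2 * 3 ^+ k < nrm B (z k) := projT2 (ub k).
have z0 k : 0 < nrm B (z k) by rewrite (le_lt_trans _ (zb k)).
have t0 k : 0 < third ^+ k by rewrite exprn_gt0// invr_gt0.
pose y := hump z.
have step k : nrm B (y k.+1 - y k) = third ^+ k.
  rewrite /= addrC addKr nrmZ !normrM normfV (ger0_norm (ltW (z0 k))).
  rewrite (ger0_norm (ltW (t0 k))) divfK ?gt_eqF//.
  by rewrite /sgn1; case: ifP; rewrite ?normrN normr1 mul1r.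
have big k : third ^+ k * nrm B (z k) <= `|B (z k) (y k.+1)|.
  rewrite /= ripDr ripZr -sqr_nrm -/(y k) expr2 !mulrA divfK ?gt_eqF//.
  have pos : 0 <= third ^+ k * nrm B (z k) by rewrite mulr_ge0 ?ltW.
  rewrite /sgn1; case: ifP => [h|/negbT]; rewrite -?ltNge ?mul1r.
    by rewrite (le_trans _ (ler_norm _))// lerDr.
  move=> h; rewrite -normrN opprD (le_trans _ (ler_norm _))//.
  by rewrite mulN1r mulNr opprK lerDr oppr_ge0 ltW.
have [|w hw] := cpl (x := y).
  move=> k; rewrite step lerXn2r ?nnegrE ?invr_ge0//.
  by rewrite lef_pV2 ?posrE// ler_nat.
have tail k m : nrm B (y (k + m)%N.+1 - y k.+1) <= third ^+ k / 2 * (1 - third ^+ m).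
  elim: m => [|m IH].
    by rewrite addn0 subrr nrm0 expr0 subrr mulr0.
  rewrite addnS; apply: (le_trans (nrm_tri B (y (k + m)%N.+1) _ _)).
  rewrite step; apply: (le_trans (lerD (lexx _) IH)).
  have t3 : third * 3 = 1 by rewrite mulVf.
  rewrite !exprS exprD.
  move: (third ^+ k) (third ^+ m) t3 => p q; move: third => t t3; nra.
have tailw k : nrm B (w - y k.+1) <= third ^+ k / 2.
  have : ip_cvg B (fun n => y n - y k.+1) (w - y k.+1).
    by rewrite /ip_cvg; under eq_fun do rewrite opprB addrA subrK.
  move/ip_cvg_bound; apply; exists k.+1 => // n /= kn.
  rewrite -(subnKC kn) addSn; apply: (le_trans (tail _ _)).
  by rewrite ler_piMr ?gerBl ?divr_ge0// ltW.
have [M hM] := bx w.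
have [k hk] : exists k, M < k.+1%:R.
  by exists (Num.truncn M); rewrite truncnS_gt.
have := le_lt_trans (hM (projT1 (ub k))) hk; rewrite -/(z k).
suff : k.+1%:R <= `|B (z k) w| by lra.
have h1 := big k; have h2 : `|B (z k) (w - y k.+1)| <= nrm B (z k) * (third ^+ k / 2).
  by rewrite (le_trans (normr_rip _ _ _))// ler_wpM2l// ltW.
have h3 : `|B (z k) (y k.+1)| <= `|B (z k) w| + `|B (z k) (w - y k.+1)|.
  by move: (y k.+1) => t; rewrite ripBr -{1}(subKr (B (z k) w) (B (z k) t)) ler_normB.
have h4 : k.+1%:R * 2 <= third ^+ k * nrm B (z k).
  apply: (le_trans _ (ler_wpM2l (ltW (t0 k)) (ltW (zb k)))).
  by rewrite mulrCA -exprMn mulVf// expr1n mulr1.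
rewrite -/(y k.+1) in h1 h2 h3.
move: h1 h2 h3 h4; rewrite (mulrC (nrm B _)) mulrAC.
move: (third ^+ k * _) => p; lra.
Qed.

End UniformBoundedness.

(** * Weak sequential compactness of balls *)

Section WeakCompactness.
Variables (R : realType) (V : lmodType R) (B : real_ip V) (b : nat -> V).
Hypotheses (cpl : ip_complete B) (ob : orthonormal0 B b) (tb : ip_total B b).

(* The sequences of Fourier coefficients lie in a product of compact intervals; *)
(* Tychonoff's theorem replaces the usual diagonal argument.                    *)
Lemma coef_cluster (x : nat -> V) M : (forall n, nrm B (x n) <= M) ->
  exists c (phi : nat -> nat), (forall k, (k <= phi k)%N) /\
    forall n, B (x (phi k)) (b n) @[k --> \oo] --> (c n : R).
Proof.
move=> xM.
have b1 n : nrm B (b n) <= 1.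
  by rewrite nrm_le// ob expr1n; case: (_ && _).
pose f k : prod_topology (fun _ : nat => R) := fun n => B (x k) (b n).
have ct := @tychonoff nat (fun=> R) (fun=> `[-M, M]%classic)
  (fun=> @segment_compact R _ _).
have pf : ProperFilter (f @ \oo) by exact: fmap_proper_filter.
have [|c [_ cc]] := ct (f @ \oo) pf.
  exists 0%N => // k _ n /=; rewrite in_itv/= -ler_norml.
  apply: (le_trans (normr_rip _ _ _)).
  by rewrite -[M]mulr1 ler_pM ?nrm_ge0.
(* Constraining only the first [k] coordinates gives a neighbourhood in the product topology, which
   the cluster point lets the sequence revisit beyond index [k]. *)
have near_c k : exists l, (k <= l)%N /\
    forall n, (n < k)%N -> `|f l n - c n| < k.+1%:R^-1.
  have e0 : 0 < k.+1%:R^-1 :> R by rewrite invr_gt0.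
  pose nc : set_system (nat -> R) := nbhs (c : prod_topology (fun _ : nat => R)).
  have Fnc : Filter nc.
    by apply: (@filter_filter _ _ (@nbhs_pfilter (prod_topology (fun _ : nat => R)) c)).
  have nb j : nc
      [set g | forall n, (n < j)%N -> `|g n - c n| < k.+1%:R^-1].
    elim: j => [|j IH].
      have -> : [set g : nat -> R | forall n, (n < 0)%N ->
          `|g n - c n| < k.+1%:R^-1] = setT by rewrite predeqE.
      exact: filterT.
    have pj := @proj_continuous nat (fun=> R) j c _ (nbhsx_ballx (c j) _ e0).
    apply: filterS (filterI IH pj) => g [hg gj] n.
    by rewrite ltnS leq_eqVlt => /orP[/eqP ->|/hg//]; rewrite distrC.
  have [|_ [[l /= kl <-] hl]] := cc [set f l | l in [set l | (k <= l)%N]] _ _ (nb k).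
    by exists k => // l /= kl; exists l.
  by exists l.
have [phi hphi] := choice near_c.
exists c, phi; split=> [k|n]; first by have [] := hphi k.
apply/cvgrPdist_lt => e e0.
have : (k.+1%:R^-1 : R) @[k --> \oo] --> 0 by exact: cvg_harmonic.
move=> /cvgrPdist_lt/(_ _ e0)[N _ hN].
exists (maxn N n.+1) => // k /=; rewrite geq_max => /andP[Nk nk].
have [_ /(_ n nk)] := hphi k; rewrite distrC => /lt_trans; apply.
by have := hN k Nk; rewrite /= sub0r normrN ger0_norm// invr_ge0.
Qed.

(** Bessel's inequality passes to the limit coefficients, so Riesz--Fischer makes them a vector [v].
    Against a general [y], replace [y] by a finite Fourier sum. Here [phi] need not be increasing:
    [k <= phi k] suffices to transfer limits. *)
Lemma weak_compactness (x : nat -> V) M : (forall n, nrm B (x n) <= M) ->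
  exists v (phi : nat -> nat), [/\ forall k, (k <= phi k)%N, nrm B v <= M &
    forall y, B (x (phi k)) y @[k --> \oo] --> B v y].
Proof.
move=> xM; have M0 : 0 <= M by rewrite (le_trans _ (xM 0%N))// nrm_ge0.
have [c [phi [phik hc]]] := coef_cluster xM.
have c0 n : b n = 0 -> c n = 0.
  move=> bn; rewrite -(cvg_lim (@Rhausdorff R) (hc n)).
  by apply: cvg_lim => //; under eq_fun do rewrite bn rip0r; exact: cvg_cst.
have cM N : \sum_(n < N) c n ^+ 2 <= M ^+ 2.
  have h : \sum_(n < N) fourier B b (x (phi k)) n ^+ 2 @[k --> \oo]
      --> \sum_(n < N) c n ^+ 2.
    apply: cvg_sumR => n _; rewrite expr2; under eq_fun do rewrite expr2.
    by apply: cvgM; exact: hc.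
  rewrite -(cvg_lim (@Rhausdorff R) h); apply: limr_le; first exact: cvgP h.
  apply: nearW => k; rewrite (le_trans (bessel ob _ _))//.
  by rewrite -nrm_le.
have [v [vb vM vc]] := riesz_fischer ob cpl c0 cM.
exists v, phi; split => [//||y]; first by rewrite nrm_le.
apply/cvgrPdist_lt => e e0.
(* The difference of [v] and [x (phi k)] has norm at most [2 * M], so an error of $e/(4(M+1))$ in
   [y] costs at most $e/2$; the added $1$ covers [M = 0]. *)
have M1 : 0 < 4 * (M + 1) by rewrite mulr_gt0// ltr_wpDl.
have [N hN] := (ip_cvgP _ _ _).1 (psum_cvg ob cpl tb y) _ (divr_gt0 e0 M1).
have {}hN := hN N (leqnn N); set s := psum _ _ N in hN.
have : B (x (phi k)) s @[k --> \oo] --> B v s.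
  under eq_fun do rewrite rip_psum; rewrite rip_psum.
  apply: cvg_sumR => n _; apply: cvgM; first exact: cvg_cst.
  by rewrite vb; exact: hc.
move=> /cvgrPdist_lt/(_ _ (divr_gt0 e0 (ltr0Sn R 1)))[K _ hK].
exists K => // k /hK /= {}hK.
have -> : B v y - B (x (phi k)) y =
    (B v s - B (x (phi k)) s) + B (v - x (phi k)) (y - s).
  by rewrite !ripBr !ripBl; ring.
apply: (le_lt_trans (ler_normD _ _)).
suff : `|B (v - x (phi k)) (y - s)| <= e / 2 by lra.
apply: (le_trans (normr_rip _ _ _)).
have h2 : nrm B (v - x (phi k)) <= 2 * M.
  rewrite (le_trans (nrmD _ _ _))// nrmN; have := xM (phi k).
  have : nrm B v <= M by rewrite nrm_le.
  lra.
rewrite nrm_distC in hN.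
apply: (@le_trans _ _ (2 * M * (e / (4 * (M + 1))))).
  by rewrite ler_pM ?nrm_ge0// ltW.
rewrite mulrA ler_pdivrMr//.
nra.
Qed.

End WeakCompactness.

(** * The Hilbert space L^2 *)

Section NonnegSeries.
Variable R : realType.
Implicit Type a : nat -> R.

Lemma nneseries_cvg_fine a : (forall n, 0 <= a n) ->
  (\sum_(0 <= n <oo) (a n)%:E < +oo)%E ->
  series a @ \oo --> fine (\sum_(0 <= n <oo) (a n)%:E)%E.
Proof.
move=> a0 afin.
have -> : series a = fine \o (fun n => \sum_(0 <= i < n) (a i)%:E)%E.
  by apply/funext => n /=; rewrite /series/= sumEFin.
apply: fine_cvg; rewrite fineK; last first.
  rewrite ge0_fin_numE//; apply: nneseries_ge0 => n _ _.
  by rewrite lee_fin.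
have h n : (0 <= n)%N -> true -> (0 <= (a n)%:E)%E by rewrite lee_fin.
exact: (is_cvg_nneseries h).
Qed.

Lemma nneseries_le_bound (u : nat -> \bar R) M : (forall n, 0 <= u n)%E ->
  (forall N, \sum_(n < N) u n <= M)%E -> (\sum_(0 <= n <oo) u n <= M)%E.
Proof.
move=> u0 uM; apply: lime_le; first exact: is_cvg_nneseries.
by apply: nearW => N; rewrite big_mkord.
Qed.

Lemma cvg_nneseries a l : (forall n, 0 <= a n) -> series a @ \oo --> l ->
  (\sum_(0 <= n <oo) (a n)%:E)%E = l%:E.
Proof.
move=> a0 al; apply/cvg_lim => //.
have -> : (fun n => \sum_(0 <= i < n) (a i)%:E)%E = EFin \o series a.
  by apply/funext => n /=; rewrite /series/= sumEFin.
by apply/cvg_EFin => //; apply: nearW.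
Qed.

End NonnegSeries.

Lemma normc_ge0 (R : realType) (z : R[i]) : 0 <= Normc.normc z.
Proof. by case: z => x y; exact: sqrtr_ge0. Qed.

Section ComplexMeasurable.
Context (R : realType) (d1 : measure_display) (T : measurableType d1).
Implicit Types f g : T -> R[i].

Definition mfunc f := measurable_fun setT (fun x => complex.Re (f x)) /\
  measurable_fun setT (fun x => complex.Im (f x)).

Lemma mfuncB f g : mfunc f -> mfunc g -> mfunc (fun x => f x - g x).
Proof.
move=> [f1 f2] [g1 g2]; split; under eq_fun do rewrite raddfB;
exact: measurable_funB.
Qed.

Lemma mfuncM f g : mfunc f -> mfunc g -> mfunc (fun x => f x * g x).
Proof.
move=> [f1 f2] [g1 g2].
have er x : complex.Re (f x * g x) =
  complex.Re (f x) * complex.Re (g x) - complex.Im (f x) * complex.Im (g x).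
  by case: (f x) (g x) => [? ?] [? ?].
have ei x : complex.Im (f x * g x) =
  complex.Re (f x) * complex.Im (g x) + complex.Im (f x) * complex.Re (g x).
  by case: (f x) (g x) => [? ?] [? ?].
split; [under eq_fun do rewrite er|under eq_fun do rewrite ei].
  by apply: measurable_funB; exact: measurable_funM.
by apply: measurable_funD; exact: measurable_funM.
Qed.

Lemma mfunc_conj f : mfunc f -> mfunc (fun x => (f x)^*).
Proof.
move=> [f1 f2]; split.
  have e x : complex.Re (f x)^* = complex.Re (f x) by case: (f x).
  by under eq_fun do rewrite e.
have e x : complex.Im (f x)^* = - complex.Im (f x) by case: (f x).
by under eq_fun do rewrite e; exact: measurable_funN.
Qed.

End ComplexMeasurable.

(** * Representatives of classes and sesquilinearity of the inner product *)

Section L2Theory.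
Variables (R : realType) (d : nat).
Local Notation C := R[i].
Local Notation mu := (leb R d).
Local Notation H := (L2 R d).
Implicit Types (f g : euclid R d -> C) (u v w : H).

Lemma normc2E (z : C) : Normc.normc z ^+ 2 = complex.Re (z * z^*).
Proof. by rewrite sqr_normc_parts; case: z => x y /=; ring. Qed.

Lemma sqint_mfunc f : square_integrable f -> mfunc f.
Proof. by case. Qed.

Lemma l2rep_sqint u : square_integrable (l2rep u).
Proof.
have := valP (repr u : l2fun_type R d).
by rewrite inE.
Qed.

Lemma toL2E f : square_integrable f ->
  {ae mu, forall x, l2rep (toL2 f) x = f x}.
Proof.
move=> sf; have vf : l2_fun (insubd (0 : l2fun_type R d) f) = f.
  by rewrite insubdK// inE.
have : repr (toL2 f : H) - insubd (0 : l2fun_type R d) f \in @l2null R d.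
  by apply/pi_L2P; rewrite reprK.
rewrite inE /= /l2rep; apply: filterS => x e.
by apply/eqP; rewrite -subr_eq0 -[X in _ - X x]vf; apply/eqP; exact: e.
Qed.

Lemma l2_ext u v : {ae mu, forall x, l2rep u x = l2rep v x} -> u = v.
Proof.
move=> uv; rewrite -[u]reprK -[v]reprK; apply/pi_L2P.
rewrite inE /=; apply: filterS uv => x e.
by change (l2rep u x - l2rep v x = 0); rewrite e subrr.
Qed.

Lemma toL2_ext f u : square_integrable f ->
  {ae mu, forall x, f x = l2rep u x} -> toL2 f = u.
Proof.
move=> sf fu; apply: l2_ext; apply: filterS2 fu (toL2E sf) => x <-.
exact.
Qed.

Lemma l2rep_lin a u v :
  {ae mu, forall x, l2rep (a *: u + v) x = a * l2rep u x + l2rep v x}.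
Proof.
have : repr (a *: u + v : H) - (a *: repr u + repr v : l2fun_type R d)
    \in @l2null R d.
  by apply/pi_L2P; rewrite reprK pi_L2D pi_L2Z !reprK.
rewrite inE /= /l2rep; apply: filterS => x e.
by apply/eqP; rewrite -subr_eq0; apply/eqP; exact: e.
Qed.

Lemma l2repB u v : {ae mu, forall x, l2rep (u - v) x = l2rep u x - l2rep v x}.
Proof.
apply: filterS (l2rep_lin (-1) v u) => x.
by rewrite scaleN1r addrC => ->; rewrite mulN1r addrC.
Qed.

Lemma integrable_sqr_normc f : square_integrable f ->
  mu.-integrable setT (fun x => (Normc.normc (f x) ^+ 2)%:E).
Proof.
move=> [f1 f2 fi]; apply/integrableP; split.
  exact: measurable_sqr_normc.
by under eq_integral do rewrite gee0_abs ?lee_fin ?sqr_ge0//.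
Qed.

Lemma integrable_prod f g : square_integrable f -> square_integrable g ->
  mu.-integrable setT (fun x => (complex.Re (f x * (g x)^*))%:E) /\
  mu.-integrable setT (fun x => (complex.Im (f x * (g x)^*))%:E).
Proof.
move=> sf sg.
have [m1 m2] := mfuncM (sqint_mfunc sf) (mfunc_conj (sqint_mfunc sg)).
have ifg := integrableD measurableT (integrable_sqr_normc sf)
  (integrable_sqr_normc sg).
have bd (z1 z2 : C) : `|complex.Re (z1 * z2^*)| <= Normc.normc z1 ^+ 2 + Normc.normc z2 ^+ 2
   /\ `|complex.Im (z1 * z2^*)| <= Normc.normc z1 ^+ 2 + Normc.normc z2 ^+ 2.
  rewrite !sqr_normc_parts; case: z1 z2 => [a b] [a' b'] /=.
  have := (sqr_ge0 a, sqr_ge0 b, sqr_ge0 a', sqr_ge0 b').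
  have := (sqr_ge0 (a - a'), sqr_ge0 (a + a'), sqr_ge0 (b - b'), sqr_ge0 (b + b')).
  have := (sqr_ge0 (a - b'), sqr_ge0 (a + b'), sqr_ge0 (b - a'), sqr_ge0 (b + a')).
  move=> [[[? ?] ?] ?] [[[? ?] ?] ?] [[[? ?] ?] ?].
  by split; rewrite ler_norml; apply/andP; split; nra.
split; apply: le_integrable ifg => //.
- exact/measurable_EFinP.
- move=> x _ /=; rewrite lee_fin [leRHS]ger0_norm ?addr_ge0 ?sqr_ge0//.
  by have [] := bd (f x) (g x).
- exact/measurable_EFinP.
- move=> x _ /=; rewrite lee_fin [leRHS]ger0_norm ?addr_ge0 ?sqr_ge0//.
  by have [] := bd (f x) (g x).
Qed.

Lemma inner_ae f g u v : square_integrable f -> square_integrable g ->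
  {ae mu, forall x, l2rep u x = f x} -> {ae mu, forall x, l2rep v x = g x} ->
  inner u v = Complex (\int[mu]_x complex.Re (f x * (g x)^*))%R
                      (\int[mu]_x complex.Im (f x * (g x)^*))%R.
Proof.
move=> sf sg fu gv; rewrite /inner.
have [m1 m2] := mfuncM (sqint_mfunc sf) (mfunc_conj (sqint_mfunc sg)).
have [m3 m4] := mfuncM (sqint_mfunc (l2rep_sqint u))
  (mfunc_conj (sqint_mfunc (l2rep_sqint v))).
congr Complex; congr fine; apply: ae_eq_integral => //;
  try exact/measurable_EFinP; apply: filterS2 fu gv => x -> -> //.
Qed.

Lemma inner_lin a u v w : inner (a *: u + v) w = a * inner u w + inner v w.
Proof.
have sl : square_integrable (fun x => a * l2rep u x + l2rep v x).
  have := rpredD (rpredZ a (valP (repr u : l2fun_type R d)))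
    (valP (repr v : l2fun_type R d)).
  by rewrite inE.
rewrite (inner_ae sl (l2rep_sqint w) (l2rep_lin a u v)); last exact: aeW.
have [i1 i2] := integrable_prod (l2rep_sqint u) (l2rep_sqint w).
have [i3 i4] := integrable_prod (l2rep_sqint v) (l2rep_sqint w).
have er (x : euclid R d) : complex.Re ((a * l2rep u x + l2rep v x) * (l2rep w x)^*) =
    complex.Re a * complex.Re (l2rep u x * (l2rep w x)^*) +
    - complex.Im a * complex.Im (l2rep u x * (l2rep w x)^*) +
    complex.Re (l2rep v x * (l2rep w x)^*).
  by rewrite mulrDl -mulrA re_axpy mulNr.
have ei (x : euclid R d) : complex.Im ((a * l2rep u x + l2rep v x) * (l2rep w x)^*) =
    complex.Re a * complex.Im (l2rep u x * (l2rep w x)^*) +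
    complex.Im a * complex.Re (l2rep u x * (l2rep w x)^*) +
    complex.Im (l2rep v x * (l2rep w x)^*).
  by rewrite mulrDl -mulrA im_axpy.
under eq_Rintegral do rewrite er; under [X in Complex _ X]eq_Rintegral do rewrite ei.
have Z r (h : euclid R d -> R) : mu.-integrable setT (EFin \o h) ->
    mu.-integrable setT (EFin \o (fun x => r * h x)).
  by move=> ih; exact: (integrableZl measurableT r ih).
have D (h k : euclid R d -> R) : mu.-integrable setT (EFin \o h) ->
    mu.-integrable setT (EFin \o k) ->
    mu.-integrable setT (EFin \o (fun x => h x + k x)).
  by move=> ih ik; exact: (integrableD measurableT ih ik).
rewrite !RintegralD//; do ?[exact: Z|apply: D]; do ?exact: Z => //.
rewrite !RintegralZl// /inner.
by case: a {sl er ei} => a1 a2 /=; congr Complex; rewrite mulNr.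
Qed.

Lemma inner_conj u v : inner v u = (inner u v)^*.
Proof.
rewrite /inner /=; have [_ i2] := integrable_prod (l2rep_sqint u) (l2rep_sqint v).
congr Complex.
  apply: eq_Rintegral => x _; case: (l2rep u x) (l2rep v x) => [? ?] [? ?] /=.
  by ring.
rewrite -[RHS]mulN1r -RintegralZl//; apply: eq_Rintegral => x _.
by case: (l2rep u x) (l2rep v x) => [? ?] [? ?] /=; ring.
Qed.

End L2Theory.

(** * The real Hilbert structure of $L^2$ and its completeness *)

Section L2Hilbert.
Variables (R : realType) (d : nat).
Local Notation C := R[i].
Local Notation mu := (leb R d).
Local Notation H := (L2 R d).

(** A copy of [H] to carry the scalar action of [R], kept apart from the module structure over
    [R[i]]. *)
Definition L2r : Type := H.
HB.instance Definition _ := Choice.on L2r.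
HB.instance Definition _ := GRing.Zmodule.on L2r.

Definition L2r_scale (a : R) (u : L2r) : L2r := a%:C *: (u : H).

Let L2r_scaleA a b (u : L2r) : L2r_scale a (L2r_scale b u) = L2r_scale (a * b) u.
Proof. by rewrite /L2r_scale scalerA rmorphM. Qed.

Let L2r_scale1 : left_id 1 L2r_scale.
Proof. by move=> u; rewrite /L2r_scale rmorph1 scale1r. Qed.

Let L2r_scaleDr : right_distributive L2r_scale +%R.
Proof. by move=> a u v; rewrite /L2r_scale scalerDr. Qed.

Let L2r_scaleDl (u : L2r) : {morph L2r_scale^~ u : a b / a + b}.
Proof. by move=> a b; rewrite /L2r_scale rmorphD scalerDl. Qed.

HB.instance Definition _ := GRing.Zmodule_isLmodule.Build R L2r
  L2r_scaleA L2r_scale1 L2r_scaleDr L2r_scaleDl.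

Lemma L2r_scaleE (a : R) (u : L2r) : a *: u = (a%:C *: (u : H)) :> H.
Proof. by []. Qed.

Let reinner (u v : L2r) : R := complex.Re (inner u v).

Lemma sqr_l2normE f (u : H) : square_integrable f ->
  {ae mu, forall x, l2rep u x = f x} ->
  (complex.Re (inner u u))%:E = (\int[mu]_x (Normc.normc (f x) ^+ 2)%:E)%E.
Proof.
move=> sf fu; rewrite (inner_ae sf sf)//=.
under eq_Rintegral do rewrite -normc2E.
rewrite /Rintegral fineK//.
exact: (integrable_fin_num measurableT (integrable_sqr_normc sf)).
Qed.

Lemma sqr_l2norm (u : H) :
  (complex.Re (inner u u))%:E = (\int[mu]_x (Normc.normc (l2rep u x) ^+ 2)%:E)%E.
Proof. by apply: sqr_l2normE; [exact: l2rep_sqint|exact: aeW]. Qed.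

Let reinnerC u v : reinner u v = reinner v u.
Proof. by rewrite /reinner inner_conj; case: inner. Qed.

Let reinner_lin a u v w : reinner (a *: u + v) w = a * reinner u w + reinner v w.
Proof. by rewrite /reinner inner_lin re_axpy/= mul0r subr0. Qed.

Let reinner_ge0 u : 0 <= reinner u u.
Proof.
rewrite -lee_fin sqr_l2norm; apply: integral_ge0 => x _.
by rewrite lee_fin sqr_ge0.
Qed.

Let reinner_eq0 u : reinner u u = 0 -> u = 0.
Proof.
move=> u0; have := sqr_l2norm u; rewrite [complex.Re _]u0.
have [mr mi _] := l2rep_sqint u.
have ms := measurable_sqr_normc mr mi.
move=> /esym; under eq_integral do rewrite -[X in (X%:E)]ger0_norm ?sqr_ge0// -abse_EFin.
move/(ae_eq_integral_abs _ measurableT ms) => h.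
apply: l2_ext; have := l2rep_lin 0 u u; rewrite scale0r add0r.
have := l2rep_lin (-1) u u; rewrite scaleN1r addNr.
move=> h0 _; apply: filterS2 h h0 => x hx ->.
have /eqP := hx I; rewrite eqe sqrf_eq0 => /eqP/Normc.eq0_normc ->.
by rewrite mulr0 addr0.
Qed.

(* Opaque, so that unification never unfolds it to an integral. *)
Lemma reip_sig : {B : real_ip L2r | forall u v, B u v = complex.Re (inner u v)}.
Proof. by exists (RealIp reinnerC reinner_lin reinner_ge0 reinner_eq0). Qed.

Definition reip : real_ip L2r := proj1_sig reip_sig.

Lemma reipE u v : reip u v = complex.Re (inner u v).
Proof. exact: (proj2_sig reip_sig). Qed.

Lemma L2norm_nrm (u : H) : L2norm u = nrm reip u.
Proof. by rewrite /nrm reipE. Qed.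

Lemma innerZr (a : C) (u v : H) : inner u (a *: v) = a^* * inner u v.
Proof.
have i0 : inner 0 u = 0 :> C.
  by have := inner_lin (-1) 0 0 u; rewrite scaler0 addr0 mulN1r addNr.
rewrite inner_conj -[a *: v]addr0 inner_lin i0 addr0 (inner_conj v u).
by case: a inner => [? ?] [? ?]; congr Complex => /=; ring.
Qed.

Lemma innerZl (a : C) (u v : H) : inner (a *: u) v = a * inner u v.
Proof.
rewrite inner_conj innerZr (inner_conj u v).
by case: a inner => [? ?] [? ?]; congr Complex => /=; ring.
Qed.

Lemma im_inner (u v : H) : complex.Im (inner u v) = reip u ('i *: (v : H)).
Proof. by rewrite reipE innerZr; case: inner => a b /=; ring. Qed.

Lemma nrm_cscale (a : C) (u : H) : nrm reip (a *: u : H) = Normc.normc a * nrm reip u.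
Proof.
rewrite /nrm !reipE innerZl innerZr mulrA.
have -> : a * a^* = (Normc.normc a ^+ 2)%:C.
  by rewrite sqr_normc_parts; case: a => x y; congr Complex => /=; ring.
rewrite (_ : complex.Re (_ * _) = Normc.normc a ^+ 2 * complex.Re (inner u u)).
  by rewrite sqrtrM ?sqr_ge0// sqrtr_sqr ger0_norm// normc_ge0.
by case: inner => x y /=; rewrite mul0r subr0.
Qed.

Lemma innerE (u v : H) : inner u v = Complex (reip u v) (reip u ('i *: (v : H))).
Proof. by rewrite -im_inner reipE; case: inner. Qed.

Lemma reip_iZ (u v : H) : reip ('i *: u) ('i *: v) = reip u v.
Proof. by rewrite !reipE innerZl innerZr; case: inner => a b /=; ring. Qed.

Lemma reip_iN (u v : H) : reip ('i *: u) v = - reip u ('i *: v).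
Proof. by rewrite !reipE innerZl innerZr; case: inner => a b /=; ring. Qed.

Lemma reip_iZr0 (u : H) : reip u ('i *: u) = 0.
Proof.
rewrite -im_inner; have := congr1 (@complex.Im R) (inner_conj u u).
by case: inner => a b /=; lra.
Qed.

(** Fatou's lemma: almost everywhere the square of the limit is the lower limit of the squares. *)
Lemma sqint_lim (f : nat -> euclid R d -> C) (g : euclid R d -> C) (M : R) :
  (forall n, mfunc (f n)) -> mfunc g ->
  {ae mu, forall x, complex.Re (f n x) @[n --> \oo] --> complex.Re (g x) /\
    complex.Im (f n x) @[n --> \oo] --> complex.Im (g x)} ->
  (\forall n \near \oo, \int[mu]_x (Normc.normc (f n x) ^+ 2)%:E <= M%:E)%E ->
  square_integrable g /\ (\int[mu]_x (Normc.normc (g x) ^+ 2)%:E <= M%:E)%E.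
Proof.
move=> mf [mg1 mg2] fg fM.
pose F n x : \bar R := (Normc.normc (f n x) ^+ 2)%:E.
have mF n : measurable_fun setT (F n).
  by have [? ?] := mf n; exact: measurable_sqr_normc.
have F0 n x : setT x -> (0 <= F n x)%E by rewrite lee_fin sqr_ge0.
have gM : (\int[mu]_x (Normc.normc (g x) ^+ 2)%:E <= M%:E)%E.
  rewrite (_ : integral _ _ _ = (\int[mu]_x limn_einf (F ^~ x))%E); last first.
    apply: ge0_ae_eq_integral => //.
    - exact: measurable_sqr_normc.
    - apply: (emeasurable_fun_cvg (fun n x => einfs (F ^~ x) n)).
        exact: measurable_fun_einfs.
      by move=> x _; rewrite limn_einf_lim; exact: is_cvg_einfs.
    - by move=> x _; rewrite lee_fin sqr_ge0.
    - move=> x _; rewrite limn_einf_lim; apply: lime_ge.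
        exact: is_cvg_einfs.
      apply: nearW => n; apply: le_ereal_inf_tmp => _ [m _ <-].
      exact: F0.
    - apply: filterS fg => x [h1 h2] _.
      have h : F ^~ x @ \oo --> (Normc.normc (g x) ^+ 2)%:E.
        apply: cvg_EFin; first exact: nearW.
        suff : (fun n => Normc.normc (f n x) ^+ 2) @ \oo
            --> Normc.normc (g x) ^+ 2 by [].
        rewrite sqr_normc_parts; under eq_fun do rewrite sqr_normc_parts.
        rewrite !expr2; under eq_fun do rewrite !expr2.
        by apply: cvgD; apply: cvgM.
      by rewrite is_cvg_limn_einfE ?(cvg_lim _ h)//; exact: cvgP h.
  apply: (le_trans (fatou mu measurableT mF F0)).
  rewrite limn_einf_lim; apply: lime_le; first exact: is_cvg_einfs.
  have [N _ hN] := fM; exists N => // n /= nN.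
  by apply: (@le_trans _ _ (\int[mu]_x F n x)%E); [apply: ereal_inf_lbound; exists n => /=|exact: hN].
by split=> //; split=> //; rewrite (le_lt_trans gM)// ltry.
Qed.

(** With weights $2^k$ the integrals of the squared increments still sum to at most $2$, so the
    weighted series is finite almost everywhere. At such a point it dominates the increments up to a
    geometric series, and they are absolutely summable. *)
Lemma ae_cvg_fast (f : nat -> euclid R d -> C) : (forall n, mfunc (f n)) ->
  (forall k, \int[mu]_x (Normc.normc (f k.+1 x - f k x) ^+ 2)%:E <= (4^-1 ^+ k)%:E)%E ->
  {ae mu, forall x, cvgn (fun n => complex.Re (f n x)) /\
    cvgn (fun n => complex.Im (f n x))}.
Proof.
move=> mf fk.
pose G k x : \bar R := (2 ^+ k * Normc.normc (f k.+1 x - f k x) ^+ 2)%:E.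
have ms k : measurable_fun setT
    (fun x => (Normc.normc (f k.+1 x - f k x) ^+ 2)%:E : \bar R).
  by have [m1 m2] := mfuncB (mf k.+1) (mf k); exact: measurable_sqr_normc.
have mG k : measurable_fun setT (G k).
  by rewrite /G; under eq_fun do rewrite EFinM; exact: measurable_funeM.
have G0 k x : setT x -> (0 <= G k x)%E.
  by rewrite lee_fin mulr_ge0 ?sqr_ge0 ?exprn_ge0.
have half_sum N : \sum_(k < N) (2^-1 : R) ^+ k <= 2.
  have -> : \sum_(k < N) (2^-1 : R) ^+ k = 2 - 2 * 2^-1 ^+ N.
    elim: N => [|N IH]; first by rewrite big_ord0 expr0 mulr1 subrr.
    by rewrite big_ord_recr/= IH exprS; field.
  by rewrite gerBl mulr_ge0// exprn_ge0// invr_ge0.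
have iG : (\int[mu]_x (\sum_(0 <= k <oo) G k x) <= 2%:E)%E.
  rewrite integral_nneseries//; apply: nneseries_le_bound.
    by move=> k; apply: integral_ge0 => x; exact: G0.
  move=> N; apply: (@le_trans _ _ (\sum_(k < N) ((2^-1 : R) ^+ k)%:E)%E).
    apply: lee_sum => k _; rewrite /G; under eq_integral do rewrite EFinM.
    rewrite ge0_integralZl//; last first.
      by move=> x _; rewrite lee_fin sqr_ge0.
    have e : (2^-1 : R) ^+ k = 2 ^+ k * 4^-1 ^+ k.
      by rewrite -exprMn; congr (_ ^+ _); field.
    by rewrite e EFinM lee_wpmul2l// lee_fin exprn_ge0.
  by rewrite sumEFin lee_fin.
have : mu.-integrable setT (fun x => \sum_(0 <= k <oo) G k x)%E.
  apply/integrableP; split.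
    apply: (@ge0_emeasurable_sum _ _ _ _ G xpredT) => [k x xT _|k _].
      exact: G0.
    exact: mG.
  have Gs x : (0 <= \sum_(0 <= k <oo) G k x)%E.
    by apply: nneseries_ge0 => k _ _; exact: G0.
  under eq_integral do rewrite gee0_abs//.
  by rewrite (le_lt_trans iG)// ltry.
move/(integrable_ae measurableT); apply: filterS => x /(_ I).
rewrite ge0_fin_numE; last by apply: nneseries_ge0 => k _ _; exact: G0.
move=> Gx.
have cG : cvgn (series (fun k => 2 ^+ k * Normc.normc (f k.+1 x - f k x) ^+ 2)).
  have := nneseries_cvg_fine _ Gx => /= h; apply: cvgP; apply: h => k.
  by have := G0 k x I; rewrite lee_fin.
have c2 : cvgn (series (fun k => (2^-1 : R) ^+ k)).
  have -> : (fun k => (2^-1 : R) ^+ k) = geometric 1 2^-1.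
    by apply/funext => k; rewrite /geometric /= mul1r.
  by apply: is_cvg_geometric_series; rewrite ger0_norm ?invr_ge0// invf_lt1// ltr1n.
pose a k := (2^-1 : R) ^+ k + 2 ^+ k * Normc.normc (f k.+1 x - f k x) ^+ 2.
have ca : cvgn (series a) by exact: is_cvg_seriesD c2 cG.
have e2 k : 0 < (2 : R) ^+ k by rewrite exprn_gt0.
(* AM-GM: [t <= 2^-k + 2^k t^2] *)
have amgm k (t : R) : t ^+ 2 <= Normc.normc (f k.+1 x - f k x) ^+ 2 -> `|t| <= a k.
  move=> ht; rewrite (@le_trans _ _ (2^-1 ^+ k + 2 ^+ k * t ^+ 2))//; last first.
    by rewrite lerD2l ler_pM2l.
  have eq1 : 2^-1 ^+ k * 2 ^+ k = 1 :> R by rewrite -exprMn mulVf// expr1n.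
  have ep : 0 < (2^-1 : R) ^+ k by rewrite exprn_gt0// invr_gt0.
  rewrite -real_normK ?num_real//; move: `|t| (normr_ge0 t) => s s0.
  move: (e2 k) ep eq1; move: (2^-1 ^+ k) (2 ^+ k) => p q q0 p0 pq.
  have : 0 <= q * (s - p) ^+ 2 by rewrite mulr_ge0// ?sqr_ge0// ltW.
  nra.
have a0 k : 0 <= a k.
  by rewrite (le_trans (normr_ge0 0) (amgm k 0 _))// expr0n sqr_ge0.
have key (r : nat -> R) :
    (forall k, (r k.+1 - r k) ^+ 2 <= Normc.normc (f k.+1 x - f k x) ^+ 2) -> cvgn r.
  move=> hr; have h : cvgn (series (telescope r)).
    apply: normed_cvg.
    exact: (series_le_cvg (fun k => normr_ge0 _) a0 (fun k => amgm k _ (hr k)) ca).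
  have -> : r = (fun n => r 0%N + series (telescope r) n).
    by apply/funext => n; rewrite -eq_sum_telescope.
  by apply: is_cvgD => //; exact: is_cvg_cst.
split; apply: key => k; rewrite sqr_normc_parts;
  case: (f k.+1 x) (f k x) => [? ?] [? ?] /=; rewrite ?lerDl ?lerDr sqr_ge0//.
Qed.

Lemma L2_complete : ip_complete reip.
Proof.
move=> u uk; pose f k := l2rep (u k).
have sf k : square_integrable (f k) by exact: l2rep_sqint.
have fint m n : (\int[mu]_x (Normc.normc (f m x - f n x) ^+ 2)%:E)%E
    = (reip (u m - u n) (u m - u n))%:E.
  have sd : square_integrable (fun x => f m x - f n x).
    have := rpredB (valP (repr (u m) : l2fun_type R d)) (valP (repr (u n) : l2fun_type R d)).
    by rewrite inE.
  by rewrite reipE (sqr_l2normE sd)//; exact: l2repB.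
have q4 k : 4^-1 ^+ k = (2^-1 ^+ k) ^+ 2 :> R.
  by rewrite -exprM mulnC exprM; congr (_ ^+ _); field.
have p2 k : 0 <= (2^-1 : R) ^+ k by rewrite exprn_ge0// invr_ge0.
have ae := ae_cvg_fast (fun k => sqint_mfunc (sf k)) (fun k => _).
have {}ae : {ae mu, forall x, cvgn (fun n => complex.Re (f n x)) /\
    cvgn (fun n => complex.Im (f n x))}.
  apply: ae => k; rewrite fint lee_fin q4.
  by rewrite -nrm_le.
(* An upper limit is measurable without any convergence and agrees with the limit where there is
   one, so the limit function is defined everywhere. *)
pose lm (h : nat -> euclid R d -> R) x := fine (limn_esup (fun n => (h n x)%:E)).
have mlm h : (forall n, measurable_fun setT (h n)) -> measurable_fun setT (lm h).
  move=> mh; apply: measurableT_comp; first exact: fine_measurable.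
  by apply: measurable_fun_limn_esup => n; apply/measurable_EFinP.
have lmE h x : cvgn (h ^~ x) -> h ^~ x @ \oo --> lm h x.
  move=> hx; have : (fun n => (h n x)%:E) @ \oo --> (limn (h ^~ x))%:E.
    by apply/cvg_EFin => //; exact: nearW.
  move=> hh; rewrite /lm is_cvg_limn_esupE ?(cvg_lim (@ereal_hausdorff R) hh) //; exact: cvgP hh.
pose g x : C := Complex (lm (fun n x => complex.Re (f n x)) x)
  (lm (fun n x => complex.Im (f n x)) x).
have mg : mfunc g by split; apply: mlm => n; have [] := sf n.
have dist := fast_dist uk.
(* Fatou is applied to the distance from the fixed member [f k]; this gives both the integrability
   of the limit and the rate of convergence. *)
have gk k : square_integrable (fun x => g x - f k x) /\
    (\int[mu]_x (Normc.normc (g x - f k x) ^+ 2)%:E <= ((2 * 2^-1 ^+ k) ^+ 2)%:E)%E.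
  apply: (@sqint_lim (fun n x => f n x - f k x)).
  - by move=> n; apply: mfuncB; exact: sqint_mfunc.
  - by apply: mfuncB => //; exact: sqint_mfunc.
  - apply: filterS ae => x [c1 c2].
    split; rewrite raddfB; under eq_fun do rewrite raddfB; apply: cvgB;
      try exact: cvg_cst.
    + exact: (lmE (fun n x => complex.Re (f n x))).
    + exact: (lmE (fun n x => complex.Im (f n x))).
  - exists k => // n /= kn; rewrite fint lee_fin -nrm_le ?mulr_ge0//.
    by rewrite -(subnKC kn).
have sg : square_integrable g.
  have [s0 _] := gk 0%N.
  have : (fun x => g x - f 0%N x) + f 0%N \in @l2fun R d.
    by apply: rpredD; rewrite inE //; exact: (sf 0%N).
  rewrite inE (_ : _ + _ = g)//; apply/funext => x.
  by rewrite [LHS]subrK.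
exists (toL2 g); apply/ip_cvgP => e e0.
have : (2 * (2^-1 : R) ^+ n) @[n --> \oo] --> (2 * 0 : R).
  apply: cvgM; first exact: cvg_cst.
  by apply: cvg_expr; rewrite ger0_norm ?invr_ge0// invf_lt1// ltr1n.
rewrite mulr0 => /cvgrPdist_lt/(_ _ e0)[N _ hN]; exists N => n /hN /=.
rewrite sub0r normrN ger0_norm ?mulr_ge0//; apply: le_lt_trans.
have [s1 s2] := gk n; rewrite nrm_distC nrm_le ?mulr_ge0// -lee_fin.
rewrite reipE (sqr_l2normE s1)//.
apply: filterS2 (l2repB (toL2 g) (u n)) (toL2E sg) => x -> ->.
by [].
Qed.

End L2Hilbert.

(** * Hilbert-Schmidt operators *)

Section Operators.
Variables (R : realType) (d : nat).
Local Notation C := R[i].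
Local Notation H := (L2 R d).
Local Notation B := (reip R d).
Implicit Types (A T S : H -> H) (u v w : H) (e f : nat -> H).

Lemma inner0_eq u : (forall v, inner u v = 0) -> u = 0.
Proof.
by move=> u0; apply: (@rip_eq0 _ _ B); rewrite reipE u0.
Qed.

Lemma inner_linr (a : C) u v w :
  inner w (a *: u + v) = a^* * inner w u + inner w v.
Proof.
rewrite inner_conj inner_lin (inner_conj w u) (inner_conj w v).
by case: a (inner w u) (inner w v) => [? ?] [? ?] [? ?]; congr Complex => /=; ring.
Qed.

Lemma inner_ext u v : (forall w, inner w u = inner w v) -> u = v.
Proof.
move=> uv; apply/eqP; rewrite -subr_eq0; apply/eqP/inner0_eq => w.
rewrite -scaleN1r addrC inner_lin mulN1r (inner_conj w u) (inner_conj w v) uv.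
by rewrite addNr.
Qed.

Section Basis.
Variable e : nat -> H.

(** Over the reals [e n] and ['i *: e n] are independent, so a complex basis becomes a real one when
    both are listed alternately. *)
Definition rbasis (n : nat) : L2r R d := if odd n then 'i *: e n./2 else e n./2.

Hypothesis oe : orthonormal_basis e.

Lemma reip_rbasis m n : B (rbasis m) (rbasis n) = (m == n)%:R.
Proof.
have [on _] := oe; have eij i j : reip R d (e i) (e j) = (i == j)%:R.
  by rewrite reipE on; case: eqP.
have eiij i j : reip R d (e i) ('i *: e j) = 0.
  by rewrite -im_inner on; case: eqP.
rewrite /rbasis -[m in RHS]odd_double_half -[n in RHS]odd_double_half.
case: (odd m) (odd n) => [] []; rewrite ?reip_iZ ?eij ?eiij ?reip_iN ?eiij ?oppr0 //.
- by rewrite eqn_add2l -!mul2n eqn_pmul2l.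
- case: eqP => // h; have := congr1 odd h.
  by rewrite !oddD !odd_double.
- case: eqP => // h; have := congr1 odd h.
  by rewrite !oddD !odd_double.
- by rewrite eqn_add2l -!mul2n eqn_pmul2l.
Qed.

Lemma rbasis_on : orthonormal0 B rbasis.
Proof.
move=> m n; rewrite reip_rbasis; case: eqP => //= _.
suff -> : rbasis n != 0 by [].
apply/eqP => n0; have := reip_rbasis n n; rewrite n0 rip0l eqxx.
by move/eqP; rewrite eq_sym oner_eq0.
Qed.

Lemma rbasis_total : ip_total B rbasis.
Proof.
move=> u u0; apply: (proj2 oe) => n.
rewrite innerE; have := u0 n.*2; have := u0 n.*2.+1.
by rewrite /rbasis /= odd_double/= uphalf_double doubleK => -> ->.
Qed.

Lemma parsevalE u : (B u u)%:E =
  (\sum_(0 <= n <oo) (B u (e n) ^+ 2 + B u ('i *: e n) ^+ 2)%:E)%E.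
Proof.
apply/esym/cvg_nneseries; first by move=> n; rewrite addr_ge0 ?sqr_ge0.
have := parseval rbasis_on (@L2_complete R d) rbasis_total u u.
(* Partial sums of even length contain [e n] and ['i *: e n] together, which is the grouping on the
   right-hand side. *)
have dbl : (fun n => n.*2) @ \oo --> \oo.
  move=> P [N _ NP]; exists N => // n /= Nn; apply: NP => /=.
  by rewrite (leq_trans Nn)// -addnn leq_addr.
move/(cvg_comp _ _ dbl); apply: cvg_trans; apply: near_eq_cvg; apply: nearW => N /=.
rewrite /series /= big_mkord.
elim: N => [|N IH]; first by rewrite !big_ord0.
rewrite doubleS !big_ord_recr/= IH -addrA; congr (_ + (_ + _)).
  by rewrite /rbasis odd_double doubleK expr2.
by rewrite /rbasis /= odd_double/= uphalf_double expr2.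
Qed.

End Basis.

Lemma bounded_ge0 A : bounded_operator A ->
  exists2 M, 0 <= M & forall u, nrm B (A u) <= M * nrm B u.
Proof.
move=> [_ [M hM]]; exists `|M| => // u.
rewrite -!L2norm_nrm; apply: (le_trans (hM u)).
by apply: ler_wpM2r; [exact: sqrtr_ge0|exact: ler_norm].
Qed.

Lemma bounded_lin0 A : bounded_operator A -> A 0 = 0.
Proof.
move=> [lA _]; have := lA (-1) 0 0.
by rewrite scaler0 addr0 scaleN1r addNr.
Qed.

Lemma bounded_linZ A a u : bounded_operator A -> A (a *: u) = a *: A u.
Proof.
move=> bA; have [lA _] := bA; have := lA a u 0.
by rewrite !addr0 (bounded_lin0 bA) addr0.
Qed.

Lemma reip_iC (u v : H) : B u ('i *: v : H) = - B ('i *: u : H) v.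
Proof. by rewrite reip_iN opprK. Qed.

Lemma adjoint_unique A A' : (forall u v, inner (A u) v = inner u (A' v)) ->
  adjoint A = A'.
Proof.
move=> AA'; rewrite /adjoint; set P := [set _ | _].
have : P (xget (fun=> 0) P) by apply: xgetPex; exists A'.
move=> h; apply/funext => v; apply: inner_ext => u.
by rewrite -h AA'.
Qed.

Variable e0 : nat -> H.
Hypothesis oe0 : orthonormal_basis e0.

(** Riesz representation of the real functional $u\mapsto\mathrm{Re}\langle Au,v\rangle$; the
    imaginary part follows on replacing [u] by ['i *: u], since [A] is complex linear. *)
Lemma adjointP A : bounded_operator A ->
  forall u v, inner (A u) v = inner u (adjoint A v).
Proof.
move=> bA; have [M M0 hM] := bounded_ge0 bA; have [lA _] := bA.
have ex v : exists w : H, forall u, B (A u) v = B u w.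
  have [||w hw] := @riesz_representation _ _ B _ (rbasis_on oe0)
    (@L2_complete R d) (rbasis_total oe0) (fun u => B (A u) v) (M * nrm B v).
  - move=> a u w; rewrite !reipE L2r_scaleE lA inner_lin re_axpy/=.
    by rewrite mul0r subr0.
  - move=> u; apply: (le_trans (normr_rip _ _ _)).
    by rewrite mulrAC ler_wpM2r ?nrm_ge0.
  - by exists w.
have [A' hA'] := choice ex.
have hA u v : inner (A u) v = inner u (A' v).
  rewrite !innerE; congr Complex; first exact: hA'.
  by rewrite !reip_iC -(bounded_linZ _ _ bA) hA'.
by rewrite (adjoint_unique hA).
Qed.

Lemma bounded_adjoint A : bounded_operator A -> bounded_operator (adjoint A).
Proof.
move=> bA; have hA := adjointP bA; have [M M0 hM] := bounded_ge0 bA.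
split.
  move=> a u v; apply: inner_ext => w; rewrite -hA.
  by rewrite !inner_linr !hA.
exists M => v; rewrite !L2norm_nrm.
have [->|v0] := eqVneq (nrm B (adjoint A v)) 0.
  by rewrite mulr_ge0 ?nrm_ge0.
have vp : 0 < nrm B (adjoint A v) by rewrite lt_neqAle eq_sym v0 nrm_ge0.
rewrite -(ler_pM2r vp) -expr2 sqr_nrm [B _ _]reipE -hA -reipE.
apply: (le_trans (ler_norm _)); apply: (le_trans (normr_rip _ _ _)).
by rewrite mulrAC ler_wpM2r ?nrm_ge0.
Qed.

Lemma adjointK A : bounded_operator A -> adjoint (adjoint A) = A.
Proof.
move=> bA; apply: adjoint_unique => u v.
by rewrite inner_conj -(adjointP bA) -inner_conj.
Qed.

Lemma bounded_comp A T : bounded_operator A -> bounded_operator T ->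
  bounded_operator (A \o T).
Proof.
move=> bA bT; have [M M0 hM] := bounded_ge0 bA; have [N N0 hN] := bounded_ge0 bT.
have [lA _] := bA; have [lT _] := bT; split.
  by move=> a u v /=; rewrite lT lA.
exists (M * N) => u; rewrite !L2norm_nrm -mulrA; apply: (le_trans (hM _)).
by rewrite ler_wpM2l.
Qed.

Lemma bounded_lin a A T : bounded_operator A -> bounded_operator T ->
  bounded_operator (fun u => a *: A u + T u).
Proof.
move=> bA bT; have [M M0 hM] := bounded_ge0 bA; have [N N0 hN] := bounded_ge0 bT.
have [lA _] := bA; have [lT _] := bT; split.
  move=> c u v; rewrite lA lT !scalerDr !scalerA (mulrC a c) -!addrA.
  by congr (_ + _); rewrite addrCA.
exists (Normc.normc a * M + N) => u; rewrite !L2norm_nrm.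
apply: (le_trans (nrmD B _ _)); rewrite mulrDl lerD//.
by rewrite nrm_cscale -mulrA ler_wpM2l// normc_ge0.
Qed.

Lemma bounded0 : bounded_operator (fun _ : H => 0 : H).
Proof.
split; first by move=> a u v; rewrite scaler0 addr0.
by exists 0 => u; rewrite mul0r L2norm_nrm nrm0.
Qed.

Lemma bounded_scale a A : bounded_operator A -> bounded_operator (fun u => a *: A u).
Proof.
move=> bA; have := bounded_lin a bA bounded0.
by under eq_fun do rewrite addr0.
Qed.

Definition hsq e A : \bar R := (\sum_(0 <= n <oo) (B (A (e n)) (A (e n)))%:E)%E.

Lemma hsq_ge0 e A : (0 <= hsq e A)%E.
Proof. by apply: nneseries_ge0 => n _ _; rewrite lee_fin rip_ge0. Qed.

(* Both sides are the sum of |<A e_n, f_m>|^2 over all m and n. *)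
Lemma hsq_adj e f A : orthonormal_basis e -> orthonormal_basis f ->
  bounded_operator A -> hsq e A = hsq f (adjoint A).
Proof.
move=> oe of_ bA; rewrite /hsq.
under eq_eseriesr do rewrite (parsevalE of_).
under [RHS]eq_eseriesr do rewrite (parsevalE oe).
pose a n m : \bar R := (B (A (e n)) (f m) ^+ 2 + B (A (e n)) ('i *: f m) ^+ 2)%:E.
have a0 n m : (0 <= a n m)%E by rewrite lee_fin addr_ge0 ?sqr_ge0.
apply: (etrans (@nneseries_interchange R a xpredT xpredT a0)).
apply: eq_eseriesr => m _; apply: eq_eseriesr => n _; congr (_%:E).
have lA := bounded_linZ 'i (e n) bA.
rewrite (ripC B (adjoint A _)) (ripC B (adjoint A _)).
rewrite reip_iC -lA.
by rewrite !reipE !(adjointP bA) sqrrN.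
Qed.

(** Two uses of [hsq_adj]: the sum over [e] for [A] is a sum over [e0] for the adjoint, and this is
    the sum over [f] for the double adjoint. *)
Lemma hsq_basis e f A : orthonormal_basis e -> orthonormal_basis f ->
  bounded_operator A -> hsq e A = hsq f A.
Proof.
move=> oe of_ bA; rewrite (hsq_adj oe oe0 bA) (hsq_adj oe0 of_ (bounded_adjoint bA)).
by rewrite adjointK.
Qed.

Lemma hsP A : hilbert_schmidt A <-> bounded_operator A /\ (hsq e0 A < +oo)%E.
Proof.
have hE e : hsq e A = (\sum_(0 <= n <oo) (L2norm (A (e n)) ^+ 2)%:E)%E.
  by apply: eq_eseriesr => n _; rewrite L2norm_nrm sqr_nrm.
split=> [[bA [e [oe fe]]]|[bA fA]]; split => //.
  by rewrite (hsq_basis oe0 oe bA) hE.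
by exists e0; split => //; rewrite -hE.
Qed.

Lemma hs_adjoint A : hilbert_schmidt A -> hilbert_schmidt (adjoint A).
Proof.
move=> /hsP[bA fA]; apply/hsP; split; first exact: bounded_adjoint.
by rewrite -(hsq_adj oe0 oe0 bA).
Qed.

Lemma hs_compl A T : bounded_operator A -> hilbert_schmidt T ->
  hilbert_schmidt (A \o T).
Proof.
move=> bA /hsP[bT fT]; apply/hsP; split; first exact: bounded_comp.
have [M M0 hM] := bounded_ge0 bA.
apply: (@le_lt_trans _ _ ((M ^+ 2)%:E * hsq e0 T)%E).
  rewrite -nneseriesZl//; last by move=> n _; rewrite lee_fin rip_ge0.
  apply: lee_nneseries => n _; rewrite -?EFinM lee_fin ?rip_ge0//.
  by rewrite -!sqr_nrm -exprMn lerXn2r ?nnegrE ?mulr_ge0 ?nrm_ge0 ?hM.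
by rewrite lte_mul_pinfty// lee_fin sqr_ge0.
Qed.

Lemma adjoint_comp A T : bounded_operator A -> bounded_operator T ->
  adjoint (A \o T) = adjoint T \o adjoint A.
Proof.
move=> bA bT; apply: adjoint_unique => u v /=.
by rewrite (adjointP bA) (adjointP bT).
Qed.

(** Taking adjoints turns composition on the right into composition on the left. *)
Lemma hs_compr A T : bounded_operator A -> hilbert_schmidt T ->
  hilbert_schmidt (T \o A).
Proof.
move=> bA hT; have [bT _] := (hsP T).1 hT.
have -> : T \o A = adjoint (adjoint A \o adjoint T).
  by rewrite -(adjoint_comp bT bA) (adjointK (bounded_comp bT bA)).
by apply/hs_adjoint/hs_compl; [exact: bounded_adjoint|exact: hs_adjoint].
Qed.

Lemma hs_lin a A T : hilbert_schmidt A -> hilbert_schmidt T ->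
  hilbert_schmidt (fun u => a *: A u + T u).
Proof.
move=> /hsP[bA fA] /hsP[bT fT]; apply/hsP; split; first exact: bounded_lin.
have [M M0 hM] := bounded_ge0 (bounded_scale a bA).
have fZ : (hsq e0 (fun u => a *: A u) < +oo)%E.
  have b1 : bounded_operator (fun u : H => a *: u).
    have := @bounded_scale a id; apply; split => //.
    by exists 1 => u; rewrite mul1r.
  have /hsP[] // : hilbert_schmidt ((fun u : H => a *: u) \o A).
  by apply: hs_compl => //; exact/hsP.
apply: (@le_lt_trans _ _ (2%:E * hsq e0 (fun u => (a *: A u)%R) + 2%:E * hsq e0 T)%E).
  rewrite -!nneseriesZl//; try by move=> n _; rewrite lee_fin rip_ge0.
  rewrite -nneseriesD; try by move=> n _ _; rewrite -EFinM lee_fin mulr_ge0// rip_ge0.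
  apply: lee_nneseries => n _; rewrite -?EFinM -?EFinD lee_fin ?rip_ge0//.
  by have := parallelogram B (a *: A (e0 n) : H) (T (e0 n));
    have := rip_ge0 B ((a *: A (e0 n) : H) - T (e0 n)); lra.
have e2 : (0 <= 2%:E :> \bar R)%E by rewrite lee_fin.
have f2 : (2%:E : \bar R) \is a fin_num by [].
exact: (lte_add_pinfty (lte_mul_pinfty e2 f2 fZ) (lte_mul_pinfty e2 f2 fT)).
Qed.

Lemma hs0 : hilbert_schmidt (fun _ : H => 0 : H).
Proof.
apply/hsP; split; first exact: bounded0.
by rewrite /hsq eseries0// => n _ _; rewrite rip0l.
Qed.

Lemma hs_scale a A : hilbert_schmidt A -> hilbert_schmidt (fun u => a *: A u).
Proof. by move=> hA; have := hs_lin a hA hs0; under eq_fun do rewrite addr0. Qed.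

End Operators.

(** * The Hilbert--Schmidt pairing and the trace *)

Section HsPairing.
Variables (R : realType) (d : nat).
Local Notation C := R[i].
Local Notation H := (L2 R d).
Local Notation B := (reip R d).
Implicit Types (A T S : H -> H) (u v w : H) (e f : nat -> H).
Variable e0 : nat -> H.
Hypothesis oe0 : orthonormal_basis e0.

Definition hspair A T : R := limn (series (fun n => B (A (e0 n)) (T (e0 n)))).

Lemma hs_sqr_cvg e A : orthonormal_basis e -> hilbert_schmidt A ->
  series (fun n => B (A (e n)) (A (e n))) @ \oo --> fine (hsq e0 A).
Proof.
move=> oe hA; have [bA fA] := (hsP oe0 A).1 hA.
rewrite -(hsq_basis oe0 oe oe0 bA).
apply: nneseries_cvg_fine => [n|]; first exact: rip_ge0.
by have := fA; rewrite (hsq_basis oe0 oe0 oe bA).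
Qed.

Lemma hs_sub A T : hilbert_schmidt A -> hilbert_schmidt T ->
  hilbert_schmidt (fun u => A u - T u).
Proof.
move=> hA hT; have := hs_lin oe0 (-1) hT hA.
by under eq_fun do rewrite scaleN1r addrC.
Qed.

Lemma hs_add A T : hilbert_schmidt A -> hilbert_schmidt T ->
  hilbert_schmidt (fun u => A u + T u).
Proof.
move=> hA hT; have := hs_lin oe0 1 hA hT.
by under eq_fun do rewrite scale1r.
Qed.

(** Polarization writes the series, whose terms have no sign, through two series of squares; these
    converge and do not depend on the basis. *)
Lemma hs_polar_cvg e A T : orthonormal_basis e -> hilbert_schmidt A ->
  hilbert_schmidt T ->
  series (fun n => B (A (e n)) (T (e n))) @ \oo -->
    4^-1 * (fine (hsq e0 (fun u => A u + T u)) - fine (hsq e0 (fun u => A u - T u))).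
Proof.
move=> oe hA hT.
have h1 := hs_sqr_cvg oe (hs_add hA hT).
have h2 := hs_sqr_cvg oe (hs_sub hA hT).
have -> : series (fun n => B (A (e n)) (T (e n))) =
    (fun n => 4^-1 * (series (fun n => B (A (e n) + T (e n)) (A (e n) + T (e n))) n
     - series (fun n => B (A (e n) - T (e n)) (A (e n) - T (e n))) n)).
  apply/funext => n; rewrite /series/= -sumrB mulr_sumr.
  by apply: eq_bigr => i _; rewrite polar.
by apply: cvgM; [exact: cvg_cst|exact: cvgB].
Qed.

Lemma hspair_cvg e A T : orthonormal_basis e -> hilbert_schmidt A ->
  hilbert_schmidt T -> series (fun n => B (A (e n)) (T (e n))) @ \oo --> hspair A T.
Proof.
move=> oe hA hT; rewrite /hspair (cvg_lim _ (hs_polar_cvg oe0 hA hT))//.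
exact: hs_polar_cvg.
Qed.

Lemma hspair_eq e A T l : orthonormal_basis e -> hilbert_schmidt A ->
  hilbert_schmidt T -> series (fun n => B (A (e n)) (T (e n))) @ \oo --> l ->
  hspair A T = l.
Proof.
move=> oe hA hT h.
by rewrite -(cvg_lim (@Rhausdorff R) h) (cvg_lim (@Rhausdorff R) (hspair_cvg oe hA hT)).
Qed.

Lemma hspair_sqr A : hilbert_schmidt A -> (hspair A A)%:E = hsq e0 A.
Proof.
move=> hA; have [bA fA] := (hsP oe0 A).1 hA.
rewrite (hspair_eq oe0 hA hA (hs_sqr_cvg oe0 hA)) fineK// ge0_fin_numE//.
exact: hsq_ge0.
Qed.

Lemma hspairC A T : hspair A T = hspair T A.
Proof.
rewrite /hspair; congr (lim (_ @ \oo)); congr series; apply/funext => n.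
exact: ripC.
Qed.

Lemma hspair_lin (a : R) A T S : hilbert_schmidt A -> hilbert_schmidt T ->
  hilbert_schmidt S ->
  hspair (fun u => a%:C *: A u + T u) S = a * hspair A S + hspair T S.
Proof.
move=> hA hT hS; apply: (hspair_eq oe0 (hs_lin oe0 _ hA hT) hS).
have -> : series (fun n => B (a%:C *: A (e0 n) + T (e0 n)) (S (e0 n))) =
    (fun n => a * series (fun n => B (A (e0 n)) (S (e0 n))) n
     + series (fun n => B (T (e0 n)) (S (e0 n))) n).
  apply/funext => n; rewrite /series/= mulr_sumr -big_split/=.
  by apply: eq_bigr => i _; rewrite -rip_lin.
apply: cvgD; last exact: hspair_cvg.
by apply: cvgM; [exact: cvg_cst|exact: hspair_cvg].
Qed.

(** By polarization it is enough that taking adjoints preserves [hsq] of the sum and of the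
    difference; [adj_lin] treats both signs at once. *)
Lemma hspair_adj A T : hilbert_schmidt A -> hilbert_schmidt T ->
  hspair (adjoint A) (adjoint T) = hspair A T.
Proof.
move=> hA hT; have hA' := hs_adjoint oe0 hA; have hT' := hs_adjoint oe0 hT.
have [bA _] := (hsP oe0 A).1 hA; have [bT _] := (hsP oe0 T).1 hT.
rewrite (hspair_eq oe0 hA hT (hs_polar_cvg oe0 hA hT)).
rewrite (hspair_eq oe0 hA' hT' (hs_polar_cvg oe0 hA' hT')).
have adj_lin a : adjoint (fun u => A u + (a%:C : C) *: T u) =
    (fun u => adjoint A u + (a%:C : C) *: adjoint T u).
  apply: adjoint_unique => u v; rewrite addrC inner_lin [in RHS]addrC inner_linr.
  rewrite (adjointP oe0 bA) (adjointP oe0 bT); congr (_ * _ + _).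
  by congr Complex => /=; rewrite ?oppr0.
have hz a : hsq e0 (fun u => adjoint A u + (a%:C : C) *: adjoint T u) =
    hsq e0 (fun u => A u + (a%:C : C) *: T u).
  rewrite -adj_lin -(hsq_adj oe0 oe0 oe0)//.
  have := bounded_lin a%:C bT bA.
  by under eq_fun do rewrite addrC.
have eD (F G : H -> H) : (fun u => F u + G u) = (fun u => F u + (1%:C : C) *: G u).
  by apply/funext => u; rewrite scale1r.
have eB (F G : H -> H) : (fun u => F u - G u) = (fun u => F u + ((-1)%:C : C) *: G u).
  by apply/funext => u; rewrite rmorphN rmorph1 scaleN1r.
by rewrite (eD A T) (eD (adjoint A) (adjoint T)) (eB A T)
  (eB (adjoint A) (adjoint T)) !hz.
Qed.

Lemma cvg_complexP (z : nat -> C) (l : C) :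
  ((z : nat -> C^o) @ \oo --> (l : C^o)) <->
  ((fun n => complex.Re (z n)) @ \oo --> complex.Re l /\
   (fun n => complex.Im (z n)) @ \oo --> complex.Im l).
Proof.
have le_re (w : C) : `|complex.Re w| <= Normc.normc w.
  case: w => a b /=; rewrite -sqrtr_sqr ler_wsqrtr// lerDl sqr_ge0//.
have le_im (w : C) : `|complex.Im w| <= Normc.normc w.
  case: w => a b /=; rewrite -sqrtr_sqr ler_wsqrtr// lerDr sqr_ge0//.
have le_nc (w : C) : Normc.normc w <= `|complex.Re w| + `|complex.Im w|.
  case: w => a b /=; rewrite -[leRHS]ger0_norm ?addr_ge0// -sqrtr_sqr ler_wsqrtr//.
  rewrite sqrrD -(real_normK (num_real a)) -(real_normK (num_real b)).
  by rewrite addrAC lerDl mulrn_wge0// mulr_ge0.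
split=> [/cvgrPdist_lt h|[/cvgrPdist_lt h1 /cvgrPdist_lt h2]].
  split; apply/cvgrPdist_lt => e e0_; have e1 : 0 < e%:C :> C by rewrite ltcR.
    have [N _ hN] := h _ e1; exists N => // n /hN /=.
    rewrite ltcR; apply: le_lt_trans.
    by case: l (z n) {h hN} => [? ?] [? ?] /=; exact: (le_re (Complex _ _)).
  have [N _ hN] := h _ e1; exists N => // n /hN /=.
  rewrite ltcR; apply: le_lt_trans.
  by case: l (z n) {h hN} => [? ?] [? ?] /=; exact: (le_im (Complex _ _)).
(* The order on [C] only compares numbers with equal imaginary parts, so a positive tolerance is
   real. *)
apply/cvgrPdist_lt => -[e e'] ee; have : 0 < e /\ e' = 0.
  by move: ee; rewrite ltcE /= => /andP[/eqP -> ->].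
move=> [ep ->]; have e2 : 0 < e / 2 by rewrite divr_gt0.
have [N _ hN] := h1 _ e2; have [M _ hM] := h2 _ e2.
exists (maxn N M) => // n /=; rewrite geq_max => /andP[/hN hn /hM hm].
rewrite ltcR; apply: (le_lt_trans (le_nc _)).
by move: hn hm; case: l (z n) {h1 h2 hN hM} => [? ?] [? ?] /=; lra.
Qed.

(** Moving [A] across turns the diagonal series into that of [hspair], with the same sum in every
    basis. The value chosen by [xget] is then a limit of the same series for [e0], hence equal to
    [t]. *)
Lemma trace_hs A T : hilbert_schmidt A -> hilbert_schmidt T ->
  trace (A \o T) = Complex (hspair T (adjoint A))
                           (hspair T (fun u => 'i *: adjoint A u)).
Proof.
move=> hA hT; have hA' := hs_adjoint oe0 hA.
have hiA := hs_scale oe0 'i hA'.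
have [bA _] := (hsP oe0 A).1 hA.
set t := Complex _ _.
have ht e : orthonormal_basis e ->
    (series (fun n => inner ((A \o T) (e n)) (e n)) : nat -> C^o) @ \oo --> (t : C^o).
  move=> oe; apply/cvg_complexP; split => /=.
    have := hspair_cvg oe hT hA'; apply: cvg_trans; apply: near_eq_cvg.
    apply: nearW => N; rewrite /series /=.
    rewrite (big_morph (@complex.Re R) (id1 := 0) (op1 := +%R))//; last by case=> ? ? [].
    by apply: eq_bigr => n _; rewrite reipE (adjointP oe0 bA).
  have := hspair_cvg oe hT hiA; apply: cvg_trans; apply: near_eq_cvg.
  apply: nearW => N; rewrite /series /=.
  rewrite (big_morph (@complex.Im R) (id1 := 0) (op1 := +%R))//; last by case=> ? ? [].
  by apply: eq_bigr => n _; rewrite -im_inner (adjointP oe0 bA).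
rewrite /trace; set P := [set _ | _].
have : P (xget 0 P) by apply: xgetPex; exists t => e; exact: ht.
move=> /(_ e0 oe0) h1; have h2 := ht _ oe0.
have [h3 h4] := (cvg_complexP _ _).1 h1; have [h5 h6] := (cvg_complexP _ _).1 h2.
apply/eqP; rewrite eq_complex.
rewrite -(cvg_lim (@Rhausdorff R) h3) -(cvg_lim (@Rhausdorff R) h4).
by rewrite -(cvg_lim (@Rhausdorff R) h5) -(cvg_lim (@Rhausdorff R) h6) !eqxx.
Qed.

End HsPairing.

(** * Hilbert--Schmidt operators as a real Hilbert space *)

Section HsHilbert.
Variables (R : realType) (d : nat).
Local Notation C := R[i].
Local Notation H := (L2 R d).
Local Notation B := (reip R d).

Definition onb := {e : nat -> H | orthonormal_basis e}.

(* [E] is an argument because the closure properties, which are to be found by *)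
(* instance inference, need an orthonormal basis.                              *)
Definition hsfun (E : onb) : {pred H -> L2r R d} :=
  mem [set A : H -> H | hilbert_schmidt A].

Lemma hsfunP (E : onb) (A : H -> H) : A \in hsfun E <-> hilbert_schmidt A.
Proof. by rewrite inE. Qed.

Variable E : onb.
Let e0 : nat -> H := proj1_sig E.
Let oe0 : orthonormal_basis e0 := proj2_sig E.

Lemma hsfun_submod_closed : submod_closed (hsfun E).
Proof.
split; first by apply/hsfunP; exact: (hs0 oe0).
move=> a A T /hsfunP hA /hsfunP hT; apply/hsfunP.
exact: (hs_lin oe0 a%:C hA hT).
Qed.

HB.instance Definition _ := GRing.isSubmodClosed.Build _ _ (hsfun E)
  hsfun_submod_closed.

Record hsop := HsOp { hs_fun :> H -> L2r R d ; _ : hs_fun \in hsfun E }.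

HB.instance Definition _ := [isSub for hs_fun].
HB.instance Definition _ := [Choice of hsop by <:].
HB.instance Definition _ := [SubChoice_isSubLmodule of hsop by <:].

Lemma hsopP (A : hsop) : hilbert_schmidt (A : H -> H).
Proof. by have /hsfunP := valP A. Qed.

Definition to_hsop (A : H -> H) (hA : hilbert_schmidt A) : hsop :=
  HsOp (mem_set hA).

Lemma hsopB (A T : hsop) u : (A - T) u = A u - T u :> H.
Proof. by []. Qed.

End HsHilbert.

Section HsHilbert2.
Variables (R : realType) (d : nat).
Local Notation C := R[i].
Local Notation H := (L2 R d).
Local Notation B := (reip R d).
Variable E : onb R d.
Let e0 : nat -> H := proj1_sig E.
Let oe0 : orthonormal_basis e0 := proj2_sig E.
Implicit Types (A T S : H -> H).

(** The coefficients of [A u] are the inner products of [u] with the vectors [adjoint A (e0 n)].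
    Cauchy--Schwarz on each leaves the Hilbert--Schmidt sum of the adjoint, which is that of [A]. *)
Lemma bounded_nrm_le A u : hilbert_schmidt A ->
  nrm B (A u) <= Num.sqrt (hspair e0 A A) * nrm B u.
Proof.
move=> hA; have [bA fA] := (hsP oe0 A).1 hA.
have p0 : 0 <= hspair e0 A A by rewrite -lee_fin (hspair_sqr oe0 hA) hsq_ge0.
rewrite nrm_le ?mulr_ge0 ?nrm_ge0 ?sqrtr_ge0// exprMn sqr_nrm sqr_sqrtr//.
rewrite -lee_fin (parsevalE oe0) EFinM (hspair_sqr oe0 hA).
rewrite (hsq_adj oe0 oe0 oe0 bA) muleC -nneseriesZl; last first.
  by move=> n _; rewrite lee_fin rip_ge0.
apply: lee_nneseries => n _; first by rewrite lee_fin addr_ge0 ?sqr_ge0.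
rewrite -EFinM lee_fin.
have -> : B (A u) (e0 n) = B u (adjoint A (e0 n)).
  by rewrite !reipE (adjointP oe0 bA).
have -> : B (A u) ('i *: e0 n) = B u ('i *: adjoint A (e0 n)).
  by rewrite !reip_iC -(bounded_linZ _ _ bA) !reipE (adjointP oe0 bA).
by apply: cauchy_schwarz2; rewrite ?reip_iZr0 ?reip_iZ.
Qed.

Lemma hspair_eq0 A : hilbert_schmidt A -> hspair e0 A A = 0 -> A = (fun=> 0).
Proof.
move=> hA A0; apply/funext => u; apply: (@nrm_eq0 _ _ B).
apply/eqP; rewrite eq_le nrm_ge0 andbT.
by rewrite (le_trans (bounded_nrm_le u hA))// A0 sqrtr0 mul0r.
Qed.

Lemma hsip_sig : {P : real_ip (hsop E) | forall A T : hsop E, P A T = hspair e0 A T}.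
Proof.
have pC (A T : hsop E) : hspair e0 A T = hspair e0 T A by exact: hspairC.
have pl a (A T S : hsop E) :
    hspair e0 (a *: A + T) S = a * hspair e0 A S + hspair e0 T S.
  exact: (hspair_lin oe0 a (hsopP A) (hsopP T) (hsopP S)).
have p0 (A : hsop E) : 0 <= hspair e0 A A.
  by rewrite -lee_fin (hspair_sqr oe0 (hsopP A)) hsq_ge0.
have pe (A : hsop E) : hspair e0 A A = 0 -> A = 0.
  by move=> /(hspair_eq0 (hsopP A)) A0; apply: val_inj.
by exists (RealIp pC pl p0 pe).
Qed.

Definition hsip : real_ip (hsop E) := proj1_sig hsip_sig.

Lemma hsipE (A T : hsop E) : hsip A T = hspair e0 A T.
Proof. exact: (proj2_sig hsip_sig). Qed.

Lemma hs_nrm_le (A : hsop E) u : nrm B (A u) <= nrm hsip A * nrm B u.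
Proof. by rewrite /nrm hsipE; exact: (bounded_nrm_le u (hsopP A)). Qed.

(** The limit is built pointwise from completeness of $L^2$, as the operator norm is dominated by
    the Hilbert--Schmidt norm; convergence in the stronger norm comes from the finite sums in
    [tail]. *)
Lemma hs_complete : ip_complete hsip.
Proof.
move=> x xk; have dist := fast_dist xk.
have ex u : exists v : L2r R d, ip_cvg B (fun k => x k u) v.
  (* The increments of [x k u] carry a factor [nrm B u]; scaling by [c] brings them below $2^{-k}$,
     as [ip_complete] demands. *)
  pose c := (nrm B u + 1)^-1.
  have c0 : 0 < c by rewrite invr_gt0 ltr_wpDl ?nrm_ge0.
  have [|v hv] := @L2_complete R d (fun k => c *: x k u).
    move=> k; rewrite -scalerBr nrmZ (ger0_norm (ltW c0)).
    apply: (@le_trans _ _ (c * (2^-1 ^+ k * nrm B u))).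
      rewrite ler_pM2l// -hsopB (le_trans (hs_nrm_le _ _))//.
      by rewrite ler_wpM2r ?nrm_ge0.
    rewrite mulrCA ler_piMr ?exprn_ge0 ?invr_ge0//.
    by rewrite mulrC ler_pdivrMr ?mul1r ?lerDl// ltr_wpDl ?nrm_ge0.
  exists (c^-1 *: v).
  have := ip_cvgZ c^-1 hv.
  by under eq_fun do rewrite scalerA mulVf ?gt_eqF// scale1r.
have [A hA] := choice ex.
have x_bd k : nrm hsip (x k) <= nrm hsip (x 0%N) + 2.
  have := nrm_tri hsip (x 0%N) (x k) 0; rewrite !subr0.
  by have := dist 0%N k; rewrite add0n expr0; lra.
have bA : bounded_operator A.
  split.
    move=> a u v; apply: (ip_cvg_unique (hA _)).
    have lx k : x k (a *: u + v) = a *: (x k u : H) + x k v :> H.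
      by have [[lx _] _] := (hsP oe0 _).1 (hsopP (x k)); exact: lx.
    have ha : ip_cvg B (fun k => (a *: (x k u : H) : L2r R d)) (a *: (A u : H)).
      have := hA u; rewrite /ip_cvg => h.
      have : Normc.normc a * nrm B (x n u - A u) @[n --> \oo] --> Normc.normc a * 0.
        by apply: cvgM => //; exact: cvg_cst.
      rewrite mulr0; under eq_fun do rewrite -nrm_cscale.
      by under eq_fun do rewrite (scalerBr a (_ : H)).
    have := ip_cvg_lin 1 ha (hA v); rewrite scale1r.
    by under eq_fun do rewrite scale1r -lx.
  exists (nrm hsip (x 0%N) + 2) => u; rewrite !L2norm_nrm.
  apply: (ip_cvg_bound (hA u)); apply: nearW => k.
  by rewrite (le_trans (hs_nrm_le _ _))// ler_wpM2r ?nrm_ge0.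
(* For a fixed number of terms the bound on [x m - x k] passes to the limit in [m]; only then does
   the number of terms grow. *)
have tail k : (hsq e0 (fun u => A u - x k u)%R <= ((2 * 2^-1 ^+ k) ^+ 2)%:E)%E.
  apply: nneseries_le_bound => [n|N]; first by rewrite lee_fin rip_ge0.
  rewrite sumEFin lee_fin.
  have h : \sum_(n < N) B (x m (e0 n) - x k (e0 n)) (x m (e0 n) - x k (e0 n))
      @[m --> \oo] --> \sum_(n < N) B (A (e0 n) - x k (e0 n)) (A (e0 n) - x k (e0 n)).
    apply: cvg_sumR => n _; apply: ip_cvg_sqr.
    by rewrite /ip_cvg; under eq_fun do rewrite opprB addrA subrK; exact: hA.
  rewrite -(cvg_lim (@Rhausdorff R) h); apply: limr_le; first exact: cvgP h.
  exists k => // m /= km.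
  apply: (@le_trans _ _ (hsip (x m - x k) (x m - x k))); last first.
    by rewrite -nrm_le ?mulr_ge0 ?exprn_ge0 ?invr_ge0// -(subnKC km) dist.
  rewrite -lee_fin hsipE (hspair_sqr oe0 (hsopP _)) -sumEFin.
  rewrite -(big_mkord xpredT (fun n => (B (x m (e0 n) - x k (e0 n)) (x m (e0 n) - x k (e0 n)))%:E)).
  by apply: nneseries_lim_ge => n _ _; rewrite lee_fin rip_ge0.
have hsd k : hilbert_schmidt (fun u => A u - x k u).
  apply/(hsP oe0); split; last by rewrite (le_lt_trans (tail k))// ltry.
  have [bx _] := (hsP oe0 _).1 (hsopP (x k)).
  have := bounded_lin (-1) bx bA.
  by under eq_fun do rewrite scaleN1r addrC.
have hsA : hilbert_schmidt A.
  have := hs_add oe0 (hsd 0%N) (hsopP (x 0%N)).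
  by under eq_fun do rewrite subrK.
exists (to_hsop E hsA); apply/ip_cvgP => e e0_.
have : (2 * (2^-1 : R) ^+ n) @[n --> \oo] --> (2 * 0 : R).
  apply: cvgM; first exact: cvg_cst.
  by apply: cvg_expr; rewrite ger0_norm ?invr_ge0// invf_lt1// ltr1n.
rewrite mulr0 => /cvgrPdist_lt/(_ _ e0_)[N _ hN]; exists N => n /hN /=.
rewrite sub0r normrN ger0_norm ?mulr_ge0 ?exprn_ge0 ?invr_ge0//; apply: le_lt_trans.
rewrite nrm_distC nrm_le ?mulr_ge0 ?exprn_ge0 ?invr_ge0// -lee_fin hsipE.
by rewrite (hspair_sqr oe0 (hsopP _)); exact: tail.
Qed.

Definition rank1 (v w : H) : H -> H := fun u => inner u v *: w.

Lemma normc_inner (u v : H) : Normc.normc (inner u v) <= nrm B u * nrm B v.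
Proof.
rewrite -(ler_sqr (x := Normc.normc _)) ?nnegrE ?mulr_ge0 ?nrm_ge0 ?normc_ge0//.
rewrite sqr_normc_parts exprMn !sqr_nrm innerE /=.
by apply: cauchy_schwarz2; rewrite ?reip_iZr0 ?reip_iZ.
Qed.

Lemma bounded_rank1 v w : bounded_operator (rank1 v w).
Proof.
split; first by move=> a u u'; rewrite /rank1 inner_lin scalerDl scalerA.
exists (nrm B v * nrm B w) => u; rewrite !L2norm_nrm nrm_cscale.
by rewrite [leRHS]mulrAC ler_wpM2r ?nrm_ge0// mulrC normc_inner.
Qed.

Lemma rank1_basis_cvg A (m : nat) w : 
  series (fun n => B (A (e0 n)) (rank1 (e0 m) w (e0 n))) @ \oo --> B (A (e0 m)) w.
Proof.
apply: cvg_near_cst; exists m.+1 => // N /= mN; rewrite /series /= big_mkord.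
rewrite (bigD1 (Ordinal mN))//= /rank1 (proj1 oe0) eqxx scale1r big1 ?addr0// => i im.
rewrite (proj1 oe0); case: eqP => [h|_]; last by rewrite scale0r rip0r.
by move: im; rewrite -val_eqE /= h eqxx.
Qed.

Lemma hs_rank1 m w : hilbert_schmidt (rank1 (e0 m) w).
Proof.
apply/(hsP oe0); split; first exact: bounded_rank1.
have h := @rank1_basis_cvg (rank1 (e0 m) w) m w.
rewrite /hsq (cvg_nneseries _ h) ?ltry//.
by move=> n; exact: rip_ge0.
Qed.

Lemma hspair_rank1 A m w : hilbert_schmidt A ->
  hspair e0 A (rank1 (e0 m) w) = B (A (e0 m)) w.
Proof.
move=> hA; apply: (hspair_eq oe0 oe0 hA (hs_rank1 m w)).
exact: rank1_basis_cvg.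
Qed.

(** The matrix units sending [e0 m] to the [k]-th real basis vector, with pairs coded by [pickle]. A
    number that codes no pair gives $0$, which [orthonormal0] tolerates. *)
Definition hsbasis (n : nat) : hsop E :=
  if pickle_inv n is Some (m, k) then to_hsop E (hs_rank1 m (rbasis e0 k)) else 0.

Lemma hsbasis_on : orthonormal0 hsip hsbasis.
Proof.
move=> m n; rewrite /hsbasis.
have zE x : (if x is Some (m, k) then to_hsop E (hs_rank1 m (rbasis e0 k)) else 0)
    = 0 -> x = None :> option (nat * nat).
  case: x => // -[i k] /(congr1 (fun A : hsop E => hsip A A)).
  rewrite rip0l hsipE (hspair_rank1 _ _ (hs_rank1 _ _)).
  rewrite /rank1 (proj1 oe0) eqxx scale1r (reip_rbasis oe0) eqxx => /eqP.
  by rewrite oner_eq0.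
case: eqP => [->|mn] /=.
  case: eqP => [h|]; first by rewrite h rip0l.
  case: pickle_inv => [[i k]|//] _.
  rewrite hsipE (hspair_rank1 _ _ (hs_rank1 _ _)).
  by rewrite /rank1 (proj1 oe0) eqxx scale1r (reip_rbasis oe0) eqxx.
case em : (pickle_inv m) => [[i k]|]; last by rewrite rip0l.
case en : (pickle_inv n) => [[j l]|]; last by rewrite rip0r.
rewrite hsipE (hspair_rank1 _ _ (hs_rank1 _ _)) /rank1 (proj1 oe0).
case: eqP => [ji|_]; last by rewrite scale0r rip0l.
rewrite scale1r (reip_rbasis oe0); case: eqP => // kl.
have hm : pickle (i, k) = m by have := @pickle_invK (nat * nat)%type m; rewrite em.
have hn : pickle (j, l) = n by have := @pickle_invK (nat * nat)%type n; rewrite en.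
by case: mn; rewrite -hm -hn ji kl.
Qed.

Lemma hsbasis_total : ip_total hsip hsbasis.
Proof.
move=> A A0; apply: (@rip_eq0 _ _ hsip).
have Ae m : A (e0 m) = 0.
  apply: (rbasis_total oe0) => k.
  have := A0 (pickle (m, k)); rewrite /hsbasis pickleK_inv hsipE.
  by rewrite (hspair_rank1 _ _ (hsopP A)).
apply/eqP; rewrite -eqe hsipE (hspair_sqr oe0 (hsopP A)) /hsq.
by rewrite eseries0// => n _ _; rewrite Ae rip0l.
Qed.

End HsHilbert2.

(** * The complex inner product: Cauchy--Schwarz and weak convergence *)

Section HsInner.
Variables (R : realType) (d : nat).
Local Notation C := R[i].
Local Notation H := (L2 R d).
Local Notation B := (reip R d).
Variable E : onb R d.
Let e0 : nat -> H := proj1_sig E.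
Let oe0 : orthonormal_basis e0 := proj2_sig E.
Implicit Types (A T S : H -> H).

Lemma adjoint_iZ T : hilbert_schmidt T ->
  adjoint (fun u => - 'i *: T u) = (fun u => 'i *: adjoint T u).
Proof.
move=> hT; have [bT _] := (hsP oe0 T).1 hT.
apply: adjoint_unique => u v; rewrite innerZl innerZr (adjointP oe0 bT).
by congr (_ * _); congr Complex; rewrite ?oppr0.
Qed.

(** [trace_hs] yields pairings of the adjoints; [hspair_adj] removes them, and the factor of modulus
    one moves to the other side by skew symmetry of multiplication by ['i]. *)
Lemma hs_innerE T S : hilbert_schmidt T -> hilbert_schmidt S ->
  hs_inner T S = Complex (hspair e0 T S) (hspair e0 T (fun u => 'i *: S u)).
Proof.
move=> hT hS; have hS' := hs_adjoint oe0 hS.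
rewrite /hs_inner (trace_hs oe0 hT hS') -(adjoint_iZ hT).
have hiT := hs_scale oe0 (- 'i) hT.
rewrite !(hspair_adj oe0)// hspairC; congr Complex.
rewrite /hspair; congr (lim (_ @ \oo)); congr series; apply/funext => n.
have -> : - 'i *: T (e0 n) = - ('i *: T (e0 n)) by rewrite scaleNr.
by rewrite ripNr reip_iC opprK ripC.
Qed.

Lemma hspair_iZ0 A : hspair e0 A (fun u => 'i *: A u) = 0.
Proof.
rewrite /hspair (_ : (fun n => _) = (fun=> 0)); last first.
  by apply/funext => n; exact: reip_iZr0.
apply: cvg_lim => //; rewrite (_ : series _ = fun=> 0); first exact: cvg_cst.
by apply/funext => n; rewrite /series/= big1.
Qed.

Lemma hspair_iZ A :
  hspair e0 (fun u => 'i *: A u) (fun u => 'i *: A u) = hspair e0 A A.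
Proof.
rewrite /hspair; congr (lim (_ @ \oo)); congr series; apply/funext => n.
exact: reip_iZ.
Qed.

Lemma hs_normE T : hilbert_schmidt T -> hs_norm T = Num.sqrt (hspair e0 T T).
Proof. by move=> hT; rewrite /hs_norm hs_innerE. Qed.

Lemma hs_norm_ge0 T : 0 <= hs_norm T. Proof. exact: sqrtr_ge0. Qed.

Lemma sqr_hs_norm T : hilbert_schmidt T -> hs_norm T ^+ 2 = hspair e0 T T.
Proof.
move=> hT; rewrite hs_normE// sqr_sqrtr//.
by rewrite -lee_fin (hspair_sqr oe0 hT) hsq_ge0.
Qed.

Local Opaque hs_norm hs_inner hspair.

Lemma hs_norm_sqrE T : hilbert_schmidt T -> (hs_norm T ^+ 2)%:E = hsq e0 T.
Proof. by move=> hT; rewrite sqr_hs_norm// (hspair_sqr oe0 hT). Qed.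

Lemma hs_norm_eq0 T : hilbert_schmidt T -> hs_norm T = 0 -> T = (fun=> 0).
Proof.
move=> hT T0; apply: (@hspair_eq0 _ _ E) => //.
by rewrite -sqr_hs_norm// T0 expr0n.
Qed.

Lemma hs_norm_gt0 T : hs_nonzero T -> 0 < hs_norm T.
Proof.
move=> [hT T0]; rewrite lt_neqAle hs_norm_ge0 andbT eq_sym; apply/eqP => h.
by apply: T0; exact: hs_norm_eq0.
Qed.

Lemma hs_norm_adjoint T : hilbert_schmidt T -> hs_norm (adjoint T) = hs_norm T.
Proof.
move=> hT; have hT' := hs_adjoint oe0 hT.
by rewrite !hs_normE// (hspair_adj oe0).
Qed.

Lemma hs_norm_scale (a : C) T : hilbert_schmidt T ->
  hs_norm (fun u => a *: T u) = Normc.normc a * hs_norm T.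
Proof.
move=> hT; have haT := hs_scale oe0 a hT.
have n0 := normc_ge0 a.
suff e : hs_norm (fun u => a *: T u) ^+ 2 = (Normc.normc a * hs_norm T) ^+ 2.
  apply/eqP; rewrite -(eqrXn2 (ltn0Sn 1) (hs_norm_ge0 _) (mulr_ge0 n0 (hs_norm_ge0 _))).
  exact/eqP.
rewrite exprMn.
suff : hsq e0 (fun u => a *: T u)%R = ((Normc.normc a ^+ 2)%:E * hsq e0 T)%E.
  rewrite -(hs_norm_sqrE haT) -(hs_norm_sqrE hT) -EFinM.
  exact: EFin_inj.
rewrite /hsq -nneseriesZl; last first.
  by move=> n _; rewrite lee_fin rip_ge0.
apply: eq_eseriesr => n _.
by rewrite -EFinM -!sqr_nrm nrm_cscale exprMn.
Qed.

Let iE (A : hsop E) : hsop E := to_hsop E (hs_scale oe0 'i (hsopP A)).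

Let iE_orth (A : hsop E) : hsip E A (iE A) = 0.
Proof. by rewrite hsipE hspair_iZ0. Qed.

Let iE_sqr (A : hsop E) : hsip E (iE A) (iE A) = hsip E A A.
Proof. by rewrite !hsipE hspair_iZ. Qed.

Lemma hs_cauchy_schwarz T A : hilbert_schmidt T -> hilbert_schmidt A ->
  Normc.normc (hs_inner T A) <= hs_norm T * hs_norm A.
Proof.
move=> hT hA.
rewrite -(ler_sqr (x := Normc.normc _)) ?nnegrE ?mulr_ge0 ?hs_norm_ge0 ?normc_ge0//.
have -> : (hs_norm T * hs_norm A) ^+ 2 = hspair e0 T T * hspair e0 A A.
  by rewrite exprMn; congr (_ * _); [exact: (sqr_hs_norm hT)|exact: (sqr_hs_norm hA)].
rewrite (hs_innerE hT hA) sqr_normc_parts.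
have := @cauchy_schwarz2 _ _ (hsip E) (to_hsop E hT) (to_hsop E hA) (iE (to_hsop E hA)).
by rewrite !hsipE; apply; [rewrite -hsipE iE_orth|rewrite -!hsipE iE_sqr].
Qed.

(** The real equality case with [iE A] as second direction: a real combination of [A] and ['i *: A]
    is a complex multiple of [A]. *)
Lemma hs_cauchy_schwarz_eq T A : hs_nonzero T -> hs_nonzero A ->
  Normc.normc (hs_inner T A) = hs_norm T * hs_norm A ->
  exists c : C, T = (fun u => c *: A u).
Proof.
move=> nT nA e; have [hT _] := nT; have [hA _] := nA.
pose T' := to_hsop E hT; pose A' := to_hsop E hA.
have sT : hsip E T' T' != 0.
  by rewrite hsipE -(sqr_hs_norm hT) sqrf_eq0 (gt_eqF (hs_norm_gt0 nT)).
have sA : hsip E A' A' != 0.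
  by rewrite hsipE -(sqr_hs_norm hA) sqrf_eq0 (gt_eqF (hs_norm_gt0 nA)).
have := @cauchy_schwarz2_eq _ _ (hsip E) T' A' (iE A') (iE_orth A') (iE_sqr A') sT.
have -> : hsip E T' A' ^+ 2 + hsip E T' (iE A') ^+ 2 = hsip E T' T' * hsip E A' A'.
  rewrite !hsipE -(sqr_hs_norm hT) -(sqr_hs_norm hA) -exprMn -e.
  by rewrite sqr_normc_parts (hs_innerE hT hA).
move=> /(_ erefl) h.
exists ((hsip E A' A')^-1%:C * Complex (hsip E T' A') (hsip E T' (iE A'))).
apply/funext => u; have := congr1 (fun S : hsop E => S u : H) h.
rewrite /= => hu; rewrite -scalerA.
have <- : (hsip E A' A')%:C *: (T u : H) = Complex (hsip E T' A') (hsip E T' (iE A')) *: A u.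
  rewrite [LHS]hu.
  have -> : Complex (hsip E T' A') (hsip E T' (iE A')) =
      (hsip E T' A')%:C + (hsip E T' (iE A'))%:C * 'i.
    by congr Complex => /=; ring.
  by rewrite scalerDl -scalerA.
by rewrite scalerA -rmorphM mulVf// scale1r.
Qed.

Lemma weakly_convergesE (T_ : nat -> H -> H) T :
  (forall n, hilbert_schmidt (T_ n)) -> hilbert_schmidt T ->
  weakly_converges T_ T <-> forall A, hilbert_schmidt A ->
    hspair e0 (T_ n) A @[n --> \oo] --> hspair e0 T A.
Proof.
move=> hT_ hT; split=> h A hA.
  have /cvg_complexP[+ _] := h A hA; rewrite (hs_innerE hT hA).
  by under eq_fun do rewrite (hs_innerE (hT_ _) hA).
have hiA := hs_scale oe0 'i hA.
apply/cvg_complexP; rewrite (hs_innerE hT hA); split.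
  by under eq_fun do rewrite (hs_innerE (hT_ _) hA); exact: h.
by under eq_fun do rewrite (hs_innerE (hT_ _) hA); exact: h.
Qed.

(** Convergent scalar sequences are bounded, so the uniform boundedness principle applies in the
    complete space [hsop E]. *)
Lemma weakly_converges_bounded (T_ : nat -> H -> H) T :
  (forall n, hilbert_schmidt (T_ n)) -> hilbert_schmidt T ->
  weakly_converges T_ T -> exists M, forall n, hs_norm (T_ n) <= M.
Proof.
move=> hT_ hT /(weakly_convergesE hT_ hT) h.
have [|M hM] := @uniform_boundedness _ _ _ (@hs_complete _ _ E)
    (fun n => to_hsop E (hT_ n)).
  move=> A; have := h A (hsopP A) => hA.
  have /cvg_seq_bounded := cvgP _ hA.
  move=> [M [Mr hM]]; exists (M + 1) => n.
  by rewrite hsipE; apply: (hM (M + 1)) => //; rewrite ltrDl.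
by exists M => n; rewrite (hs_normE (hT_ n)); have := hM n; rewrite /nrm hsipE.
Qed.

Lemma hs_weak_compactness (T_ : nat -> H -> H) M :
  (forall n, hilbert_schmidt (T_ n)) -> (forall n, hs_norm (T_ n) <= M) ->
  exists T (phi : nat -> nat), [/\ forall k, (k <= phi k)%N,
    hilbert_schmidt T, hs_norm T <= M & weakly_converges (T_ \o phi) T].
Proof.
move=> hT_ bT.
have [|T [phi [hphi TM hw]]] := @weak_compactness _ _ _ _ (@hs_complete _ _ E)
  (@hsbasis_on _ _ E) (@hsbasis_total _ _ E) (fun n => to_hsop E (hT_ n)) M.
  by move=> n; have := bT n; rewrite (hs_normE (hT_ n)) /nrm hsipE.
have hT := hsopP T; exists T, phi; split => //.
  by rewrite (hs_normE hT); move: TM; rewrite /nrm hsipE.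
apply/(weakly_convergesE (fun n => hT_ (phi n)) hT) => A hA; have := hw (to_hsop E hA).
by rewrite hsipE; under eq_fun do rewrite hsipE.
Qed.

Lemma hs_norm0 : hs_norm (fun _ : H => 0 : H) = 0.
Proof.
have h0 := hs0 oe0; rewrite (hs_normE h0).
have := hspair_sqr oe0 h0; rewrite /hsq eseries0; last first.
  by move=> n _ _; rewrite rip0l.
by case=> e; rewrite e sqrtr0.
Qed.

Lemma hs_norm_nonzero T : hilbert_schmidt T -> 0 < hs_norm T -> hs_nonzero T.
Proof. by move=> hT T0; split=> // T00; move: T0; rewrite T00 hs_norm0 ltxx. Qed.

End HsInner.

(** * Invariance of Lebesgue measure and time-frequency shifts *)

Section LebesgueInvariance.
Variable R : realType.
Local Notation lam := (@lebesgue_measure R).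
Local Notation M1 := (measurableTypeR R).

Definition preserves_lebesgue (phi : R -> R) :=
  measurable_fun [set: M1] (phi : M1 -> M1) /\
  forall A : set M1, measurable A -> lam (phi @^-1` A) = lam A.

Lemma preserves_translation (c : R) : preserves_lebesgue (fun x => x - c).
Proof.
have mc : measurable_fun [set: M1] ((fun x => x - c) : M1 -> M1).
  by apply: measurable_funB => //; exact: measurable_cst.
split=> // A mA; apply/esym.
apply: (@lebesgue_measure_unique R (pushforward lam ((fun x => x - c) : M1 -> M1))) => //= _ [[a b]] _ <-.
rewrite /pushforward /= (_ : _ @^-1` _ = `]a + c, b + c]%classic); last first.
  apply/seteqP; split => x /=; rewrite !in_itv/= => /andP[h1 h2];
  by apply/andP; split; lra.
rewrite !lebesgue_measure_itv/= !lte_fin ltrD2r.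
by case: ifP => // _; rewrite -!EFinD; congr (_%:E); ring.
Qed.

Lemma preserves_opp : preserves_lebesgue -%R.
Proof.
split; first exact: measurable_funN.
by move=> A mA; exact: lebesgue_measureN.
Qed.

Definition tmap n (phi : 'I_n -> R -> R) (t : euclid R n) : euclid R n :=
  [tuple phi i (tnth t i) | i < n].

Lemma measurable_tmap n (phi : 'I_n -> R -> R) :
  (forall i, measurable_fun [set: M1] (phi i : M1 -> M1)) ->
  measurable_fun [set: _] (tmap phi).
Proof.
move=> mphi; apply/measurable_fun_tnthP => i.
rewrite (_ : _ \o _ = (phi i : M1 -> M1) \o (@tnth n M1 ^~ i)).
  by apply: measurableT_comp => //; exact: measurable_tnth.
by apply/funext => t /=; rewrite tnth_mktuple.
Qed.

Lemma leb_succE n A : leb R n.+1 A = (lam \x leb R n)%E (@tcons R n @^-1` A).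
Proof. by []. Qed.

Lemma measurable_tcons_pre n (A : set (euclid R n.+1)) : measurable A ->
  measurable (@tcons R n @^-1` A).
Proof. by move=> mA; rewrite -[X in measurable X]setTI; exact: measurable_tcons. Qed.

(** Induction on the dimension: the image of the product measure under the coordinatewise map has
    the right value on rectangles, and these determine it. *)
Lemma leb_tmap n (phi : 'I_n -> R -> R) : (forall i, preserves_lebesgue (phi i)) ->
  forall A : set (euclid R n), measurable A -> leb R n (tmap phi @^-1` A) = leb R n A.
Proof.
elim: n phi => [|n IH] phi mphi A mA.
  congr (leb R 0 _); apply/seteqP; split => t /=;
  by rewrite (tuple0 (tmap phi t)) (tuple0 t).
pose phi' i := phi (lift ord0 i).
have mphi' i : measurable_fun [set: M1] (phi' i : M1 -> M1) by have [] := mphi (lift ord0 i).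
have [m0 p0] := mphi ord0.
pose F (u : M1 * euclid R n) : M1 * euclid R n := (phi ord0 u.1, tmap phi' u.2).
have mF : measurable_fun [set: _] F.
  apply/measurable_fun_pairP; split.
    by rewrite (_ : _ \o _ = (phi ord0 : M1 -> M1) \o fst)//; exact: measurableT_comp.
  rewrite (_ : _ \o _ = tmap phi' \o snd)//; apply: measurableT_comp => //.
  exact: measurable_tmap.
have tF u : tmap phi (tcons u) = tcons (F u).
  case: u => a t; apply: eq_from_tnth => i; rewrite tnth_mktuple /tcons /=.
  have [->|] := eqVneq i ord0; first by rewrite !tnth0.
  rewrite eq_sym => /unlift_some[j -> _]; by rewrite !tnthS tnth_mktuple.
have e : @tcons R n @^-1` (tmap phi @^-1` A) = F @^-1` (@tcons R n @^-1` A).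
  by apply/funext => u; exact: (congr1 A (tF u)).
rewrite !leb_succE e.
apply/esym.
apply: (@product_measure_unique _ _ _ _ _ lam (leb R n)
  (pushforward (lam \x leb R n)%E F)) => //; last exact: measurable_tcons_pre.
move=> X Y mX mY.
rewrite -[LHS]/((lam \x leb R n)%E ((phi ord0 @^-1` X) `*` (tmap phi' @^-1` Y))).
rewrite product_measure1E//.
- by congr (_ * _)%E; [exact: p0|apply: IH => // i; exact: mphi].
- by rewrite -[X in measurable X]setTI; exact: m0.
- by rewrite -[X in measurable X]setTI; apply: measurable_tmap.
Qed.

Lemma integral_tmap n (phi : 'I_n -> R -> R) (f : euclid R n -> \bar R) :
  (forall i, preserves_lebesgue (phi i)) -> measurable_fun [set: _] f ->
  (forall t, 0 <= f t)%E ->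
  (\int[leb R n]_t f (tmap phi t) = \int[leb R n]_t f t)%E.
Proof.
move=> pphi mf f0.
have mphi : measurable_fun [set: _] (tmap phi).
  by apply: measurable_tmap => i; have [] := pphi i.
have := @ge0_integral_pushforward _ _ _ _ R _ mphi (leb R n) setT f measurableT mf.
rewrite preimage_setT => <- //.
by apply: eq_measure_integral => A mA _; rewrite -[RHS](leb_tmap pphi).
Qed.

Lemma ae_tmap n (phi : 'I_n -> R -> R) (P : euclid R n -> Prop) :
  (forall i, preserves_lebesgue (phi i)) ->
  {ae leb R n, forall t, P t} -> {ae leb R n, forall t, P (tmap phi t)}.
Proof.
move=> pphi [N [mN N0 PN]].
have mphi : measurable_fun [set: _] (tmap phi).
  by apply: measurable_tmap => i; have [] := pphi i.
exists (tmap phi @^-1` N); split.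
- by rewrite -[X in measurable X]setTI; exact: mphi.
- exact: etrans (leb_tmap pphi mN) N0.
- by move=> t /= nP; exact: PN.
Qed.

Lemma measurable_box n (I : set R) : measurable (I : set M1) ->
  measurable [set t : euclid R n | forall i, I (tnth t i)].
Proof.
move=> mI.
rewrite (_ : [set t | _] = \bigcap_(i in [set: 'I_n]) ((@tnth n M1 ^~ i) @^-1` I)).
  apply: fin_bigcap_measurable; first exact: finite_finset.
  by move=> i _; rewrite -[X in measurable X]setTI; exact: measurable_tnth.
by apply/seteqP; split => t h i; [move=> _|]; exact: h.
Qed.

Lemma leb_box n (I : set R) (r : R) : measurable (I : set M1) -> lam I = r%:E ->
  leb R n [set t | forall i, I (tnth t i)] = (r ^+ n)%:E.
Proof.
move=> mI Ir; elim: n => [|n IH].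
  rewrite (_ : [set t | _] = setT); last by apply/seteqP; split => t // _ [].
  by rewrite /= diracT.
rewrite leb_succE (_ : _ @^-1` _ = I `*` [set t | forall i, I (tnth t i)]).
  rewrite product_measure1E//; last exact: measurable_box.
  by rewrite exprS EFinM; congr (_ * _)%E.
apply/seteqP; split => -[a t] /=.
  move=> h; split; first by have := h ord0; rewrite /tcons tnth0.
  by move=> i; have := h (lift ord0 i); rewrite /tcons tnthS.
move=> [Ia It] i; rewrite /tcons; have [->|] := eqVneq i ord0; first by rewrite tnth0.
by rewrite eq_sym => /unlift_some[j -> _]; rewrite tnthS.
Qed.

Lemma leb_hyperplane n (c : R) : leb R n.+1 [set t | thead t = c] = 0%E.
Proof.
rewrite leb_succE (_ : _ @^-1` _ = [set c] `*` setT).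
  rewrite product_measure1E// -[RHS](mul0e (leb R n setT)).
  by congr (_ * _)%E; exact: lebesgue_measure_set1.
by apply/seteqP; split => -[a t] /=; rewrite theadE => // -[].
Qed.

End LebesgueInvariance.

(** * Weighted compositions and unitary operators *)

Section WeightedComposition.
Variables (R : realType) (d : nat).
Local Notation C := R[i].
Local Notation H := (L2 R d).
Local Notation B := (reip R d).
Local Notation mu := (leb R d).
Implicit Types (u v : H).

Section OneMap.
Variables (w : euclid R d -> C) (phi : 'I_d -> R -> R).
Hypotheses (mw : mfunc w) (w1 : forall y, Normc.normc (w y) = 1)
  (pphi : forall i, preserves_lebesgue (phi i)).

(** The common form of time-frequency shifts and parity: a unimodular weight and a
    measure-preserving change of each coordinate. *)
Definition wcomp u : H := toL2 (fun y => w y * l2rep u (tmap phi y)).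

Let mphi : measurable_fun [set: _] (tmap phi).
Proof. by apply: measurable_tmap => i; have [] := pphi i. Qed.

Let normc_w y (z : C) : Normc.normc (w y * z) = Normc.normc z.
Proof. by rewrite Normc.normcM w1 mul1r. Qed.

Lemma wcomp_sqint u : square_integrable (fun y => w y * l2rep u (tmap phi y)).
Proof.
have [m1 m2 fi] := l2rep_sqint u.
have [n1 n2] : mfunc (fun y => w y * l2rep u (tmap phi y)).
  apply: mfuncM => //; split.
    by rewrite (_ : (fun x => _) = (fun y => complex.Re (l2rep u y)) \o tmap phi)//;
      exact: measurableT_comp.
  by rewrite (_ : (fun x => _) = (fun y => complex.Im (l2rep u y)) \o tmap phi)//;
    exact: measurableT_comp.
split => //; under eq_integral do rewrite normc_w.
rewrite (integral_tmap (f := fun y => (Normc.normc (l2rep u y) ^+ 2)%:E) pphi)//.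
  exact: measurable_sqr_normc.
by move=> t; rewrite lee_fin sqr_ge0.
Qed.

Lemma wcompE u : {ae mu, forall y, l2rep (wcomp u) y = w y * l2rep u (tmap phi y)}.
Proof. exact: toL2E (wcomp_sqint u). Qed.

Lemma wcomp_linear : linear wcomp.
Proof.
move=> a u v; apply: toL2_ext; first exact: wcomp_sqint.
have h1 := ae_tmap pphi (l2rep_lin a u v).
have h2 := l2rep_lin a (wcomp u) (wcomp v).
have h3 : {ae mu, forall y, l2rep (wcomp u) y = w y * l2rep u (tmap phi y) /\
    l2rep (wcomp v) y = w y * l2rep v (tmap phi y)}.
  exact: filterI (wcompE u) (wcompE v).
apply: filterS3 h1 h2 h3 => y -> -> [-> ->].
by rewrite mulrDr mulrCA.
Qed.

Lemma wcomp_sqr u : B (wcomp u) (wcomp u) = B u u.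
Proof.
have [m1 m2 fi] := l2rep_sqint u.
apply: EFin_inj; rewrite reipE (sqr_l2normE (wcomp_sqint u) (wcompE u)).
under eq_integral do rewrite normc_w.
rewrite (integral_tmap (f := fun y => (Normc.normc (l2rep u y) ^+ 2)%:E) pphi)//.
- by rewrite -sqr_l2norm reipE.
- exact: measurable_sqr_normc.
by move=> t; rewrite lee_fin sqr_ge0.
Qed.

End OneMap.

Lemma wcomp_comp w phi w' phi' : mfunc w -> (forall y, Normc.normc (w y) = 1) ->
  (forall i, preserves_lebesgue (phi i)) ->
  mfunc w' -> (forall y, Normc.normc (w' y) = 1) ->
  (forall i, preserves_lebesgue (phi' i)) -> forall u,
  {ae mu, forall y, l2rep (wcomp w phi (wcomp w' phi' u)) y =
    w y * w' (tmap phi y) * l2rep u (tmap phi' (tmap phi y))}.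
Proof.
move=> mw w1 pphi mw' w1' pphi' u.
have h1 := wcompE mw w1 pphi (wcomp w' phi' u).
have h2 := ae_tmap pphi (wcompE mw' w1' pphi' u).
by apply: filterS2 h1 h2 => y -> ->; rewrite mulrA.
Qed.

Definition unitary (U : H -> H) := [/\ linear U,
  forall u, B (U u) (U u) = B u u & forall v, exists u, U u = v].

Lemma unitary_bounded U : unitary U -> bounded_operator U.
Proof.
move=> [lU nU _]; split => //; exists 1 => u.
by rewrite mul1r !L2norm_nrm /nrm nU.
Qed.

Lemma unitary_reip U u v : unitary U -> B (U u) (U v) = B u v.
Proof.
move=> hU; have [lU nU _] := hU; have bU := unitary_bounded hU.
have lD x y : U (x + y) = U x + U y.
  by have := lU 1 x y; rewrite !scale1r.
have lN x y : U (x - y) = U x - U y.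
  by have := lU (-1) y x; rewrite !scaleN1r (addrC _ x) => ->; rewrite addrC.
by rewrite polar -lD -lN !nU -polar.
Qed.

Lemma unitary_inner U u v : unitary U -> inner (U u) (U v) = inner u v.
Proof.
move=> hU; rewrite !innerE (unitary_reip _ _ hU); congr Complex.
by rewrite -(bounded_linZ _ _ (unitary_bounded hU)) (unitary_reip _ _ hU).
Qed.

Variable e0 : nat -> H.
Hypothesis oe0 : orthonormal_basis e0.

Lemma unitary_adjointK U : unitary U -> adjoint U \o U = id.
Proof.
move=> hU; apply/funext => u /=; apply: inner_ext => v.
by rewrite -(adjointP oe0 (unitary_bounded hU)) unitary_inner.
Qed.

Lemma unitary_Kadjoint U : unitary U -> U \o adjoint U = id.
Proof.
move=> hU; apply/funext => v /=; have [_ _ /(_ v)[u <-]] := hU.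
by have /(congr1 (fun F : H -> H => F u)) /= -> := unitary_adjointK hU.
Qed.

Lemma unitary_adjoint U : unitary U -> unitary (adjoint U).
Proof.
move=> hU; have bU := unitary_bounded hU; split.
- by have [] := bounded_adjoint oe0 bU.
- move=> u; rewrite -(unitary_reip _ _ hU).
  by have /(congr1 (fun F : H -> H => F u)) /= -> := unitary_Kadjoint hU.
- move=> v; exists (U v).
  by have /(congr1 (fun F : H -> H => F v)) /= := unitary_adjointK hU.
Qed.

Lemma unitary_basis U e : unitary U -> orthonormal_basis e ->
  orthonormal_basis (U \o e).
Proof.
move=> hU [oe te]; split; first by move=> m n /=; rewrite unitary_inner.
move=> u u0; have [_ _ /(_ u)[v vu]] := hU; move: u0; rewrite -vu => u0.
suff -> : v = 0 by exact: (bounded_lin0 (unitary_bounded hU)).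
by apply: te => n; rewrite -(unitary_inner v (e n) hU); exact: u0.
Qed.

End WeightedComposition.

(** * Time-frequency shifts, $\alpha_z$ and the operator convolution *)

Section TimeFrequency.
Variables (R : realType) (d : nat).
Local Notation C := R[i].
Local Notation H := (L2 R d).
Local Notation B := (reip R d).
Local Notation mu := (leb R d).
Implicit Types (u v : H) (z : phase R d).

Definition cis (t : R) : C := Complex (cos t) (sin t).

Lemma normc_cis t : Normc.normc (cis t) = 1.
Proof. by rewrite /= cos2Dsin2 sqrtr1. Qed.

Lemma cisD s t : cis (s + t) = cis s * cis t.
Proof. by rewrite /cis sinD cosD; congr Complex; rewrite ?(addrC (sin s * _)). Qed.

Definition tsub (y x : euclid R d) : euclid R d :=
  tmap (fun i r => r - tnth x i) y.

Definition tneg (x : euclid R d) : euclid R d := tmap (fun _ => -%R) x.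

Definition character (xi y : euclid R d) : C := cis (2 * pi * dot xi y).

Lemma measurable_dot (d1 : measure_display) (T : measurableType d1)
    (f g : T -> euclid R d) :
  measurable_fun setT f -> measurable_fun setT g ->
  measurable_fun setT (fun t => dot (f t) (g t)).
Proof.
move=> mf mg; apply: measurable_sum => i; apply: measurable_funM.
  exact: (measurableT_comp (measurable_tnth i) mf).
exact: (measurableT_comp (measurable_tnth i) mg).
Qed.

Lemma measurable_cis (d1 : measure_display) (T : measurableType d1) (f : T -> R) :
  measurable_fun setT f ->
  measurable_fun setT (fun t => complex.Re (cis (f t))) /\
  measurable_fun setT (fun t => complex.Im (cis (f t))).
Proof.
move=> mf; split; rewrite /cis /=.
  apply: measurableT_comp mf; apply: continuous_measurable_fun; exact: continuous_cos.
apply: measurableT_comp mf; apply: continuous_measurable_fun; exact: continuous_sin.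
Qed.

Lemma mfunc_character xi : mfunc (character xi).
Proof.
apply: measurable_cis; apply: measurable_funM; first exact: measurable_cst.
by apply: measurable_dot => //; exact: measurable_cst.
Qed.

Lemma time_freq_shiftE z :
  time_freq_shift z = wcomp (character z.2) (fun i r => r - tnth z.1 i).
Proof. by []. Qed.

Let tsub_pres (x : euclid R d) i : preserves_lebesgue (fun r : R => r - tnth x i).
Proof. exact: preserves_translation. Qed.

Let char1 xi y : Normc.normc (character xi y) = 1.
Proof. exact: normc_cis. Qed.

Lemma l2rep_shift z u : {ae mu, forall y,
  l2rep (time_freq_shift z u) y = character z.2 y * l2rep u (tsub y z.1)}.
Proof. exact: wcompE (mfunc_character _) (char1 _) (tsub_pres z.1) u. Qed.

Lemma unitary_shift z : unitary (time_freq_shift z).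
Proof.
split.
- exact: wcomp_linear (mfunc_character _) (char1 _) (tsub_pres z.1).
- exact: wcomp_sqr (mfunc_character _) (char1 _) (tsub_pres z.1).
(* Surjectivity: [W] is $\pi(-z)$, and $\pi(z)\pi(-z)$ is multiplication by the constant phase
   $e^{2\pi i\xi\cdot x}$, which [c] cancels. *)
pose W := wcomp (character (tneg z.2)) (fun i r => r - tnth (tneg z.1) i).
move=> v; pose c := cis (- (2 * pi * dot z.2 z.1)).
exists (W (c *: v)); rewrite time_freq_shiftE; apply: l2_ext.
have h1 := wcomp_comp (mfunc_character z.2) (char1 z.2) (tsub_pres z.1)
  (mfunc_character (tneg z.2)) (char1 _) (tsub_pres (tneg z.1)) (c *: v).
have h2 := l2rep_lin c v 0; rewrite addr0 in h2.
have h3 := l2rep_lin 0 v (0 : H); rewrite scale0r add0r in h3.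
have h0 := l2rep_lin (-1) v v; rewrite scaleN1r addNr in h0.
apply: filterS3 h1 h2 h0 => y -> + hy.
have -> : tmap (fun i r => r - tnth (tneg z.1) i)
    (tmap (fun i r => r - tnth z.1 i) y) = y.
  by apply: eq_from_tnth => i; rewrite !tnth_mktuple opprK subrK.
move=> ->; rewrite hy mulN1r addNr addr0 mulrA.
rewrite /character -!cisD (_ : _ + _ = 0).
  by rewrite /cis cos0 sin0 mul1r.
have -> : dot (tneg z.2) (tmap (fun i r => r - tnth z.1 i) y) = dot z.2 z.1 - dot z.2 y.
  rewrite /dot -sumrB; apply: eq_bigr => i _; rewrite !tnth_mktuple; ring.
by ring.
Qed.

Lemma parityK : involutive (@parity R d).
Proof.
have m1 : mfunc (fun _ : euclid R d => 1 : C) by split; exact: measurable_cst.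
have n1 (y : euclid R d) : Normc.normc (1 : C) = 1 by rewrite Normc.normc1.
have pp (i : 'I_d) : preserves_lebesgue -%R := preserves_opp R.
have parityE : @parity R d = wcomp (fun=> 1) (fun _ => -%R).
  by apply/funext => u; rewrite /wcomp /parity; congr toL2; apply/funext => y; rewrite mul1r.
move=> u; rewrite parityE; apply: l2_ext.
apply: filterS (wcomp_comp m1 n1 pp m1 n1 pp u) => y ->.
rewrite mul1r mul1r; congr (l2rep u _); apply: eq_from_tnth => i.
by rewrite !tnth_mktuple opprK.
Qed.

Lemma op_checkK (S : H -> H) : op_check (op_check S) = S.
Proof. by apply/funext => u; rewrite /op_check /= !parityK. Qed.

Variable E : onb R d.
Let e0 : nat -> H := proj1_sig E.
Let oe0 : orthonormal_basis e0 := proj2_sig E.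

Lemma hs_alpha z (S : H -> H) : hilbert_schmidt S -> hilbert_schmidt (alpha z S).
Proof.
move=> hS; have hU := unitary_shift z; have bU := unitary_bounded hU.
exact: (hs_compr oe0 (bounded_adjoint oe0 bU) (hs_compl oe0 bU hS)).
Qed.

Lemma hsq_alpha z (S : H -> H) : hilbert_schmidt S -> hsq e0 (alpha z S) = hsq e0 S.
Proof.
move=> hS; have hU := unitary_shift z; have [bS _] := (hsP oe0 S).1 hS.
have hU' := unitary_adjoint oe0 hU.
rewrite [RHS](hsq_basis oe0 oe0 (unitary_basis hU' oe0) bS).
by apply: eq_eseriesr => n _; rewrite (unitary_reip _ _ hU).
Qed.

Lemma hs_norm_alpha z (S : H -> H) : hilbert_schmidt S ->
  hs_norm (alpha z S) = hs_norm S.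
Proof.
move=> hS; have haS := hs_alpha z hS.
rewrite (hs_normE E haS) (hs_normE E hS); congr (Num.sqrt _).
by apply: EFin_inj; rewrite (hspair_sqr oe0 haS) (hspair_sqr oe0 hS) hsq_alpha.
Qed.

Lemma adjoint_alpha z (S : H -> H) : hilbert_schmidt S ->
  adjoint (alpha z S) = alpha z (adjoint S).
Proof.
move=> hS; have hU := unitary_shift z; have bU := unitary_bounded hU.
have [bS _] := (hsP oe0 S).1 hS.
rewrite /alpha (adjoint_comp oe0 (bounded_comp bU bS) (bounded_adjoint oe0 bU)).
by rewrite (adjointK oe0 bU) (adjoint_comp oe0 bU bS).
Qed.

(** The two checks cancel, leaving the trace of $T\alpha_z(S)$; the second factor is then written as
    a double adjoint. *)
Lemma op_convE (T S : H -> H) z : hilbert_schmidt S ->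
  op_conv T (op_check S) z = hs_inner T (adjoint (alpha z S)).
Proof.
move=> hS; rewrite /op_conv op_checkK /hs_inner (adjointK oe0)//.
by have [] := (hsP oe0 _).1 (hs_alpha z hS).
Qed.

Lemma normc_op_conv (T S : H -> H) z : hilbert_schmidt T -> hilbert_schmidt S ->
  Normc.normc (op_conv T (op_check S) z) <= hs_norm T * hs_norm S.
Proof.
move=> hT hS; have haS := hs_alpha z hS; rewrite op_convE//.
rewrite -(hs_norm_alpha z hS) -(hs_norm_adjoint E haS).
exact: (hs_cauchy_schwarz E hT (hs_adjoint oe0 haS)).
Qed.

End TimeFrequency.

(** * Measurability in the phase space variable *)

Section PhaseMeasurability.
Variables (R : realType) (d : nat).
Local Notation C := R[i].
Local Notation H := (L2 R d).
Local Notation B := (reip R d).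
Local Notation mu := (leb R d).
Implicit Types (u v : H) (T S A : H -> H).

Lemma measurable_phase (X : set (phase R d)) :
  measurable (X : set (euclid R d * euclid R d)%type) -> measurable X.
Proof. by move=> mX; apply: sub_caratheodory; exact: sub_sigma_algebra. Qed.

Lemma leb2E (X : set (phase R d)) :
  measurable (X : set (euclid R d * euclid R d)%type) ->
  leb2 R d X = (leb R d \x leb R d)%E X.
Proof. by move=> mX; exact: measurable_mu_extE. Qed.

Lemma measurable_fun_phase (d1 : measure_display) (T1 : measurableType d1)
    (f : (euclid R d * euclid R d)%type -> T1) :
  measurable_fun setT f -> measurable_fun [set: phase R d] (f : phase R d -> T1).
Proof.
move=> mf _ Y mY; rewrite setTI; apply: measurable_phase.
by rewrite -[X in measurable X]setTI; exact: mf.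
Qed.

(** Tonelli for the positive and the negative part separately; [fine] keeps measurability also where
    the integral is not finite. *)
Lemma measurable_Rintegral_param (d1 d2 : measure_display) (X : measurableType d1)
    (Y : measurableType d2) (m : {sigma_finite_measure set Y -> \bar R})
    (F : X * Y -> R) : measurable_fun setT F ->
  measurable_fun setT (fun x => \int[m]_y F (x, y)).
Proof.
move=> mF; pose G q := (F q)%:E.
have mG : measurable_fun setT G by exact/measurable_EFinP.
have e x : \int[m]_y F (x, y) = fine
    (\int[m]_y (G^\+%E (x, y)) - \int[m]_y (G^\-%E (x, y)))%E.
  by rewrite /Rintegral integralE; congr (fine (_ - _)%E);
    apply: eq_integral => y _; rewrite ?funeposE ?funenegE.
under eq_fun do rewrite e.
apply: measurableT_comp; first exact: fine_measurable.
apply: emeasurable_funB.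
  apply: (measurable_fun_fubini_tonelli_F (m2 := m) (G^\+%E)).
    exact: measurable_funepos.
  by move=> q; exact: funepos_ge0.
apply: (measurable_fun_fubini_tonelli_F (m2 := m) (G^\-%E)).
  exact: measurable_funeneg.
by move=> q; exact: funeneg_ge0.
Qed.

Lemma measurable_tsub (d1 : measure_display) (T1 : measurableType d1)
    (f g : T1 -> euclid R d) : measurable_fun setT f -> measurable_fun setT g ->
  measurable_fun setT (fun t => tsub (f t) (g t)).
Proof.
move=> mf mg; apply/measurable_fun_tnthP => i.
rewrite (_ : _ \o _ = fun t => (tnth (f t) i : measurableTypeR R) - tnth (g t) i); last first.
  by apply/funext => t /=; rewrite tnth_mktuple.
apply: measurable_funB.
  exact: (measurableT_comp (measurable_tnth i) mf).
exact: (measurableT_comp (measurable_tnth i) mg).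
Qed.

Lemma measurable_reip_shift u v :
  measurable_fun [set: phase R d] (fun z => B u (time_freq_shift z v)).
Proof.
pose F (q : ((euclid R d * euclid R d) * euclid R d)%type) : C :=
  l2rep u q.2 * (character q.1.2 q.2 * l2rep v (tsub q.2 q.1.1))^*.
have rE z : B u (time_freq_shift z v) = \int[mu]_y complex.Re (F (z, y)).
  rewrite reipE (@inner_ae _ _ (l2rep u)
    (fun y => character z.2 y * l2rep v (tsub y z.1)))//.
  - exact: l2rep_sqint.
  - apply: wcomp_sqint; [exact: mfunc_character|by move=> y; exact: normc_cis|].
    by move=> i; exact: preserves_translation.
  - exact: aeW.
  - exact: l2rep_shift.
under eq_fun do rewrite rE.
apply: (measurable_fun_phase (f := fun z => \int[mu]_y complex.Re (F (z, y)))).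
apply: (@measurable_Rintegral_param _ _ _ _ mu (fun q => complex.Re (F q))).
have m2 : measurable_fun setT
    (fun q : (euclid R d * euclid R d) * euclid R d => q.2).
  exact: measurable_snd.
have m11 : measurable_fun setT
    (fun q : (euclid R d * euclid R d) * euclid R d => q.1.1).
  exact: (measurableT_comp measurable_fst measurable_fst).
have m12 : measurable_fun setT
    (fun q : (euclid R d * euclid R d) * euclid R d => q.1.2).
  exact: (measurableT_comp measurable_snd measurable_fst).
have [ru iu] := sqint_mfunc (l2rep_sqint u).
have [rv iv] := sqint_mfunc (l2rep_sqint v).
have mu_ : mfunc (fun q : (euclid R d * euclid R d) * euclid R d => l2rep u q.2).
  by split; [exact: (measurableT_comp ru m2)|exact: (measurableT_comp iu m2)].
have mts := measurable_tsub m2 m11.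
have mv_ : mfunc (fun q : (euclid R d * euclid R d) * euclid R d =>
    l2rep v (tsub q.2 q.1.1)).
  by split; [exact: (measurableT_comp rv mts)|exact: (measurableT_comp iv mts)].
have mc_ : mfunc (fun q : (euclid R d * euclid R d) * euclid R d =>
    character q.1.2 q.2).
  apply: measurable_cis; apply: measurable_funM; first exact: measurable_cst.
  exact: measurable_dot.
by have [] := mfuncM mu_ (mfunc_conj (mfuncM mc_ mv_)).
Qed.

Variable E : onb R d.
Let e0 : nat -> H := proj1_sig E.
Let oe0 : orthonormal_basis e0 := proj2_sig E.

(** Both the pairing and, through Parseval, each of its terms are limits of finite sums of products
    of the coefficients $\mathrm{Re}\langle u,\pi(z)v\rangle$, which are measurable by
    [measurable_reip_shift]. *)
Lemma measurable_hspair_alpha T A : hilbert_schmidt T -> hilbert_schmidt A ->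
  measurable_fun [set: phase R d] (fun z => hspair e0 T (alpha z A)).
Proof.
move=> hT hA; have [bA _] := (hsP oe0 A).1 hA.
have step u v : measurable_fun [set: phase R d]
    (fun z => B u (alpha z A v)).
  pose rb := rbasis e0.
  pose h N z := \sum_(k < N) B u (time_freq_shift z (rb k)) *
    B v (time_freq_shift z (adjoint A (rb k))).
  apply: (@measurable_fun_cvg _ _ _ setT h).
    move=> N; apply: measurable_sum => k.
    by apply: measurable_funM; exact: measurable_reip_shift.
  move=> z _; have hU := unitary_shift z; have bU := unitary_bounded hU.
  have hU' := unitary_adjoint oe0 hU.
  have bU' := unitary_bounded hU'.
  have e1 x y : B (adjoint (time_freq_shift z) x) y = B x (time_freq_shift z y).
    by rewrite ripC [RHS]ripC !reipE (adjointP oe0 bU).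
  have e2 : B u (alpha z A v) =
      B (adjoint (time_freq_shift z) u) (A (adjoint (time_freq_shift z) v)).
    by rewrite e1.
  rewrite e2; have := parseval (rbasis_on oe0) (@L2_complete R d) (rbasis_total oe0)
    (adjoint (time_freq_shift z) u) (A (adjoint (time_freq_shift z) v)).
  apply: cvg_trans; apply: near_eq_cvg; apply: nearW => N.
  apply: eq_bigr => k _; rewrite e1; congr (_ * _).
  by rewrite -e1 !reipE (adjointP oe0 bA).
apply: (@measurable_fun_cvg _ _ _ setT
  (fun N z => series (fun n => B (T (e0 n)) (alpha z A (e0 n))) N)).
  move=> N; rewrite /series /=; under eq_fun do rewrite big_mkord.
  by apply: measurable_sum => n; exact: step.
by move=> z _; exact: (hspair_cvg oe0 oe0 hT (hs_alpha E z hA)).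
Qed.

Lemma alpha_iZ z A : (fun u => 'i *: alpha z A u) = alpha z (fun u => 'i *: A u).
Proof.
apply/funext => u; rewrite /alpha /=.
by rewrite (bounded_linZ _ _ (unitary_bounded (unitary_shift z))).
Qed.

Lemma op_conv_hspair T S z : hilbert_schmidt T -> hilbert_schmidt S ->
  op_conv T (op_check S) z = Complex (hspair e0 T (alpha z (adjoint S)))
    (hspair e0 T (alpha z (fun u => 'i *: adjoint S u))).
Proof.
move=> hT hS; have hS' := hs_adjoint oe0 hS.
rewrite (op_convE E _ _ hS) (adjoint_alpha E z hS).
by rewrite (hs_innerE E hT (hs_alpha E z hS')) alpha_iZ.
Qed.

Lemma mfunc_op_conv T S : hilbert_schmidt T -> hilbert_schmidt S ->
  mfunc (op_conv T (op_check S)).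
Proof.
move=> hT hS; have hS' := hs_adjoint oe0 hS; have hiS := hs_scale oe0 'i hS'.
split; under eq_fun do rewrite (op_conv_hspair _ hT hS);
exact: measurable_hspair_alpha.
Qed.

Lemma measurable_normc_powR (d1 : measure_display) (X : measurableType d1)
    (f : X -> C) (p : R) : mfunc f ->
  measurable_fun setT (fun x => (Normc.normc (f x) `^ p)%:E : \bar R).
Proof.
move=> [m1 m2]; apply/measurable_EFinP.
apply: (measurableT_comp (measurable_powR p)).
have e x : Normc.normc (f x) =
    (complex.Re (f x) ^+ 2 + complex.Im (f x) ^+ 2) `^ (2^-1).
  by rewrite powR12_sqrt ?addr_ge0 ?sqr_ge0//; case: (f x).
under eq_fun do rewrite e.
apply: (measurableT_comp (measurable_powR _)).
by apply: measurable_funD; exact: measurable_funX.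
Qed.

End PhaseMeasurability.

(** * The concentration functional *)

(** Through the exponential and the logarithm when the limit is positive; at limit zero the
    logarithm is of no use and the threshold $e^{1/q}$ is taken directly. *)
Lemma cvg_powR (R : realType) (q : R) (x : nat -> R) (l : R) : 0 < q ->
  (forall n, 0 <= x n) -> x @ \oo --> l -> x n `^ q @[n --> \oo] --> l `^ q.
Proof.
move=> q0 x0 xl.
have : 0 <= l.
  rewrite -(cvg_lim (@Rhausdorff R) xl); apply: limr_ge; first exact: cvgP xl.
  exact: nearW.
rewrite le_eqVlt => /orP[/eqP l0|l0]; last first.
  have h : (fun r => expR (q * ln r)) (x n) @[n --> \oo] --> expR (q * ln l).
    apply: continuous_cvg; first exact: continuous_expR.
    apply: cvgM; first exact: cvg_cst.
    by apply: continuous_cvg => //; exact: continuous_ln.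
  have -> : l `^ q = expR (q * ln l) by rewrite /powR gt_eqF.
  apply: cvg_trans h; apply: near_eq_cvg.
  have [N _ hN] := cvgr_gt l xl 0 l0; exists N => // n /hN /= xn.
  by rewrite /powR gt_eqF.
rewrite -l0 powR0 ?gt_eqF//; apply/cvgrPdist_lt => e e0.
have d0 : 0 < e `^ q^-1 by rewrite powR_gt0.
rewrite -l0 in xl; move/cvgrPdist_lt : xl => /(_ _ d0)[N _ hN]; exists N => // n /hN /=.
rewrite !sub0r !normrN !ger0_norm ?powR_ge0// => h.
rewrite -[ltRHS](powRr1 (ltW e0)) -(mulVf (lt0r_neq0 q0)) powRrM.
by apply: gt0_ltr_powR => //; rewrite nnegrE ?powR_ge0.
Qed.

Lemma cvg_poweR (R : realType) (q : R) (x : nat -> \bar R) (l : \bar R) : 0 < q ->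
  (forall n, (0 <= x n)%E) -> (forall n, x n \is a fin_num) -> l \is a fin_num ->
  x n @[n --> \oo] --> l -> (x n `^ q)%E @[n --> \oo] --> (l `^ q)%E.
Proof.
move=> q0 x0 xf lf xl.
have hf : fine (x n) @[n --> \oo] --> fine l by apply: fine_cvg; rewrite fineK.
rewrite -(fineK lf) poweR_EFin; under eq_fun do rewrite -(fineK (xf _)) poweR_EFin.
apply: cvg_EFin; first exact: nearW.
by apply: cvg_powR => // n; rewrite fine_ge0.
Qed.

Lemma cvg_normc_powR (R : realType) (q : R) (x : nat -> R[i]) (l : R[i]) : 0 < q ->
  complex.Re (x n) @[n --> \oo] --> complex.Re l ->
  complex.Im (x n) @[n --> \oo] --> complex.Im l ->
  Normc.normc (x n) `^ q @[n --> \oo] --> Normc.normc l `^ q.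
Proof.
move=> q0 h1 h2.
have nE (c : R[i]) : Normc.normc c `^ q =
    (complex.Re c ^+ 2 + complex.Im c ^+ 2) `^ (2^-1 * q).
  by rewrite powRrM powR12_sqrt ?addr_ge0 ?sqr_ge0//; case: c.
under eq_fun do rewrite nE; rewrite nE.
apply: cvg_powR; first by rewrite mulr_gt0.
  by move=> n; rewrite addr_ge0// sqr_ge0.
by rewrite !expr2; under eq_fun do rewrite !expr2; apply: cvgD; apply: cvgM.
Qed.

(** * Weak continuity and existence of a maximizer for fixed $S$ *)

Section Concentration.
Variables (R : realType) (d : nat).
Local Notation C := R[i].
Local Notation H := (L2 R d).
Implicit Types (T S A : H -> H).
Variables (p : R) (p_ge1 : 1 <= p).
Variables (Omega : set (phase R d)) (mOmega : measurable Omega).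
Hypothesis Omega_fin : (leb2 R d Omega < +oo)%E.
Variable E : onb R d.
Let e0 : nat -> H := proj1_sig E.
Let oe0 : orthonormal_basis e0 := proj2_sig E.

Let p0 : 0 < p. Proof. exact: lt_le_trans p_ge1. Qed.

Definition conc_integral S T : \bar R :=
  (\int[leb2 R d]_(z in Omega) (Normc.normc (op_conv T (op_check S) z) `^ p)%:E)%E.

Lemma concentrationE S T : concentration p Omega S T = (conc_integral S T `^ p^-1)%E.
Proof. by []. Qed.

Lemma conc_integral_ge0 S T : (0 <= conc_integral S T)%E.
Proof. by apply: integral_ge0 => z _; rewrite lee_fin powR_ge0. Qed.

Lemma measurable_conc S T : hilbert_schmidt S -> hilbert_schmidt T ->
  measurable_fun Omega
    (fun z => (Normc.normc (op_conv T (op_check S) z) `^ p)%:E : \bar R).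
Proof.
move=> hS hT.
exact: (measurable_funS measurableT (@subsetT _ _)
  (measurable_normc_powR p (mfunc_op_conv E hT hS))).
Qed.

Lemma conc_integral_le S T : hilbert_schmidt S -> hilbert_schmidt T ->
  (conc_integral S T <= ((hs_norm T * hs_norm S) `^ p)%:E * leb2 R d Omega)%E.
Proof.
move=> hS hT; rewrite /conc_integral -(integral_cst (leb2 R d) mOmega).
apply: (ge0_le_integral _ mOmega).
- by move=> z _; rewrite lee_fin powR_ge0.
- exact: (measurable_conc hS hT).
- exact: measurable_cst.
move=> z _; rewrite lee_fin; apply: ge0_ler_powR; first exact: ltW.
- by rewrite nnegrE normc_ge0.
- by rewrite nnegrE mulr_ge0// hs_norm_ge0.
- exact: (normc_op_conv E z hT hS).
Qed.

Lemma conc_integral_fin S T : hilbert_schmidt S -> hilbert_schmidt T ->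
  conc_integral S T \is a fin_num.
Proof.
move=> hS hT; rewrite ge0_fin_numE ?conc_integral_ge0//.
apply: (le_lt_trans (conc_integral_le hS hT)).
by apply: lte_mul_pinfty; rewrite // lee_fin powR_ge0.
Qed.

Lemma concentration_fin S T : hilbert_schmidt S -> hilbert_schmidt T ->
  concentration p Omega S T \is a fin_num.
Proof.
move=> hS hT; rewrite concentrationE.
exact: fin_num_poweR (conc_integral_fin hS hT).
Qed.

Lemma concentration_le S T : hilbert_schmidt S -> hilbert_schmidt T ->
  (concentration p Omega S T <=
    (hs_norm T * hs_norm S)%:E * leb2 R d Omega `^ p^-1)%E.
Proof.
move=> hS hT; have n0 : 0 <= hs_norm T * hs_norm S by rewrite mulr_ge0// hs_norm_ge0.
have pow1 : (hs_norm T * hs_norm S)%:E =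
    ((((hs_norm T * hs_norm S) `^ p)%:E : \bar R) `^ p^-1)%E.
  by rewrite poweR_EFin -powRrM mulfV ?gt_eqF// powRr1.
rewrite concentrationE pow1 -poweRM ?lee_fin ?powR_ge0//.
apply: gt0_ler_poweR; first by rewrite invr_ge0 ltW.
- by rewrite in_itv/= conc_integral_ge0 leey.
- by rewrite in_itv/= mule_ge0 ?lee_fin ?powR_ge0 ?leey.
exact: conc_integral_le.
Qed.

Lemma op_conv_cvg S (T_ : nat -> H -> H) T z :
  (forall n, hilbert_schmidt (T_ n)) -> hilbert_schmidt T -> hilbert_schmidt S ->
  weakly_converges T_ T ->
  Normc.normc (op_conv (T_ n) (op_check S) z) `^ p @[n --> \oo] -->
    Normc.normc (op_conv T (op_check S) z) `^ p.
Proof.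
move=> hT_ hT hS w.
have hA := hs_adjoint oe0 (hs_alpha E z hS).
have := w _ hA; rewrite -(op_convE E T z hS).
under eq_fun do rewrite -(op_convE E _ z hS).
move=> /cvg_complexP[h1 h2].
exact: (cvg_normc_powR p0 h1 h2).
Qed.

(** Dominated convergence with the constant $(M\|S\|)^p$, where $M$ bounds the norms of the
    sequence; the constant is integrable because $\Omega$ has finite measure. *)
Lemma concentration_cvg S (T_ : nat -> H -> H) T :
  (forall n, hilbert_schmidt (T_ n)) -> hilbert_schmidt T -> hilbert_schmidt S ->
  weakly_converges T_ T ->
  concentration p Omega S (T_ n) @[n --> \oo] --> concentration p Omega S T.
Proof.
move=> hT_ hT hS w; have [M hM] := weakly_converges_bounded E hT_ hT w.
have M0 : 0 <= M by rewrite (le_trans _ (hM 0%N))// hs_norm_ge0.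
have hc : (leb2 R d).-integrable Omega (cst ((M * hs_norm S) `^ p)%:E).
  apply/integrableP; split; first exact: measurable_cst.
  rewrite (_ : (fun x => _) = cst ((M * hs_norm S) `^ p)%:E); last first.
    by apply/funext => z /=; rewrite ger0_norm// powR_ge0.
  by rewrite integral_cst//; apply: lte_mul_pinfty; rewrite // lee_fin powR_ge0.
have hdom : {ae leb2 R d, forall z n, Omega z ->
    (`|(Normc.normc (op_conv (T_ n) (op_check S) z) `^ p)%:E| <=
      cst ((M * hs_norm S) `^ p)%:E z)%E}.
  apply: aeW => z n _ /=; rewrite lee_fin ger0_norm ?powR_ge0//.
  apply: ge0_ler_powR; first exact: ltW.
  - by rewrite nnegrE normc_ge0.
  - by rewrite nnegrE mulr_ge0// hs_norm_ge0.
  apply: (le_trans (normc_op_conv E z (hT_ n) hS)).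
  by rewrite ler_wpM2r// hs_norm_ge0.
have hcv : {ae leb2 R d, forall z, Omega z ->
    (fun n => (Normc.normc (op_conv (T_ n) (op_check S) z) `^ p)%:E) @ \oo -->
    (Normc.normc (op_conv T (op_check S) z) `^ p)%:E}.
  apply: aeW => z _; apply: cvg_EFin; first exact: nearW.
  exact: (op_conv_cvg (z := z) hT_ hT hS w).
have [_ _ h] := dominated_convergence mOmega
  (fun n => measurable_conc hS (hT_ n))
  (measurable_conc hS hT) hcv hc hdom.
have fI n := conc_integral_fin hS (hT_ n); have fT := conc_integral_fin hS hT.
have ip0 : 0 < p^-1 by rewrite invr_gt0.
exact: (cvg_poweR ip0 (fun n => conc_integral_ge0 S (T_ n)) fI fT h).
Qed.

Lemma concentration_scale S T (r : R) : 0 <= r ->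
  hilbert_schmidt S -> hilbert_schmidt T ->
  concentration p Omega S (fun u => r%:C *: T u) =
    (r%:E * concentration p Omega S T)%E.
Proof.
move=> r0 hS hT; have hrT := hs_scale oe0 r%:C hT.
have nE z : Normc.normc (op_conv (fun u => r%:C *: T u) (op_check S) z) =
    r * Normc.normc (op_conv T (op_check S) z).
  have hA := hs_adjoint oe0 (hs_alpha E z hS).
  rewrite !(op_convE E _ z hS) (hs_innerE E hrT hA) (hs_innerE E hT hA).
  have lin X : hilbert_schmidt X ->
      hspair e0 (fun u => r%:C *: T u) X = r * hspair e0 T X.
    move=> hX; have := hspair_lin oe0 r hT (hs0 oe0) hX.
    have z0 : hspair e0 (fun=> 0) X = 0.
      have := hspair_lin oe0 (-1) (hs0 oe0) (hs0 oe0) hX.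
      under [X in hspair _ X _]eq_fun do rewrite scaler0 addr0.
      by rewrite mulN1r addNr.
    by rewrite z0 addr0; under [X in hspair _ X _]eq_fun do rewrite addr0.
  rewrite (lin _ hA) (lin _ (hs_scale oe0 'i hA)) /=.
  by rewrite !exprMn -mulrDr sqrtrM ?sqr_ge0// sqrtr_sqr ger0_norm.
have cE : conc_integral S (fun u => r%:C *: T u) = ((r `^ p)%:E * conc_integral S T)%E.
  have g0 z : Omega z -> (0 <= (Normc.normc (op_conv T (op_check S) z) `^ p)%:E)%E.
    by rewrite lee_fin powR_ge0.
  have rp0 : (0 <= (r `^ p)%:E)%E by rewrite lee_fin powR_ge0.
  rewrite /conc_integral -(ge0_integralZl (leb2 R d) mOmega (measurable_conc hS hT) g0 rp0).
  apply: eq_integral => z _; rewrite nE powRM; [|exact: r0|exact: normc_ge0].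
  by rewrite EFinM.
rewrite !concentrationE cE poweRM ?conc_integral_ge0 ?lee_fin ?powR_ge0//.
by rewrite poweR_EFin -powRrM mulfV ?gt_eqF// powRr1.
Qed.

Lemma conc_ratioE S T : hilbert_schmidt S -> hs_nonzero T ->
  conc_ratio p Omega S T = concentration p Omega S (fun u => ((hs_norm T)^-1)%:C *: T u).
Proof.
move=> hS nT; have [hT _] := nT; have n0 := hs_norm_gt0 E nT.
rewrite concentration_scale ?invr_ge0 ?(ltW n0)//.
by rewrite /conc_ratio inver gt_eqF// muleC.
Qed.

Lemma hs_nonzero_ex : exists T, @hs_nonzero R d T.
Proof.
exists (rank1 (e0 0%N) (e0 0%N)); split; first exact: hs_rank1.
move=> /(congr1 (fun F : H -> H => inner (F (e0 0%N)) (e0 0%N))).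
rewrite /rank1 (proj1 oe0) eqxx scale1r (proj1 oe0) eqxx.
have := innerE (0 : H) (e0 0%N); rewrite !rip0l => -> /(congr1 (@complex.Re R)) /=.
by move/eqP; rewrite oner_eq0.
Qed.

Lemma conc_ratio_sup_attained S : hilbert_schmidt S ->
  exists T0, hs_nonzero T0 /\ conc_ratio p Omega S T0
    = ereal_sup [set conc_ratio p Omega S T | T in @hs_nonzero R d].
Proof.
move=> hS; set X := [set _ | _ in _]; set s := ereal_sup X.
have [T1 nT1] := hs_nonzero_ex.
have X0 : X != set0 by apply/set0P; exists (conc_ratio p Omega S T1); exists T1.
have [r rX rs] := ereal_sup_seq X0.
have ex n : exists T, hs_nonzero T /\ conc_ratio p Omega S T = r n.
  by have [T nT <-] := rX n; exists T.
have [T_ hT_] := choice ex.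
pose U n : H -> H := fun u => ((hs_norm (T_ n))^-1)%:C *: T_ n u.
have hsT n : hilbert_schmidt (T_ n) by have [[]] := hT_ n.
have hU n : hilbert_schmidt (U n) by exact: (hs_scale oe0 _ (hsT n)).
have nU n : hs_norm (U n) <= 1.
  have n0 : 0 < hs_norm (T_ n) by apply: (hs_norm_gt0 E); have [] := hT_ n.
  rewrite /U (hs_norm_scale E _ (hsT n)) /= expr0n/= addr0 sqrtr_sqr.
  by rewrite ger0_norm ?invr_ge0 ?(ltW n0)// mulVf// gt_eqF.
have [T [phi [phik hT T1' wT]]] := hs_weak_compactness E hU nU.
have cT := concentration_cvg (fun n => hU (phi n)) hT hS wT.
have cs : concentration p Omega S (U (phi n)) @[n --> \oo] --> s.
  have -> : (fun n => concentration p Omega S (U (phi n))) = r \o phi.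
    apply/funext => n /=; have [nT <-] := hT_ (phi n).
    by rewrite conc_ratioE.
  apply: (cvg_comp _ _ _ rs) => P [N _ NP]; exists N => // n /= Nn.
  by apply: NP; rewrite /= (leq_trans Nn).
have sE : s = concentration p Omega S T.
  by rewrite -(cvg_lim (@ereal_hausdorff R) cs) -(cvg_lim (@ereal_hausdorff R) cT).
have le_s T' : hs_nonzero T' -> (conc_ratio p Omega S T' <= s)%E.
  by move=> nT'; apply: ereal_sup_ubound; exists T'.
(* If the weak limit vanishes, the supremum is $0$ and every nonzero operator attains it. *)
have [T0|T0] := eqVneq (hs_norm T) 0.
  exists T1; split=> //; apply/eqP; rewrite eq_le le_s//= sE.
  apply: (@le_trans _ _ 0%E).
    by apply: (le_trans (concentration_le hS hT)); rewrite T0 mul0r mul0e.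
  by rewrite (conc_ratioE hS nT1) concentrationE poweR_ge0.
have nT : hs_nonzero T.
  by apply: (hs_norm_nonzero E hT); rewrite lt_neqAle hs_norm_ge0 eq_sym T0.
exists T; split=> //; apply/eqP; rewrite eq_le le_s//= sE.
have n0 := hs_norm_gt0 E nT.
(* The limit has norm at most one, so dividing by its norm does not decrease the value. *)
rewrite /conc_ratio inver gt_eqF//= lee_pemulr ?poweR_ge0//.
by rewrite lee_fin invf_ge1.
Qed.

End Concentration.

(** * Almost invariant operators *)

Section KernelOperators.
Variables (R : realType) (d : nat).
Local Notation C := R[i].
Local Notation H := (L2 R d).
Local Notation B := (reip R d).
Local Notation mu := (leb R d).
Implicit Types (u v : H) (A T : H -> H) (z : phase R d).
Implicit Types (kappa : euclid R d -> H).

(** For an integral kernel $k$, the vector [kappa s] is the conjugate of the row $k(s,\cdot)$.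
    Treating rows as vectors of $L^2$ turns kernel estimates into inner product computations. *)
Definition has_kernel A kappa := forall u,
  {ae mu, forall s, l2rep (A u) s = inner u (kappa s)}.

Lemma innerBr u v w : inner u (v - w) = inner u v - inner u w.
Proof.
by rewrite -scaleN1r addrC inner_linr addrC rmorphN rmorph1 mulN1r.
Qed.

Lemma has_kernel_sub A T kappa lambda : has_kernel A kappa -> has_kernel T lambda ->
  has_kernel (fun u => A u - T u) (fun s => kappa s - lambda s).
Proof.
move=> kA kT u; apply: filterS3 (kA u) (kT u) (l2repB (A u) (T u)) => s h1 h2 ->.
by rewrite innerBr h1 h2.
Qed.

Lemma normc_inner_sqr u v :
  Normc.normc (inner u v) ^+ 2 = B v u ^+ 2 + B v ('i *: u) ^+ 2.
Proof.
by rewrite sqr_normc_parts innerE /= reip_iC sqrrN (ripC B v u) (ripC B v).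
Qed.

(** The row is evaluated at the translated point, and $\pi(z)$ crosses the inner product from the
    adjoint; the character is conjugated on entering the second argument. *)
Lemma has_kernel_alpha (e0 : nat -> H) z T kappa : orthonormal_basis e0 ->
  has_kernel T kappa ->
  has_kernel (alpha z T) (fun s => (character z.2 s)^* *:
    time_freq_shift z (kappa (tsub s z.1))).
Proof.
move=> oe0 kT u; have hU := unitary_shift z; have bU := unitary_bounded hU.
have h := ae_tmap (fun i => preserves_translation (tnth z.1 i))
  (kT (adjoint (time_freq_shift z) u)).
apply: filterS2 h (l2rep_shift z (T (adjoint (time_freq_shift z) u))) => s hs ->.
rewrite hs innerZr conjCK; congr (_ * _).
by rewrite inner_conj -(adjointP oe0 bU) -inner_conj.
Qed.

Variable E : onb R d.
Let e0 : nat -> H := proj1_sig E.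
Let oe0 : orthonormal_basis e0 := proj2_sig E.

(** The squared Hilbert--Schmidt norm is the integral of the squared norms of the rows. The function
    [F] is a version of these that is measurable by construction, since [kappa] is an arbitrary
    map. *)
Lemma hsq_kernel A kappa : has_kernel A kappa -> exists F : euclid R d -> \bar R,
  [/\ measurable_fun setT F, forall s, (0 <= F s)%E,
      {ae mu, forall s, F s = (B (kappa s) (kappa s))%:E} &
      hsq e0 A = (\int[mu]_s F s)%E].
Proof.
move=> kA; pose f n s := (Normc.normc (l2rep (A (e0 n)) s) ^+ 2)%:E.
have f0 n s : (0 <= f n s)%E by rewrite lee_fin sqr_ge0.
have mf n : measurable_fun setT (f n).
  by have [m1 m2 _] := l2rep_sqint (A (e0 n)); exact: (measurable_sqr_normc m1 m2).
exists (fun s => \sum_(0 <= n <oo) f n s)%E; split.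
- by apply: (@ge0_emeasurable_sum _ _ _ _ f xpredT).
- by move=> s; apply: nneseries_ge0 => n _ _; exact: f0.
- apply: filterS (ae_foralln (fun n => kA (e0 n))) => s hs.
  rewrite (parsevalE oe0); apply: eq_eseriesr => n _.
  by rewrite /f hs normc_inner_sqr.
rewrite integral_nneseries//; apply: eq_eseriesr => n _.
by rewrite reipE sqr_l2norm.
Qed.

Lemma has_kernel_linear A kappa : has_kernel A kappa -> linear A.
Proof.
move=> kA a u v; apply: l2_ext.
have h : {ae mu, forall s,
    a * l2rep (A u) s + l2rep (A v) s = inner (a *: u + v) (kappa s)}.
  by apply: filterS2 (kA u) (kA v) => s -> ->; rewrite inner_lin.
by apply: filterS3 (kA (a *: u + v)) (l2rep_lin a (A u) (A v)) h => s -> -> ->.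
Qed.

Lemma sqr_normc_inner_le u v : Normc.normc (inner u v) ^+ 2 <= B u u * B v v.
Proof.
rewrite -(sqr_nrm B u) -(sqr_nrm B v) -exprMn.
by rewrite ler_sqr ?nnegrE ?mulr_ge0 ?nrm_ge0 ?normc_inner ?normc_ge0.
Qed.

Variable G : euclid R d -> R.
Hypothesis mG : measurable_fun setT (fun s => (G s)%:E : \bar R).
Hypothesis iG : (\int[mu]_s (G s)%:E < +oo)%E.

Lemma has_kernel_hs A kappa : has_kernel A kappa ->
  (forall s, B (kappa s) (kappa s) <= G s) -> hilbert_schmidt A.
Proof.
move=> kA kG.
have G0 s : (0 <= (G s)%:E)%E by rewrite lee_fin (le_trans (rip_ge0 B _) (kG s)).
have iG0 : (0 <= \int[mu]_s (G s)%:E)%E by apply: integral_ge0 => s _; exact: G0.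
have fG : (\int[mu]_s (G s)%:E)%E \is a fin_num by rewrite ge0_fin_numE.
have bdA u : ((B (A u) (A u))%:E <= (B u u)%:E * \int[mu]_s (G s)%:E)%E.
  have u0 : (0 <= (B u u)%:E)%E by rewrite lee_fin rip_ge0.
  rewrite reipE sqr_l2norm -(ge0_integralZl mu measurableT mG (fun s _ => G0 s) u0).
  have [m1 m2 _] := l2rep_sqint (A u).
  apply: ae_ge0_le_integral => //.
  - by move=> s _; rewrite lee_fin sqr_ge0.
  - exact: (measurable_sqr_normc m1 m2).
  - by move=> s _; rewrite mule_ge0.
  - exact: measurable_funeM.
  apply: filterS (kA u) => s -> _; rewrite -EFinM lee_fin.
  by rewrite (le_trans (sqr_normc_inner_le _ _))// ler_wpM2l ?rip_ge0.
have bA : bounded_operator A.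
  split; first exact: (has_kernel_linear kA).
  exists (Num.sqrt (fine (\int[mu]_s (G s)%:E)%E)) => u.
  rewrite !L2norm_nrm /nrm -sqrtrM ?fine_ge0//.
  by rewrite ler_wsqrtr// -lee_fin EFinM fineK// muleC.
apply/(hsP oe0); split; first exact: bA.
have [F [mF F0 FE ->]] := hsq_kernel kA.
apply: (le_lt_trans _ iG); apply: ae_ge0_le_integral => //.
by apply: filterS FE => s -> _; rewrite lee_fin.
Qed.

Lemma has_kernel_ex kappa :
  (forall u, mfunc (fun s => inner u (kappa s))) ->
  (forall s, B (kappa s) (kappa s) <= G s) ->
  exists A, hilbert_schmidt A /\ has_kernel A kappa.
Proof.
move=> mk kG; exists (fun u => toL2 (fun s => inner u (kappa s))).
suff kA : has_kernel (fun u => toL2 (fun s => inner u (kappa s))) kappa.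
  by split=> //; exact: has_kernel_hs kG.
have G0 s : (0 <= (G s)%:E)%E by rewrite lee_fin (le_trans (rip_ge0 B _) (kG s)).
move=> u; apply: toL2E; have [m1 m2] := mk u; split => //.
have u0 : (0 <= (B u u)%:E)%E by rewrite lee_fin rip_ge0.
apply: (@le_lt_trans _ _ ((B u u)%:E * \int[mu]_s (G s)%:E)%E); last first.
  by rewrite lte_mul_pinfty.
rewrite -(ge0_integralZl mu measurableT mG (fun s _ => G0 s) u0).
apply: ge0_le_integral => //.
- by move=> s _; rewrite lee_fin sqr_ge0.
- exact: (measurable_sqr_normc m1 m2).
- exact: measurable_funeM.
move=> s _; rewrite -EFinM lee_fin.
by rewrite (le_trans (sqr_normc_inner_le _ _))// ler_wpM2l ?rip_ge0.
Qed.

End KernelOperators.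

(** * Symmetry of the bilinear form with an indicator kernel *)

Section IndicatorForm.
Context (R : realType) (d1 : measure_display) (T : measurableType d1).
Variable m : {sigma_finite_measure set T -> \bar R}.

Lemma integrable_mul (a b : T -> R) : measurable_fun setT a ->
  measurable_fun setT b -> (\int[m]_t (a t ^+ 2)%:E < +oo)%E ->
  (\int[m]_t (b t ^+ 2)%:E < +oo)%E -> m.-integrable setT (fun t => (a t * b t)%:E).
Proof.
move=> ma mb fa fb.
have sq (c : T -> R) : measurable_fun setT c -> (\int[m]_t (c t ^+ 2)%:E < +oo)%E ->
    m.-integrable setT (fun t => (c t ^+ 2)%:E).
  move=> mc fc; apply/integrableP; split.
    by apply/measurable_EFinP; exact: measurable_funX.
  by under eq_integral do rewrite gee0_abs ?lee_fin ?sqr_ge0//.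
apply: le_integrable (integrableD measurableT (sq a ma fa) (sq b mb fb)) => //.
  by apply/measurable_EFinP; exact: measurable_funM.
move=> t _ /=; rewrite lee_fin normrM [leRHS]ger0_norm ?addr_ge0 ?sqr_ge0//.
rewrite -(real_normK (num_real (a t))) -(real_normK (num_real (b t))).
by have := sqr_ge0 (`|a t| - `|b t|); have := mulr_ge0 (normr_ge0 (a t)) (normr_ge0 (b t)); nra.
Qed.

Variables (K : set (T * T)) (X : set T).
Hypotheses (mK : measurable K) (mX : measurable X) (fX : (m X < +oo)%E).
Hypothesis KX : K `<=` X `*` X.
Hypothesis symK : forall s t, K (s, t) -> K (t, s).

Lemma indicator_form_sym (a b : T -> R) : measurable_fun setT a ->
  measurable_fun setT b -> (\int[m]_t (a t ^+ 2)%:E < +oo)%E ->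
  (\int[m]_t (b t ^+ 2)%:E < +oo)%E ->
  \int[m]_s ((\int[m]_t (a t * \1_K (s, t))) * b s) =
  \int[m]_s ((\int[m]_t (b t * \1_K (s, t))) * a s).
Proof.
move=> ma mb fa fb.
have mX_ (s : T) : measurable (xsection K s) by exact: measurable_xsection.
have fX_ (s : T) : (m (xsection K s) < +oo)%E.
  apply: le_lt_trans fX; apply: le_measure; rewrite ?inE//.
  by move=> t; rewrite /xsection /= inE => /KX[].
have secE s t : \1_K (s, t) = \1_(xsection K s) t :> R.
  by rewrite !indicE mem_xsection.
have symE s t : \1_K (s, t) = \1_K (t, s) :> R.
  rewrite !indicE; suff -> : ((s, t) \in K) = ((t, s) \in K) by [].
  by apply/idP/idP; rewrite !inE; exact: symK.
have i1 (c : T -> R) s : measurable_fun setT c -> (\int[m]_t (c t ^+ 2)%:E < +oo)%E ->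
    m.-integrable setT (fun t => (c t * \1_K (s, t))%:E).
  move=> mc fc; under eq_fun do rewrite secE.
  apply: integrable_mul => //.
  have idx t : (\1_(xsection K s) t : R) ^+ 2 = \1_(xsection K s) t.
    by rewrite indicE; case: (_ \in _); rewrite ?expr1n ?expr0n.
  under eq_integral do rewrite idx.
  rewrite (integral_indic m measurableT (mX_ s)) setIT; exact: fX_.
have inE' (c : T -> R) r s : measurable_fun setT c -> (\int[m]_t (c t ^+ 2)%:E < +oo)%E ->
    (\int[m]_t (c t * \1_K (s, t) * r)%:E)%E =
      ((\int[m]_t (c t * \1_K (s, t))) * r)%:E.
  move=> mc fc; have ic := i1 c s mc fc.
  rewrite -(RintegralZr r measurableT ic) /Rintegral fineK//.
  apply: integrable_fin_num => //.
  under eq_fun do rewrite mulrC EFinM; exact: integrableZl.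
pose f (q : T * T) := (a q.2 * \1_K q * b q.1)%:E.
suff If : (m \x m)%E.-integrable setT f.
  have := Fubini If.
  rewrite /f /= => h.
  have h1 : (\int[m]_s ((\int[m]_t (a t * \1_K (s, t))) * b s)%:E =
      \int[m]_s ((\int[m]_t (b t * \1_K (s, t))) * a s)%:E)%E.
    under eq_integral => s _ do rewrite -(inE' a (b s) s ma fa).
    rewrite h; apply: eq_integral => s _; rewrite -(inE' b (a s) s mb fb).
    by apply: eq_integral => t _; rewrite (symE t s); congr (_%:E); ring.
  by rewrite /Rintegral h1.
have ma2 : measurable_fun setT (fun q : T * T => a q.2).
  exact: (measurableT_comp ma measurable_snd).
have mb1 : measurable_fun setT (fun q : T * T => b q.1).
  exact: (measurableT_comp mb measurable_fst).
(* An integrable majorant for Fubini: since [K] lies in [X] times [X], the product of [a] and [b] on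
   [K] is bounded by the squares, each multiplied by the indicator of [X] in the other variable. *)
pose g (q : T * T) := (a q.2 ^+ 2 * \1_X q.1 + b q.1 ^+ 2 * \1_X q.2)%:E.
have g0 q : (0 <= g q)%E by rewrite lee_fin addr_ge0// mulr_ge0// sqr_ge0.
have mXT : measurable_fun setT (\1_X : T -> R) by exact: measurable_indic.
have mX1 : measurable_fun setT (fun q : T * T => \1_X q.1 : R).
  exact: (measurableT_comp mXT measurable_fst).
have mX2 : measurable_fun setT (fun q : T * T => \1_X q.2 : R).
  exact: (measurableT_comp mXT measurable_snd).
have mg : measurable_fun setT g.
  by apply/measurable_EFinP; apply: measurable_funD; apply: measurable_funM => //;
    apply: measurable_funX.
have mf : measurable_fun setT f.
  apply/measurable_EFinP; apply: measurable_funM => //; apply: measurable_funM => //.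
have Ig : (m \x m)%E.-integrable setT g.
  apply/integrableP; split => //.
  under eq_integral do rewrite gee0_abs//.
  rewrite fubini_tonelli1// /fubini_F.
  have mX' : measurable_fun setT (fun t => (\1_X t)%:E : \bar R).
    exact/measurable_EFinP/measurable_indic.
  have sq (c : T -> R) : measurable_fun setT c ->
      measurable_fun setT (fun t => (c t ^+ 2)%:E : \bar R).
    by move=> mc; apply/measurable_EFinP; exact: measurable_funX.
  have sq0 (c : T -> R) (t : T) : setT t -> (0 <= (c t ^+ 2)%:E)%E.
    by rewrite lee_fin sqr_ge0.
  have X0 (t : T) : setT t -> (0 <= (\1_X t)%:E :> \bar R)%E by rewrite lee_fin.
  have iX : (\int[m]_t (\1_X t)%:E = m X)%E by rewrite integral_indic// setIT.
  have int0 (c : T -> R) : (0 <= \int[m]_t (c t ^+ 2)%:E)%E.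
    by apply: integral_ge0 => t; exact: sq0.
  have inner1 s : (\int[m]_t g (s, t) = (\1_X s)%:E * \int[m]_t (a t ^+ 2)%:E
      + (b s ^+ 2)%:E * m X)%E.
    rewrite -iX -(ge0_integralZl m measurableT (sq _ ma) (sq0 a) (X0 s I)).
    rewrite -(ge0_integralZl m measurableT mX' X0 (sq0 b s I)).
    rewrite -ge0_integralD//.
    - by apply: eq_integral => t _; rewrite /g EFinD !EFinM (muleC (_ ^+ 2)%:E).
    - by move=> t _; rewrite mule_ge0// lee_fin sqr_ge0.
    - exact: measurable_funeM (sq _ ma).
    - by move=> t _; rewrite mule_ge0// lee_fin sqr_ge0.
    - exact: measurable_funeM.
  under eq_integral do rewrite inner1.
  rewrite ge0_integralD//.
  - have mX0 : (0 <= m X)%E by exact: measure_ge0.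
    rewrite (ge0_integralZr m measurableT mX' X0 (int0 a)).
    rewrite (ge0_integralZr m measurableT (sq _ mb) (sq0 b) mX0).
    by rewrite iX lte_add_pinfty// lte_mul_pinfty// ge0_fin_numE.
  - by move=> t _; rewrite mule_ge0.
  - exact: emeasurable_funM.
  - by move=> t _; rewrite mule_ge0// lee_fin sqr_ge0.
  - by apply: emeasurable_funM => //; exact: sq.
apply: le_integrable Ig => // q _; rewrite (gee0_abs (g0 q)) /f /g/= lee_fin.
rewrite [X in X <= _]normrM normrM indicE; have [|nK] := boolP (q \in K); last first.
  by rewrite /= normr0 mulr0 mul0r addr_ge0// mulr_ge0// sqr_ge0.
rewrite inE => /KX[X1 X2]; rewrite !indicE !mem_set// normr1 !mulr1.
rewrite -(real_normK (num_real (a q.2))) -(real_normK (num_real (b q.1))).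
by have := sqr_ge0 (`|a q.2| - `|b q.1|); have := normr_ge0 (a q.2); have := normr_ge0 (b q.1); nra.
Qed.

End IndicatorForm.

(** * Integral operators with indicator kernels *)

Section IndicatorKernel.
Variables (R : realType) (d : nat).
Local Notation C := R[i].
Local Notation H := (L2 R d).
Local Notation B := (reip R d).
Local Notation mu := (leb R d).
Implicit Types (u v : H) (A : set (euclid R d)).

Definition indc A (t : euclid R d) : C := (\1_A t)%:C.

Lemma normc_indc A t : Normc.normc (indc A t) ^+ 2 = \1_A t.
Proof.
rewrite sqr_normc_parts /= indicE; case: (t \in A); rewrite /= ?expr1n expr0n/=.
  by rewrite addr0.
by rewrite addr0.
Qed.

Lemma mfunc_indc A : measurable A -> mfunc (indc A).
Proof.
move=> mA; split; last exact: measurable_cst.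
by apply: measurable_indic.
Qed.

Lemma sqint_indc A : measurable A -> (mu A < +oo)%E -> square_integrable (indc A).
Proof.
move=> mA fA; have [m1 m2] := mfunc_indc mA; split => //.
under eq_integral do rewrite normc_indc.
by rewrite integral_indic// setIT.
Qed.

Definition L2ind A : H := toL2 (indc A).

Lemma sqr_L2ind A : measurable A -> (mu A < +oo)%E ->
  B (L2ind A) (L2ind A) = fine (mu A).
Proof.
move=> mA fA; have sA := sqint_indc mA fA.
apply: EFin_inj; rewrite reipE (sqr_l2normE sA (toL2E sA)).
under eq_integral do rewrite normc_indc.
by rewrite integral_indic// setIT fineK// ge0_fin_numE.
Qed.

Lemma inner_L2ind u A : measurable A -> (mu A < +oo)%E ->
  inner u (L2ind A) = Complex (\int[mu]_t (complex.Re (l2rep u t) * \1_A t))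
                              (\int[mu]_t (complex.Im (l2rep u t) * \1_A t)).
Proof.
move=> mA fA; have sA := sqint_indc mA fA.
rewrite (inner_ae (l2rep_sqint u) sA _ (toL2E sA)); last exact: aeW.
congr Complex; apply: eq_Rintegral => t _; rewrite /indc; case: (l2rep u t) => a b /=; ring.
Qed.

Variable E : onb R d.
Let e0 : nat -> H := proj1_sig E.
Let oe0 : orthonormal_basis e0 := proj2_sig E.
Variables (K : set (euclid R d * euclid R d)%type) (X : set (euclid R d)).
Hypotheses (mK : measurable K) (mX : measurable X) (fX : (mu X < +oo)%E).
Hypothesis KX : K `<=` X `*` X.
Hypothesis symK : forall s t, K (s, t) -> K (t, s).

Let mKs s : measurable (xsection K s). Proof. exact: measurable_xsection. Qed.

Let KsX s : xsection K s `<=` X.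
Proof. by move=> t; rewrite /xsection /= inE => /KX[]. Qed.

Let fKs s : (mu (xsection K s) < +oo)%E.
Proof. by apply: le_lt_trans fX; apply: le_measure; rewrite ?inE//; exact: KsX. Qed.

Definition secL2 s : H := L2ind (xsection K s).

Lemma sqr_secL2 s : B (secL2 s) (secL2 s) = fine (mu (xsection K s)).
Proof. exact: sqr_L2ind. Qed.

Lemma inner_secL2 u s :
  inner u (secL2 s) = Complex (\int[mu]_t (complex.Re (l2rep u t) * \1_K (s, t)))
                              (\int[mu]_t (complex.Im (l2rep u t) * \1_K (s, t))).
Proof.
rewrite inner_L2ind//; congr Complex; apply: eq_Rintegral => t _;
by rewrite !indicE mem_xsection.
Qed.

Lemma mfunc_inner_secL2 u : mfunc (fun s => inner u (secL2 s)).
Proof.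
have [m1 m2 _] := l2rep_sqint u.
have mK1 : measurable_fun setT (\1_K : euclid R d * euclid R d -> R).
  by apply: measurable_indic.
split; under eq_fun do rewrite inner_secL2.
  apply: (@measurable_Rintegral_param _ _ _ _ _ mu
    (fun q => complex.Re (l2rep u q.2) * \1_K q)).
  by apply: measurable_funM => //; exact: (measurableT_comp m1 measurable_snd).
apply: (@measurable_Rintegral_param _ _ _ _ _ mu
  (fun q => complex.Im (l2rep u q.2) * \1_K q)).
by apply: measurable_funM => //; exact: (measurableT_comp m2 measurable_snd).
Qed.

Lemma sqr_secL2_le s : B (secL2 s) (secL2 s) <= fine (mu X) * \1_X s.
Proof.
rewrite sqr_secL2 indicE; have [sX|sX] := boolP (s \in X).
  rewrite mulr1 fine_le ?ge0_fin_numE//.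
  by apply: le_measure; rewrite ?inE//; exact: KsX.
rewrite mulr0 (_ : xsection K s = set0) ?measure0//.
apply/seteqP; split => // t; rewrite /xsection /= inE => /KX[] /= + _.
by move: sX; rewrite notin_setE.
Qed.

Lemma secL2_kernel_ex : exists T, hilbert_schmidt T /\ has_kernel T secL2.
Proof.
apply: (has_kernel_ex E (G := fun s => fine (mu X) * \1_X s)).
- apply/measurable_EFinP; apply: measurable_funM; first exact: measurable_cst.
  by apply: measurable_indic.
- under eq_integral do rewrite EFinM.
  rewrite ge0_integralZl//.
  + rewrite integral_indic// setIT lte_mul_pinfty ?lee_fin ?fine_ge0//.
  + by apply/measurable_EFinP; apply: measurable_indic.
  + by rewrite lee_fin fine_ge0// measure_ge0.
- exact: mfunc_inner_secL2.
- exact: sqr_secL2_le.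
Qed.

(** The kernel is real, so real and imaginary parts decouple and each contributes a form covered by
    [indicator_form_sym]. *)
Lemma secL2_reip_sym T u v : has_kernel T secL2 -> B (T u) v = B u (T v).
Proof.
move=> kT.
have sq u' : [/\ measurable_fun setT (fun t => complex.Re (l2rep u' t)),
    measurable_fun setT (fun t => complex.Im (l2rep u' t)),
    (\int[mu]_t (complex.Re (l2rep u' t) ^+ 2)%:E < +oo)%E &
    (\int[mu]_t (complex.Im (l2rep u' t) ^+ 2)%:E < +oo)%E].
  have [m1 m2 fi] := l2rep_sqint u'; split => //.
    apply: le_lt_trans fi; apply: ge0_le_integral => //.
    - by move=> t _; rewrite lee_fin sqr_ge0.
    - by apply/measurable_EFinP; exact: measurable_funX.
    - exact: (measurable_sqr_normc m1 m2).
    - by move=> t _; rewrite lee_fin sqr_normc_parts lerDl sqr_ge0.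
  apply: le_lt_trans fi; apply: ge0_le_integral => //.
  - by move=> t _; rewrite lee_fin sqr_ge0.
  - by apply/measurable_EFinP; exact: measurable_funX.
  - exact: (measurable_sqr_normc m1 m2).
  - by move=> t _; rewrite lee_fin sqr_normc_parts lerDr sqr_ge0.
have ir u' v' : mu.-integrable setT
    (fun s => (complex.Re (l2rep u' s) * complex.Re (l2rep v' s))%:E) /\
    mu.-integrable setT
    (fun s => (complex.Im (l2rep u' s) * complex.Im (l2rep v' s))%:E).
  have [m1 m2 f1 f2] := sq u'; have [n1 n2 g1 g2] := sq v'.
  by split; exact: integrable_mul.
have TE u' v' : B (T u') v' =
    \int[mu]_s ((\int[mu]_t (complex.Re (l2rep u' t) * \1_K (s, t))) *
      complex.Re (l2rep v' s)) +
    \int[mu]_s ((\int[mu]_t (complex.Im (l2rep u' t) * \1_K (s, t))) *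
      complex.Im (l2rep v' s)).
  have [i1 i2] := ir (T u') v'.
  have [m1 m2 _ _] := sq (T u'); have [n1 n2 _ _] := sq v'.
  have [k1 k2] := mfunc_inner_secL2 u'.
  rewrite reipE /inner /=.
  under eq_Rintegral => s _.
    rewrite (_ : complex.Re _ = complex.Re (l2rep (T u') s) * complex.Re (l2rep v' s) +
      complex.Im (l2rep (T u') s) * complex.Im (l2rep v' s)); last first.
      by case: (l2rep (T u') s) (l2rep v' s) => [? ?] [? ?] /=; ring.
  over.
  rewrite RintegralD//; congr (_ + _); congr fine; apply: ae_eq_integral => //.
  - by apply/measurable_EFinP; exact: measurable_funM.
  - apply/measurable_EFinP; apply: measurable_funM => //.
    by move: k1; under eq_fun do rewrite inner_secL2.
  - by apply: filterS (kT u') => s -> _; rewrite inner_secL2.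
  - by apply/measurable_EFinP; exact: measurable_funM.
  - apply/measurable_EFinP; apply: measurable_funM => //.
    by move: k2; under eq_fun do rewrite inner_secL2.
  - by apply: filterS (kT u') => s -> _; rewrite inner_secL2.
have [m1 m2 f1 f2] := sq u; have [n1 n2 g1 g2] := sq v.
rewrite (ripC B u) !TE.
by congr (_ + _); exact: indicator_form_sym mK mX fX KX symK _ _ _ _ _ _.
Qed.

Lemma secL2_adjoint T : has_kernel T secL2 -> hilbert_schmidt T -> adjoint T = T.
Proof.
move=> kT hT; have [bT _] := (hsP oe0 T).1 hT.
apply: adjoint_unique => u v; rewrite !innerE (secL2_reip_sym _ _ kT).
by rewrite (secL2_reip_sym _ _ kT) (bounded_linZ _ _ bT).
Qed.

End IndicatorKernel.

(** * Correlation of a row with a shifted row *)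

Section BandOperator.
Variables (R : realType) (d : nat).
Local Notation C := R[i].
Local Notation H := (L2 R d).
Local Notation B := (reip R d).
Local Notation mu := (leb R d).
Implicit Types (u v : H) (A : set (euclid R d)) (z : phase R d).

Lemma l2repZ (a : C) u : {ae mu, forall x, l2rep (a *: u) x = a * l2rep u x}.
Proof.
have h := l2repB (a *: u) (a *: u); rewrite subrr in h.
have := l2rep_lin a u 0; rewrite addr0.
by apply: filterS2 h => x -> ->; rewrite subrr addr0.
Qed.

Lemma conj_cis (t : R) : (cis t)^* = cis (- t).
Proof. by rewrite /cis cosN sinN. Qed.

(** The integrand is a cosine times two indicators. The cosine is at least $1-\eta\ge 0$ on [A'],
    and both indicators equal one on [A'']. In the application [A] and [A'] are rows of the band and
    [A''] a set where both are full. *)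
Lemma reip_shift_L2ind z s A A' A'' (eta : R) : eta <= 1 ->
  measurable A -> (mu A < +oo)%E -> measurable A' -> (mu A' < +oo)%E ->
  measurable A'' -> (mu A'' < +oo)%E ->
  A'' `<=` A' -> (forall t, A'' t -> A (tsub t z.1)) ->
  (forall t, A' t -> 1 - eta <= cos (2 * pi * dot z.2 t - 2 * pi * dot z.2 s)) ->
  (1 - eta) * fine (mu A'') <=
    B ((character z.2 s)^* *: time_freq_shift z (L2ind A)) (L2ind A').
Proof.
move=> eta1 mA fA mA' fA' mA'' fA'' A''A' A''A hcos.
pose c := (character z.2 s)^*.
pose f (t : euclid R d) : C := c * (character z.2 t * indc A (tsub t z.1)).
have m2 : measurable_fun setT (fun t : euclid R d => tsub t z.1).
  by apply: measurable_tmap => i; have [] := preserves_translation (tnth z.1 i).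
have [a1 a2] := mfunc_indc mA.
have mf : mfunc f.
  apply: mfuncM; first by split; exact: measurable_cst.
  apply: mfuncM; first exact: mfunc_character.
  by split; [exact: (measurableT_comp a1 m2)|exact: (measurableT_comp a2 m2)].
have fE : {ae mu, forall t, l2rep (c *: time_freq_shift z (L2ind A)) t = f t}.
  have h := ae_tmap (fun i => preserves_translation (tnth z.1 i)) (toL2E (sqint_indc mA fA)).
  by apply: filterS3 (l2repZ c (time_freq_shift z (L2ind A))) (l2rep_shift z (L2ind A)) h
    => t -> -> ->.
have sf : square_integrable f.
  have [n1 n2 n3] := l2rep_sqint (c *: time_freq_shift z (L2ind A)).
  have [f1 f2] := mf; split => //; rewrite (_ : (\int[mu]_x _)%E = 
    (\int[mu]_x (Normc.normc (l2rep (c *: time_freq_shift z (L2ind A)) x) ^+ 2)%:E)%E)//.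
  apply: ae_eq_integral => //; [exact: (measurable_sqr_normc f1 f2)
    |exact: (measurable_sqr_normc n1 n2)|].
  by apply: filterS fE => t ->.
have sA' := sqint_indc mA' fA'.
have [ifg _] := integrable_prod sf sA'.
rewrite reipE (inner_ae sf sA' fE (toL2E sA')).
rewrite -[leRHS]/(\int[mu]_t complex.Re (f t * (indc A' t)^*)).
have i'' : mu.-integrable setT (fun t => (\1_A'' t)%:E).
  apply/integrableP; split; first exact/measurable_EFinP/measurable_indic.
  under eq_integral do rewrite gee0_abs ?lee_fin//.
  by rewrite integral_indic// setIT.
have -> : fine (mu A'') = \int[mu]_t \1_A'' t.
  by rewrite /Rintegral integral_indic// setIT.
rewrite -RintegralZl//; apply: le_Rintegral => //.
  exact: (integrableZl measurableT (1 - eta) i'').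
move=> t _.
have -> : complex.Re (f t * (indc A' t)^*) =
    cos (2 * pi * dot z.2 t - 2 * pi * dot z.2 s) * \1_A (tsub t z.1) * \1_A' t.
  rewrite /f mulrA /c /character conj_cis -cisD (addrC (- _)) /indc /cis /=; ring.
rewrite !indicE; have [|nA'] := boolP (t \in A'); last first.
  have -> : (t \in A'') = false.
    by apply/negbTE; move: nA'; rewrite !notin_setE => h /A''A'.
  by rewrite !mulr0.
rewrite inE => /hcos hc; rewrite mulr1.
have [|nA''] := boolP (t \in A'').
  by rewrite inE => /A''A hA; rewrite mem_set// !mulr1.
by rewrite mulr0 mulr_ge0//; lra.
Qed.

End BandOperator.

(** * The band operator hardly moves under $\alpha_z$ *)

Section BandEstimate.
Variables (R : realType) (d : nat).
Local Notation C := R[i].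
Local Notation H := (L2 R d).
Local Notation B := (reip R d).
Local Notation mu := (leb R d).
Implicit Types (u v : H) (A : set (euclid R d)) (z : phase R d).

Definition cube (r : R) : set (euclid R d) := [set t | forall i, `|tnth t i| <= r].

Lemma cube_box r : cube r = [set t | forall i, `[- r, r]%classic (tnth t i)].
Proof.
by apply/seteqP; split => t h i; have := h i; rewrite /= in_itv/= ler_norml.
Qed.

Lemma measurable_cube r : measurable (cube r).
Proof. by rewrite cube_box; exact: measurable_box. Qed.

Lemma leb_cube r : 0 <= r -> mu (cube r) = ((2 * r) ^+ d)%:E.
Proof.
move=> r0; rewrite cube_box; apply: leb_box => //.
rewrite lebesgue_measure_itv/= lte_fin; case: ltP => [_|h].
  by rewrite -EFinD; congr (_%:E); ring.
by congr (_%:E); lra.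
Qed.

Definition ball_at (r : R) (s : euclid R d) : set (euclid R d) :=
  [set t | cube r (tsub t s)].

Lemma measurable_ball_at r s : measurable (ball_at r s).
Proof.
rewrite -[X in measurable X]setTI; apply: measurable_tmap => //.
  by move=> i; have [] := preserves_translation (tnth s i).
exact: measurable_cube.
Qed.

Lemma leb_ball_at r s : 0 <= r -> mu (ball_at r s) = ((2 * r) ^+ d)%:E.
Proof.
move=> r0; rewrite -(leb_cube r0).
exact: (leb_tmap (fun i => preserves_translation (tnth s i)) (measurable_cube r)).
Qed.

Definition band (L delta : R) : set (euclid R d * euclid R d)%type :=
  [set q | [/\ cube L q.1, cube L q.2 & cube delta (tsub q.2 q.1)]].

Lemma measurable_band L delta : measurable (band L delta).
Proof.
have mc r (f : (euclid R d * euclid R d)%type -> euclid R d) :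
    measurable_fun setT f -> measurable (f @^-1` cube r).
  by move=> mf; rewrite -[X in measurable X]setTI; apply: mf => //; exact: measurable_cube.
have m1 := mc L fst measurable_fst; have m2 := mc L snd measurable_snd.
have m3 := mc delta _ (measurable_tsub measurable_snd measurable_fst).
rewrite (_ : band L delta = (fst @^-1` cube L) `&` (snd @^-1` cube L) `&`
    ((fun q => tsub q.2 q.1) @^-1` cube delta)).
  by apply: measurableI => //; exact: measurableI.
by apply/seteqP; split => q [] => [h1 h2 h3|[h1 h2] h3]; split => //; split.
Qed.

Lemma band_sub L delta : band L delta `<=` cube L `*` cube L.
Proof. by move=> q []. Qed.

Lemma band_sym L delta s t : band L delta (s, t) -> band L delta (t, s).
Proof.
move=> [h1 h2 h3]; split => //= i; have := h3 i.
by rewrite !tnth_mktuple distrC.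
Qed.

Lemma xsection_bandE L delta s t :
  xsection (band L delta) s t <-> [/\ cube L s, cube L t & cube delta (tsub t s)].
Proof. by rewrite /xsection /= inE. Qed.

Variables (L delta c : R).
Hypotheses (delta_gt0 : 0 < delta) (c_ge0 : 0 <= c) (L_gt : c + delta < L).

(** [V] is the volume of a full row. For centres in the cube of radius [M] the row is full, and
    remains so after translation by a vector of the cube of radius [c]. *)
Let V : R := (2 * delta) ^+ d.
Let M : R := L - c - delta.
Let V0 : 0 <= V. Proof. by rewrite exprn_ge0// mulr_ge0// ltW. Qed.
Let M0 : 0 <= M. Proof. by rewrite /M; move: L_gt; lra. Qed.
Let L0 : 0 <= L. Proof. by move: c_ge0 delta_gt0 L_gt; lra. Qed.
Let K := band L delta.
Let mK : measurable K. Proof. exact: measurable_band. Qed.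
Let fL : (mu (cube L) < +oo)%E. Proof. by rewrite leb_cube// ltry. Qed.

Let mKs s : measurable (xsection K s). Proof. exact: measurable_xsection. Qed.

Let fKs s : (mu (xsection K s) < +oo)%E.
Proof.
apply: le_lt_trans fL; apply: le_measure; rewrite ?inE//; first exact: measurable_cube.
by move=> t /xsection_bandE[].
Qed.

Let fball s : (mu (ball_at delta s) < +oo)%E.
Proof. by rewrite leb_ball_at ?ltry ?ltW. Qed.

Lemma leb_xsection_band s : fine (mu (xsection K s)) <= V * \1_(cube L) s.
Proof.
rewrite indicE; have [sX|sX] := boolP (s \in cube L).
  rewrite mulr1 -lee_fin fineK ?ge0_fin_numE// -(leb_ball_at s (ltW delta_gt0)).
  apply: le_measure; rewrite ?inE//; first exact: measurable_ball_at.
  by move=> t /xsection_bandE[].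
rewrite mulr0 (_ : xsection K s = set0) ?measure0//.
apply/seteqP; split => // t /xsection_bandE[h _ _].
by move: sX; rewrite notin_setE.
Qed.

Lemma ball_at_xsection s (x : euclid R d) t : cube c x -> cube M s ->
  ball_at delta s t -> xsection K (tsub s x) (tsub t x).
Proof.
move=> hx hs ht; apply/xsection_bandE; split => i.
- by have := hs i; have := hx i; move: delta_gt0; rewrite /M tnth_mktuple !ler_norml;
    move=> ? /andP[? ?] /andP[? ?]; apply/andP; split; lra.
- have := hs i; have := hx i; have := ht i; rewrite /M !tnth_mktuple !ler_norml.
  by move=> /andP[? ?] /andP[? ?] /andP[? ?]; apply/andP; split; lra.
by have := ht i; rewrite !tnth_mktuple (_ : _ - _ = tnth t i - tnth s i)//; ring.
Qed.

Lemma ball_at_xsection0 s t : cube M s -> ball_at delta s t -> xsection K s t.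
Proof.
have c0 : cube c [tuple 0 | i < d] by move=> i; rewrite tnth_mktuple normr0.
have e (u : euclid R d) : tsub u [tuple (0 : R) | i < d] = u.
  by apply: eq_from_tnth => i; rewrite !tnth_mktuple subr0.
by move=> hs ht; have := ball_at_xsection c0 hs ht; rewrite !e.
Qed.

Variable E : onb R d.
Let e0 : nat -> H := proj1_sig E.
Let oe0 : orthonormal_basis e0 := proj2_sig E.
Variable T : H -> H.
Hypotheses (hT : hilbert_schmidt T) (kT : has_kernel T (secL2 K)).

Let integral_ind (a : R) A : 0 <= a -> measurable A ->
  (\int[mu]_s (a * \1_A s)%:E = a%:E * mu A)%E.
Proof.
move=> a0 mA; under eq_integral do rewrite EFinM.
rewrite ge0_integralZl//; first by rewrite integral_indic// setIT.
by apply/measurable_EFinP; apply: measurable_indic.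
Qed.

Let measurable_ind (a : R) A : measurable A ->
  measurable_fun setT (fun s => (a * \1_A s)%:E : \bar R).
Proof.
move=> mA; apply/measurable_EFinP; apply: measurable_funM; first exact: measurable_cst.
by apply: measurable_indic.
Qed.

Lemma band_norm_ge : V * (2 * M) ^+ d <= hspair e0 T T.
Proof.
have [F [mF F0 FE hF]] := hsq_kernel E kT.
rewrite -lee_fin (hspair_sqr oe0 hT) hF EFinM -(leb_cube M0).
have mM := measurable_cube M.
rewrite -(integral_ind V0 mM); apply: ae_ge0_le_integral => //.
- by move=> s _; rewrite lee_fin mulr_ge0.
- exact: measurable_ind.
apply: filterS FE => s -> _; rewrite lee_fin (sqr_secL2 mK (measurable_cube L) fL (@band_sub L delta)).
rewrite indicE; have [|_] := boolP (s \in cube M); last by rewrite mulr0 fine_ge0.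
rewrite inE => hs; rewrite mulr1 -lee_fin fineK ?ge0_fin_numE//.
rewrite -(leb_ball_at s (ltW delta_gt0)).
apply: le_measure; rewrite ?inE//; first exact: measurable_ball_at.
by move=> t; exact: ball_at_xsection0.
Qed.

Variables (z : phase R d) (eta : R).
Hypotheses (zc : cube c z.1) (eta0 : 0 <= eta) (eta1 : eta <= 1).
Hypothesis hcos : forall s t, cube delta (tsub t s) ->
  1 - eta <= cos (2 * pi * dot z.2 t - 2 * pi * dot z.2 s).

Let sx s := tsub s z.1.

(** Expand the squared distance of the rows at [s]: each of the two norms is at most [V], on a cube
    of radius [L], and the cross term is at least $(1-\eta)V$ on the cube of radius [M]. Then
    integrate over [s]. *)
Lemma band_shift_dist :
  hspair e0 (fun u => alpha z T u - T u) (fun u => alpha z T u - T u) +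
    2 * (1 - eta) * V * (2 * M) ^+ d <= 2 * V * (2 * L) ^+ d.
Proof.
have haT := hs_alpha E z hT; have hW := hs_sub oe0 haT hT.
have [F [mF F0 FE hF]] := hsq_kernel E (has_kernel_sub (has_kernel_alpha z oe0 kT) kT).
have mM := measurable_cube M; have mL := measurable_cube L.
pose a := 2 * (1 - eta) * V.
have a0 : 0 <= a by rewrite !mulr_ge0// subr_ge0.
rewrite -lee_fin EFinD (hspair_sqr oe0 hW) hF -/a EFinM -(leb_cube M0).
rewrite -(integral_ind a0 mM) -ge0_integralD//; last 2 first.
- by move=> s _; rewrite lee_fin mulr_ge0.
- exact: measurable_ind.
have mLx : measurable (ball_at L z.1) := measurable_ball_at L z.1.
have -> : (2 * V * (2 * L) ^+ d)%:E =
    (\int[mu]_s ((V * \1_(ball_at L z.1) s)%:E + (V * \1_(cube L) s)%:E))%E.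
  rewrite ge0_integralD//.
  - rewrite !integral_ind// leb_ball_at// leb_cube// -!EFinM -EFinD.
    by congr (_%:E); ring.
  - by move=> s _; rewrite lee_fin mulr_ge0.
  - exact: measurable_ind.
  - by move=> s _; rewrite lee_fin mulr_ge0.
  - exact: measurable_ind.
apply: ae_ge0_le_integral => //.
- by move=> s _; rewrite adde_ge0// lee_fin mulr_ge0.
- by apply: emeasurable_funD => //; exact: measurable_ind.
- by move=> s _; rewrite adde_ge0// lee_fin mulr_ge0.
- by apply: emeasurable_funD => //; exact: measurable_ind.
apply: filterS FE => s -> _; rewrite -!EFinD lee_fin.
pose k := (character z.2 s)^* *: time_freq_shift z (secL2 K (sx s)).
have kk : B k k <= V * \1_(ball_at L z.1) s.
  have n1 : Normc.normc (character z.2 s)^* = 1 by rewrite conj_cis normc_cis.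
  rewrite -sqr_nrm nrm_cscale n1 mul1r sqr_nrm (unitary_reip _ _ (unitary_shift z)).
  by rewrite (sqr_secL2 mK mL fL (@band_sub L delta)) leb_xsection_band.
have ss : B (secL2 K s) (secL2 K s) <= V * \1_(cube L) s.
  by rewrite (sqr_secL2 mK mL fL (@band_sub L delta)) leb_xsection_band.
have ks : (1 - eta) * (V * \1_(cube M) s) <= B k (secL2 K s).
  have hc t : xsection K s t ->
      1 - eta <= cos (2 * pi * dot z.2 t - 2 * pi * dot z.2 s).
    by move=> /xsection_bandE[_ _]; exact: hcos.
  rewrite indicE; have [|_] := boolP (s \in cube M).
    rewrite inE mulr1 => hs.
    have := reip_shift_L2ind (z := z) (s := s) (A := xsection K (sx s))
      (A' := xsection K s) (A'' := ball_at delta s) eta1 (mKs _) (fKs _) (mKs _) (fKs _)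
      (measurable_ball_at _ _) (fball s) (fun t => ball_at_xsection0 hs)
      (fun t => ball_at_xsection zc hs) hc.
    by rewrite (leb_ball_at s (ltW delta_gt0)); apply.
  (* Near the boundary only nonnegativity of the cross term is needed, which is the case of an empty
     [A'']. *)
  have := reip_shift_L2ind (z := z) (s := s) (A := xsection K (sx s))
    (A' := xsection K s) (A'' := set0) eta1 (mKs _) (fKs _) (mKs _) (fKs _)
    measurable0.
  by rewrite measure0 !mulr0; apply.
have -> : B (k - secL2 K s) (k - secL2 K s) = B k k + B (secL2 K s) (secL2 K s) - 2 * B k (secL2 K s).
  by rewrite ripBl !ripBr (ripC B (secL2 K s)); ring.
by rewrite /a; lra.
Qed.


(** As $\alpha_z$ preserves the norm, the squared distance is $2\|T\|^2$ minus twice the pairing, so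
    [band_shift_dist] bounds the pairing from below. *)
Lemma hspair_band_ge :
  hspair e0 T T - (V * (2 * L) ^+ d - (1 - eta) * V * (2 * M) ^+ d) <=
    hspair e0 T (alpha z T).
Proof.
have haT := hs_alpha E z hT; have hW := hs_sub oe0 haT hT.
have := band_shift_dist.
have aa : hspair e0 (alpha z T) (alpha z T) = hspair e0 T T.
  by apply: EFin_inj; rewrite (hspair_sqr oe0 haT) (hspair_sqr oe0 hT) hsq_alpha.
have lin X : hilbert_schmidt X -> hspair e0 (fun u => alpha z T u - T u) X =
    hspair e0 (alpha z T) X - hspair e0 T X.
  move=> hX; have := hspair_lin oe0 (-1) hT haT hX.
  rewrite rmorphN rmorph1 mulN1r addrC => <-; congr (hspair _ _ _).
  by apply/funext => u; rewrite scaleN1r addrC.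
rewrite (lin _ hW) (hspairC e0 (alpha z T)) (hspairC e0 T) (lin _ haT) (lin _ hT) aa.
rewrite (hspairC e0 (alpha z T) T).
by lra.
Qed.

End BandEstimate.

(** * Choice of the parameters of the band operator *)

Section SelfConcentration.
Variables (R : realType) (d : nat).
Local Notation C := R[i].
Local Notation H := (L2 R d).
Local Notation B := (reip R d).
Local Notation mu := (leb R d).
Implicit Types (T : H -> H) (z : phase R d).

Lemma cos_near0 (eta : R) : 0 < eta ->
  exists2 rho : R, 0 < rho & forall t, `|t| < rho -> 1 - eta <= cos t.
Proof.
move=> eta0; have : cos x @[x --> (0 : R)] --> (1 : R).
  by rewrite -[X in _ --> X](@cos0 R); exact: continuous_cos.
move=> /cvgrPdist_lt /(_ _ eta0)[rho /= rho0 h]; exists rho => // t tr.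
have := h t; rewrite /= sub0r normrN => /(_ tr).
by rewrite ltr_norml => /andP[_]; lra.
Qed.

Lemma large_cube_ratio (a eta : R) : 0 <= a -> 0 < eta ->
  exists2 L : R, a < L & (2 * L) ^+ d <= (1 + eta) * (2 * (L - a)) ^+ d.
Proof.
move=> a0 eta0; have : x ^+ d @[x --> (1 : R)] --> (1 : R).
  by rewrite -[X in _ --> X](expr1n R d); exact: exprn_continuous.
move=> /cvgrPdist_lt /(_ _ eta0)[e /= e_gt0 he].
(* Makes [a / M] smaller than [e], and [M] positive even for [a = 0]. *)
pose M := 2 * (a + 1) / e.
have M0 : 0 < M by rewrite divr_gt0// mulr_gt0//; lra.
exists (M + a); first by lra.
have -> : M + a - a = M by ring.
have -> : 2 * (M + a) = (1 + a / M) * (2 * M) by field; rewrite gt_eqF.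
have M2 : 0 <= (2 * M) ^+ d by rewrite exprn_ge0// mulr_ge0// ltW.
have aM : 0 <= a / M by rewrite divr_ge0// ltW.
rewrite exprMn; apply: (ler_wpM2r M2).
have := he (1 + a / M); rewrite /= opprD addrA subrr sub0r normrN.
have -> : `|a / M| < e.
  rewrite ger0_norm// ltr_pdivrMr//.
  by rewrite /M mulrC divfK ?gt_eqF//; lra.
by move=> /(_ isT); rewrite ltr_norml => /andP[+ _]; lra.
Qed.

Lemma dot_sub_le (c delta : R) (x s t : euclid R d) : 0 <= delta ->
  cube c x -> cube delta (tsub t s) -> `|dot x t - dot x s| <= d%:R * (c * delta).
Proof.
move=> delta0 hx hts; rewrite /dot -sumrB.
have -> : d%:R * (c * delta) = \sum_(i < d) c * delta.
  by rewrite sumr_const card_ord mulr_natl.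
apply: (le_trans (ler_norm_sum _ _ _)); apply: ler_sum => i _.
have h2 := hts i; rewrite tnth_mktuple in h2; have h1 := hx i.
rewrite -mulrBr normrM; exact: (ler_pM (normr_ge0 _) (normr_ge0 _) h1 h2).
Qed.

Variable E : onb R d.
Let e0 : nat -> H := proj1_sig E.
Let oe0 : orthonormal_basis e0 := proj2_sig E.

(** A small [delta] keeps the phase nearly constant on a row, and a large [L] makes the boundary
    layer negligible. The loss in [hspair_band_ge] is then at most $\epsilon$ times the lower bound
    of [band_norm_ge]. Self-adjointness removes the adjoint in [op_convE]. *)
Lemma almost_invariant (c epsilon : R) : 0 <= c -> 0 < epsilon -> epsilon <= 1 ->
  exists T, hs_nonzero T /\ forall z, cube c z.1 -> cube c z.2 ->
    (1 - epsilon) * hs_norm T ^+ 2 <= Normc.normc (op_conv T (op_check T) z).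
Proof.
(* One half of [epsilon] is spent on the phase, the other on the ratio of the two cubes. *)
move=> c0 eps0 eps1; pose eta := epsilon / 2.
have eta0 : 0 < eta by rewrite divr_gt0.
have eta1 : eta <= 1 by rewrite /eta; lra.
have [rho rho0 hrho] := cos_near0 eta0.
(* The phase varies by at most [(q - 1) * delta] on a row, strictly less than [q * delta = rho]; the
   added one also makes [q] positive. *)
pose q : R := 2 * pi * (d%:R * (c * 1)) + 1.
have q0 : 0 < q.
  by rewrite /q ltr_wpDl// !mulr_ge0 ?ler0n ?pi_ge0.
pose delta := rho / q.
have delta0 : 0 < delta by rewrite divr_gt0.
have hcos z : cube c z.2 -> forall s t, cube delta (tsub t s) ->
    1 - eta <= cos (2 * pi * dot z.2 t - 2 * pi * dot z.2 s).
  move=> hz s t hts; apply: hrho.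
  rewrite -mulrBr normrM ger0_norm ?mulr_ge0 ?pi_ge0//.
  apply: (@le_lt_trans _ _ (2 * pi * (d%:R * (c * delta)))).
    by rewrite ler_wpM2l ?mulr_ge0 ?pi_ge0//; exact: dot_sub_le (ltW delta0) hz hts.
  have -> : rho = q * delta by rewrite /delta mulrC divfK// gt_eqF.
  by rewrite /q mulr1; move: delta0; lra.
have [L La hL] := large_cube_ratio (addr_ge0 c0 (ltW delta0)) eta0.
have mL := measurable_cube (d := d) L.
have L0 : 0 <= L by move: La delta0; lra.
have fL : (mu (cube L) < +oo)%E by rewrite leb_cube// ltry.
have [T [hT kT]] := secL2_kernel_ex E (measurable_band L delta) mL fL (@band_sub _ _ L delta).
have aT := secL2_adjoint E (measurable_band L delta) mL fL (@band_sub _ _ L delta)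
  (@band_sym _ _ L delta) kT hT.
have nge := band_norm_ge delta0 c0 La E hT kT.
have V0 : 0 < (2 * delta) ^+ d by rewrite exprn_gt0// mulr_gt0.
have M0 : 0 < (2 * (L - c - delta)) ^+ d by rewrite exprn_gt0// mulr_gt0//; move: La; lra.
have N0 : 0 < hspair e0 T T by apply: lt_le_trans nge; rewrite mulr_gt0.
exists T; split.
  apply: (hs_norm_nonzero E hT); rewrite lt_neqAle hs_norm_ge0 andbT eq_sym -sqrf_eq0.
  by rewrite (sqr_hs_norm E hT) gt_eqF.
move=> z hz1 hz2.
have haT := hs_alpha E z hT.
rewrite (op_convE E T z hT) (adjoint_alpha E z hT) aT.
apply: (@le_trans _ _ (hspair e0 T (alpha z T))); last first.
  rewrite (hs_innerE E hT haT); apply: (le_trans (ler_norm _)).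
  by rewrite -sqrtr_sqr ler_wsqrtr// lerDl sqr_ge0.
apply: le_trans (hspair_band_ge delta0 c0 La E hT kT hz1 eta1 (hcos z hz2)).
rewrite (sqr_hs_norm E hT).
rewrite -[X in (1 - epsilon) * X]/(hspair e0 T T).
have e1 : L - c - delta = L - (c + delta) by ring.
move: nge V0 N0 hL; rewrite e1 /eta -/e0.
move: (hspair e0 T T) ((2 * delta) ^+ d) ((2 * L) ^+ d) ((2 * (L - (c + delta))) ^+ d).
move=> N V a b Vb V0 N0 ab.
have h1 : V * a <= V * ((1 + epsilon / 2) * b) by rewrite ler_pM2l.
have h2 : epsilon * (V * b) <= epsilon * N by rewrite ler_pM2l.
by lra.
Qed.

End SelfConcentration.

(** * The value of the self-concentration supremum *)

Section SelfSupremum.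
Variables (R : realType) (d : nat).
Local Notation H := (L2 R d).
Implicit Types (T : H -> H) (z : phase R d).
Variables (p : R) (p_ge1 : 1 <= p).
Variables (Omega : set (phase R d)) (mOmega : measurable Omega).
Hypothesis Omega_fin : (leb2 R d Omega < +oo)%E.
Variable E : onb R d.
Let p0 : 0 < p. Proof. exact: lt_le_trans p_ge1. Qed.
Let ip0 : 0 < p^-1. Proof. by rewrite invr_gt0. Qed.

Lemma self_conc_ratio_le T : hs_nonzero T ->
  (self_conc_ratio p Omega T <= leb2 R d Omega `^ p^-1)%E.
Proof.
move=> nT; have [hT _] := nT; have n0 := hs_norm_gt0 E nT.
have N0 : 0 < hs_norm T ^+ 2 by rewrite exprn_gt0.
rewrite /self_conc_ratio inver gt_eqF// lee_pdivrMr//.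
have := concentration_le p_ge1 mOmega E hT hT.
by rewrite -expr2 muleC.
Qed.

Definition phase_cube (c : R) : set (phase R d) :=
  [set z | cube c z.1 /\ cube c z.2].

Lemma measurable_phase_cube c : measurable (phase_cube c).
Proof.
apply: measurable_phase.
rewrite (_ : phase_cube c = cube c `*` cube c); last by apply/seteqP; split.
by apply: measurableX; exact: measurable_cube.
Qed.

(** Almost invariance is uniform only for bounded $z$, so $\Omega$ is exhausted by bounded pieces,
    whose measures converge by continuity from below. *)
Lemma leb2_phase_cube :
  leb2 R d (Omega `&` phase_cube n%:R) @[n --> \oo] --> leb2 R d Omega.
Proof.
have mO n : measurable (Omega `&` phase_cube n%:R).
  by apply: measurableI => //; exact: measurable_phase_cube.
have UE : \bigcup_n (Omega `&` phase_cube n%:R) = Omega.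
  apply/seteqP; split => [z [n _ []]//|z Oz].
  have ex (t : euclid R d) : exists n, forall m, (n <= m)%N -> cube m%:R t.
    exists (\max_(i < d) (Num.truncn `|tnth t i|).+1)%N => m nm i.
    apply: (@le_trans _ _ (Num.truncn `|tnth t i|).+1%:R).
      by rewrite ltW// truncnS_gt.
    rewrite ler_nat (leq_trans _ nm)//.
    exact: (leq_bigmax (F := fun i : 'I_d => (Num.truncn `|tnth t i|).+1) i).
  have [n1 h1] := ex z.1; have [n2 h2] := ex z.2.
  exists (maxn n1 n2) => //; split=> //; split.
    by apply: h1; rewrite leq_maxl.
  by apply: h2; rewrite leq_maxr.
rewrite -[X in _ --> leb2 R d X]UE; apply: nondecreasing_cvg_mu => //.
  by rewrite UE.
move=> m n mn; apply/subsetPset => z [Oz [h1 h2]]; split=> //.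
by split=> i; rewrite (le_trans (h1 i) _, le_trans (h2 i) _) ?ler_nat.
Qed.

Lemma self_conc_ratio_ge (n : nat) (epsilon : R) : 0 < epsilon -> epsilon <= 1 ->
  exists T, hs_nonzero T /\
    ((1 - epsilon)%:E * leb2 R d (Omega `&` phase_cube n%:R) `^ p^-1 <=
      self_conc_ratio p Omega T)%E.
Proof.
move=> eps0 eps1; have [T [nT hT']] := almost_invariant E (ler0n R n) eps0 eps1.
have [hT _] := nT; exists T; split=> //; have n0 := hs_norm_gt0 E nT.
have N0 : 0 < hs_norm T ^+ 2 by rewrite exprn_gt0.
rewrite /self_conc_ratio inver gt_eqF// lee_pdivlMr//.
set On := Omega `&` _.
have mOn : measurable On by apply: measurableI => //; exact: measurable_phase_cube.
pose a := (1 - epsilon) * hs_norm T ^+ 2.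
have a0 : 0 <= a by rewrite mulr_ge0 ?subr_ge0// ltW.
have -> : ((1 - epsilon)%:E * leb2 R d On `^ p^-1 * (hs_norm T ^+ 2)%:E =
    a%:E * leb2 R d On `^ p^-1)%E by rewrite muleAC -EFinM.
have aE : a%:E = ((((a `^ p)%:E : \bar R)) `^ p^-1)%E.
  by rewrite poweR_EFin -powRrM mulfV ?gt_eqF// powRr1.
rewrite aE -poweRM ?lee_fin ?powR_ge0//.
have g0 z : Omega z -> (0 <= (Normc.normc (op_conv T (op_check T) z) `^ p)%:E)%E.
  by rewrite lee_fin powR_ge0.
apply: gt0_ler_poweR; first exact: ltW.
- by rewrite in_itv/= mule_ge0 ?lee_fin ?powR_ge0 ?leey.
- by rewrite in_itv/= leey andbT; apply: integral_ge0.
apply: (@le_trans _ _ (\int[leb2 R d]_(z in On)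
    (Normc.normc (op_conv T (op_check T) z) `^ p)%:E)%E); last first.
  exact: (ge0_subset_integral _ mOn mOmega (measurable_conc p (Omega := Omega) E hT hT)
    g0 (@subIsetl _ _ _)).
rewrite -(integral_cst (leb2 R d) mOn); apply: (ge0_le_integral _ mOn).
- by move=> z _; rewrite lee_fin powR_ge0.
- exact: measurable_cst.
- exact: (measurable_conc p (Omega := On) E hT hT).
move=> z [_ [z1 z2]]; rewrite lee_fin; apply: ge0_ler_powR; first exact: ltW.
- by rewrite nnegrE.
- by rewrite nnegrE normc_ge0.
exact: hT'.
Qed.

Lemma self_conc_ratio_sup :
  ereal_sup [set self_conc_ratio p Omega T | T in @hs_nonzero R d]
    = (leb2 R d Omega `^ p^-1)%E.
Proof.
set s := ereal_sup _; apply/eqP; rewrite eq_le; apply/andP; split.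
  by apply: ge_ereal_sup => _ [T nT <-]; exact: self_conc_ratio_le.
pose w n := (leb2 R d (Omega `&` phase_cube n%:R)).
have wle n : (w n <= leb2 R d Omega)%E.
  by apply: le_measure; rewrite ?inE//; first by
    apply: measurableI => //; exact: measurable_phase_cube.
have w0 n : (0 <= w n)%E by exact: measure_ge0.
have wf n : w n \is a fin_num by rewrite ge0_fin_numE// (le_lt_trans (wle n)).
have Of : leb2 R d Omega \is a fin_num by rewrite ge0_fin_numE.
have h := cvg_poweR ip0 w0 wf Of leb2_phase_cube.
have Xf : (leb2 R d Omega `^ p^-1)%E \is a fin_num by exact: fin_num_poweR.
(* The operator of [self_conc_ratio_ge] changes with [n], but the supremum does not, so the limit in
   [n] can be taken for fixed [epsilon]. *)
have hs (epsilon : R) : 0 < epsilon -> epsilon <= 1 ->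
    ((1 - epsilon)%:E * leb2 R d Omega `^ p^-1 <= s)%E.
  move=> eps0 eps1.
  have ef : (1 - epsilon)%:E \is a @fin_num R by [].
  apply: (cvge_le _ (cvgeZl ef h)); apply: nearW => n.
  have [T [nT hT]] := self_conc_ratio_ge n eps0 eps1.
  by apply: (le_trans hT); apply: ereal_sup_ubound; exists T.
have sX : (s <= leb2 R d Omega `^ p^-1)%E.
  by apply: ge_ereal_sup => _ [T nT <-]; exact: self_conc_ratio_le.
have s0 : (0 <= s)%E by have := hs 1 ltr01 (lexx 1); rewrite subrr mul0e.
have sf : s \is a fin_num.
  by rewrite ge0_fin_numE//; apply: (le_lt_trans sX); rewrite -ge0_fin_numE// poweR_ge0.
move: hs s0; rewrite -(fineK sf) -(fineK Xf) lee_fin => hs s0.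
rewrite lee_fin leNgt; apply/negP; move: hs s0.
move: (fine s) (fine _) => r x hs r0 rx.
have x0 : 0 < x by apply: le_lt_trans rx.
(* This [epsilon] turns [(1 - epsilon) * x] into the midpoint of [r] and [x], which exceeds [r]. *)
have := hs ((x - r) / (2 * x)); rewrite -EFinM lee_fin.
have -> : (1 - (x - r) / (2 * x)) * x = x - (x - r) / 2 by field; rewrite gt_eqF.
have e0 : 0 < (x - r) / (2 * x) by rewrite divr_gt0 ?mulr_gt0 ?subr_gt0.
have e1 : (x - r) / (2 * x) <= 1 by rewrite ler_pdivrMr ?mulr_gt0// mul1r; lra.
by move=> /(_ e0 e1); lra.
Qed.

End SelfSupremum.

(** * The self-concentration supremum is not attained *)

Section Truncation.
Variables (R : realType) (d : nat).
Local Notation C := R[i].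
Local Notation H := (L2 R d.+1).
Local Notation B := (reip R d.+1).
Local Notation mu := (leb R d.+1).
Implicit Types (u v : H) (A T : H -> H) (z w : phase R d.+1) (a b : R).

Definition halfspace a : set (euclid R d.+1) := [set y | a <= (thead y : R)].

Lemma measurable_halfspace a : measurable (halfspace a).
Proof.
have mt : measurable_fun setT (fun y : euclid R d.+1 => (thead y : measurableTypeR R)).
  exact: measurable_tnth.
rewrite (_ : halfspace a = (fun y => thead y) @^-1` `[a, +oo[%classic).
  by rewrite -[X in measurable X]setTI; exact: mt.
by apply/seteqP; split => y; rewrite /halfspace /= in_itv/= andbT.
Qed.

Definition truncate a u : H := toL2 (fun y => indc (halfspace a) y * l2rep u y).

Let mfunc_truncate a u : mfunc (fun y => indc (halfspace a) y * l2rep u y).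
Proof.
apply: mfuncM; first by apply: mfunc_indc; exact: measurable_halfspace.
exact: sqint_mfunc (l2rep_sqint u).
Qed.

Let integral_truncate_le a u :
  (\int[mu]_y (Normc.normc (indc (halfspace a) y * l2rep u y) ^+ 2)%:E <=
    \int[mu]_y (Normc.normc (l2rep u y) ^+ 2)%:E)%E.
Proof.
have [n1 n2] := mfunc_truncate a u; have [m1 m2 _] := l2rep_sqint u.
apply: ge0_le_integral => //.
- by move=> y _; rewrite lee_fin sqr_ge0.
- exact: (measurable_sqr_normc n1 n2).
- exact: (measurable_sqr_normc m1 m2).
move=> y _; rewrite lee_fin Normc.normcM exprMn normc_indc indicE.
by case: (_ \in _); rewrite ?mul1r ?mul0r ?sqr_ge0.
Qed.

Lemma truncate_sqint a u :
  square_integrable (fun y => indc (halfspace a) y * l2rep u y).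
Proof.
have [m1 m2 fi] := l2rep_sqint u; have [n1 n2] := mfunc_truncate a u.
by split => //; exact: le_lt_trans (integral_truncate_le a u) fi.
Qed.

Lemma truncateE a u :
  {ae mu, forall y, l2rep (truncate a u) y = indc (halfspace a) y * l2rep u y}.
Proof. exact: toL2E (truncate_sqint a u). Qed.

Lemma reip_truncate a b u : a <= b ->
  B (truncate a u) (truncate b u) = B (truncate b u) (truncate b u).
Proof.
move=> ab; have sa := truncate_sqint a u; have sb := truncate_sqint b u.
rewrite !reipE (inner_ae sa sb (truncateE a u) (truncateE b u)).
rewrite (inner_ae sb sb (truncateE b u) (truncateE b u)).
rewrite -[LHS]/(\int[mu]_x _) -[RHS]/(\int[mu]_x _).
apply: eq_Rintegral => y _; rewrite /indc !indicE.
have [|yb] := boolP (y \in halfspace b); last first.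
  by case: (l2rep u y) => r i /=; ring.
by rewrite inE /halfspace /= => h; rewrite mem_set//; exact: le_trans ab h.
Qed.

Lemma truncate_sqr a b u : a <= b -> B (truncate a u) (truncate a u) =
  B (truncate b u) (truncate b u) +
  B (truncate a u - truncate b u) (truncate a u - truncate b u).
Proof.
move=> ab; have := reip_truncate u ab.
move: (truncate a u) (truncate b u) => f g fg.
by rewrite ripBl ripBr ripBr (ripC B g f) fg; ring.
Qed.

Lemma truncate_linear a : linear (truncate a).
Proof.
move=> c u v; apply: l2_ext.
have h : {ae mu, forall y, indc (halfspace a) y * l2rep (c *: u + v) y =
    c * l2rep (truncate a u) y + l2rep (truncate a v) y}.
  apply: filterS3 (l2rep_lin c u v) (truncateE a u) (truncateE a v) => y -> -> ->; ring.
by apply: filterS3 (truncateE a (c *: u + v)) (l2rep_lin c (truncate a u) (truncate a v)) h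
  => y -> -> ->.
Qed.

Lemma bounded_truncate a : bounded_operator (truncate a).
Proof.
split; first exact: truncate_linear.
exists 1 => u; rewrite mul1r !L2norm_nrm /nrm ler_wsqrtr//.
rewrite -lee_fin !reipE (sqr_l2normE (truncate_sqint a u) (truncateE a u)) sqr_l2norm.
exact: integral_truncate_le.
Qed.

Lemma truncate_shift a z u : truncate a (time_freq_shift z u) =
  time_freq_shift z (truncate (a - thead z.1) u).
Proof.
apply: l2_ext.
have h := ae_tmap (fun i => preserves_translation (tnth z.1 i))
  (truncateE (a - thead z.1) u).
have h2 : {ae mu, forall y, indc (halfspace a) y * l2rep (time_freq_shift z u) y =
    character z.2 y * l2rep (truncate (a - thead z.1) u) (tsub y z.1)}.
  apply: filterS2 h (l2rep_shift z u) => y -> ->.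
  have -> : indc (halfspace (a - thead z.1)) (tsub y z.1) = indc (halfspace a) y.
    congr ((_ : R)%:C); rewrite !indicE; congr (nat_of_bool _)%:R.
    by apply/idP/idP; rewrite !inE /halfspace /= /thead tnth_mktuple lerD2r.
  by ring.
by apply: filterS3 (truncateE a (time_freq_shift z u))
  (l2rep_shift z (truncate (a - thead z.1) u)) h2 => y -> -> ->.
Qed.

Variable E : onb R d.+1.
Let e0 : nat -> H := proj1_sig E.
Let oe0 : orthonormal_basis e0 := proj2_sig E.

(** The truncation passes the shift with its level lowered by the first position coordinate; what
    remains is $\alpha_z$ of a truncated operator, with the same norm. *)
Lemma hsq_truncate_alpha a z A : hilbert_schmidt A ->
  hsq e0 (truncate a \o alpha z A) = hsq e0 (truncate (a - thead z.1) \o A).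
Proof.
move=> hA; have hX := hs_compl oe0 (bounded_truncate (a - thead z.1)) hA.
rewrite -(hsq_alpha E z hX); congr hsq; apply/funext => u.
by rewrite /alpha /= truncate_shift.
Qed.

Lemma hsq_truncate_scale a (c : C) A : hilbert_schmidt A -> Normc.normc c = 1 ->
  hsq e0 (truncate a \o (fun u => c *: A u)) = hsq e0 (truncate a \o A).
Proof.
move=> hA c1; apply: eq_eseriesr => n _; congr (_%:E).
rewrite /= (bounded_linZ _ _ (bounded_truncate a)) -sqr_nrm nrm_cscale c1 mul1r.
by rewrite sqr_nrm.
Qed.

Lemma adde_cancel0 (r s : \bar R) : (0 <= r)%E -> (r < +oo)%E ->
  r = (r + s)%E -> s = 0%E.
Proof.
case: r => [r||]// _ _; case: s => [s||]// [] rs; congr (_%:E).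
by apply: (addrI r); rewrite -rs addr0.
Qed.

(** The half spaces are nested, so Pythagoras splits the mass; equal finite masses leave a
    difference of norm zero. *)
Lemma truncate_eq a b A : a <= b -> hilbert_schmidt A ->
  hsq e0 (truncate a \o A) = hsq e0 (truncate b \o A) ->
  truncate a \o A = truncate b \o A.
Proof.
move=> ab hA h.
have ha := hs_compl oe0 (bounded_truncate a) hA.
have hb := hs_compl oe0 (bounded_truncate b) hA.
have hD := hs_sub oe0 ha hb.
pose D u := (truncate a \o A) u - (truncate b \o A) u.
have e : (hsq e0 (truncate a \o A) = hsq e0 (truncate b \o A) + hsq e0 D)%E.
  rewrite /hsq -nneseriesD; try by move=> n _ _; rewrite lee_fin rip_ge0.
  by apply: eq_eseriesr => n _; rewrite /= (truncate_sqr _ ab) EFinD.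
have D0 : hsq e0 D = 0%E.
  have [_ fb] := (hsP oe0 _).1 hb.
  exact: (adde_cancel0 (hsq_ge0 _ _) fb (etrans (esym h) e)).
have D0' : D = (fun=> 0).
  have p0 : hspair e0 D D = 0.
    by apply: EFin_inj; rewrite (hspair_sqr oe0 hD) D0.
  exact: (@hspair_eq0 _ _ E _ hD p0).
apply/funext => u; apply/eqP; rewrite -subr_eq0; apply/eqP.
exact: (congr1 (fun F : H -> H => F u) D0').
Qed.

(** Iterating the period shows that [v] vanishes almost everywhere on the strips $-mx\le y_0<mx$,
    and these cover the space. *)
Lemma truncate_const_eq0 (x : R) v : 0 < x ->
  (forall a, truncate a v = truncate (a + x) v) -> v = 0.
Proof.
move=> x0 hv.
have hk k a : truncate a v = truncate (a + x *+ k) v.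
  elim: k a => [|k IH] a; first by rewrite addr0.
  by rewrite IH hv mulrSr addrA.
have h m : {ae mu, forall y, indc (halfspace (- (x *+ m))) y * l2rep v y =
    indc (halfspace (x *+ m)) y * l2rep v y}.
  have e : truncate (- (x *+ m)) v = truncate (x *+ m) v.
    by rewrite (hk (m + m)%N) mulrnDr addrA addNr add0r.
  by apply: filterS2 (truncateE (- (x *+ m)) v) (truncateE (x *+ m) v) => y <- <-; rewrite e.
have l0 : {ae mu, forall y, l2rep (0 : H) y = 0}.
  by have := l2repB (0 : H) 0; rewrite subrr; apply: filterS => y; rewrite subrr.
apply: l2_ext; apply: filterS2 (ae_foralln h) l0 => y hy ->.
pose m := (Num.truncn (`|thead y : R| / x)).+1.
have ym : `|thead y : R| < x *+ m.
  by rewrite -mulr_natr mulrC -ltr_pdivrMr// truncnS_gt.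
have := hy m; rewrite /indc !indicE.
rewrite mem_set; last first.
  by move: ym; rewrite ltr_norml => /andP[? _]; exact: ltW.
rewrite memNset ?mul1r ?mul0r//.
by rewrite /halfspace /=; apply/negP; rewrite -ltNge; move: ym; rewrite ltr_norml => /andP[].
Qed.

(* The Hilbert--Schmidt mass of [A] in the half space [y_0 >= a] is moved by   *)
(* [alpha z] by the first coordinate of the position of [z].                   *)
Lemma alpha_proportional_eq0 z w A T (c c' : C) :
  thead w.1 != thead z.1 -> hilbert_schmidt A ->
  Normc.normc c = 1 -> Normc.normc c' = 1 ->
  T = (fun u => c *: alpha z A u) -> T = (fun u => c' *: alpha w A u) ->
  A = (fun=> 0).
Proof.
wlog zw : z w c c' / (thead w.1 : R) < thead z.1.
  move=> wl; rewrite neq_lt => /orP[h|h] hA c1 c1' e e'.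
    by apply: (wl z w c c') => //; rewrite lt_eqF.
  by apply: (wl w z c' c) => //; rewrite lt_eqF.
move=> _ hA c1 c1' e e'.
pose x : R := thead z.1 - thead w.1.
have x0 : 0 < x by rewrite subr_gt0.
have P a : truncate a \o A = truncate (a + x) \o A.
  have ax : a <= a + x by rewrite lerDl ltW.
  (* With this level the two expressions for [T] see [A] truncated at [a] and at [a + x]. *)
  pose b := a + thead z.1.
  have hz := hsq_truncate_alpha b z hA; have hw := hsq_truncate_alpha b w hA.
  have hcz := hsq_truncate_scale b (hs_alpha E z hA) c1.
  have hcw := hsq_truncate_scale b (hs_alpha E w hA) c1'.
  have bz : b - thead z.1 = a by exact: addrK.
  have bw : b - thead w.1 = a + x by rewrite /b /x addrA.
  rewrite bz in hz; rewrite bw in hw.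
  have ee := congr1 (fun X : H -> H => hsq e0 (truncate b \o X)) (etrans (esym e) e').
  exact: (truncate_eq ax hA
    (etrans (esym hz) (etrans (esym hcz) (etrans ee (etrans hcw hw))))).
apply/funext => u; apply: (truncate_const_eq0 x0) => a.
exact: (congr1 (fun F : H -> H => F u) (P a)).
Qed.

End Truncation.

(** * Equality cases and the contradiction *)

Section NotAttained.
Variables (R : realType) (d : nat).
Local Notation H := (L2 R d.+1).
Implicit Types (T : H -> H) (z w : phase R d.+1).
Variables (p : R) (p_ge1 : 1 <= p).
Variables (Omega : set (phase R d.+1)) (mOmega : measurable Omega).
Hypotheses (Omega_gt0 : (0 < leb2 R d.+1 Omega)%E)
  (Omega_fin : (leb2 R d.+1 Omega < +oo)%E).
Variable E : onb R d.+1.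
Let p0 : 0 < p. Proof. exact: lt_le_trans p_ge1. Qed.

Lemma leb2_hyperplane (r : R) :
  measurable ([set z | thead z.1 = r] : set (phase R d.+1)) /\
  leb2 R d.+1 [set z | thead z.1 = r] = 0%E.
Proof.
have mt : measurable_fun setT (fun y : euclid R d.+1 => (thead y : measurableTypeR R)).
  exact: measurable_tnth.
have m1 : measurable [set y : euclid R d.+1 | thead y = r].
  rewrite (_ : [set _ | _] = (fun y => thead y) @^-1` [set r])//.
  by rewrite -[X in measurable X]setTI; exact: mt.
have e : [set z : (euclid R d.+1 * euclid R d.+1)%type | thead z.1 = r] =
    [set y | thead y = r] `*` setT by apply/seteqP; split => // z [].
have m2 : measurable [set z : (euclid R d.+1 * euclid R d.+1)%type | thead z.1 = r].
  by rewrite e; apply: measurableX.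
split; first exact: measurable_phase.
have h : leb R d.+1 [set y | thead y = r] = 0%E := leb_hyperplane d r.
rewrite (leb2E m2) e; apply: (etrans (product_measure1E _ _ m1 measurableT)).
exact: (etrans (congr1 (fun x => x * _)%E h) (mul0e _)).
Qed.

(** A set of positive measure is not covered by a null set together with the hyperplane of points
    whose first coordinate is that of [z]. *)
Lemma ae_two_points (Q : phase R d.+1 -> Prop) :
  {ae leb2 R d.+1, forall z, Omega z -> Q z} ->
  exists z w, [/\ Omega z, Omega w, Q z, Q w & thead w.1 != thead z.1].
Proof.
move=> [N [mN N0 QN]].
have key M : measurable M -> leb2 R d.+1 M = 0%E ->
    exists z, [/\ Omega z, Q z & ~ M z].
  move=> mM M0; apply: contrapT => no.
  have sub : Omega `<=` N `|` M.
    move=> z Oz; have [Mz|nMz] := pselect (M z); [by right|left].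
    apply: QN => /= Qz; apply: no; exists z; split=> //; exact: Qz.
  move: Omega_gt0; apply/negP; rewrite -leNgt.
  apply: (le_trans (le_measure (leb2 R d.+1) _ _ sub)).
  - by rewrite inE.
  - by rewrite inE; exact: measurableU.
  have NM : (leb2 R d.+1 N + leb2 R d.+1 M <= 0)%E by rewrite N0 M0 adde0.
  exact: (le_trans (measureU2 _ mN mM) NM).
have [z [Oz Qz _]] := key set0 measurable0 (measure0 _).
have [m2 z2] := leb2_hyperplane (thead z.1).
have [w [Ow Qw nw]] := key _ m2 z2.
by exists z, w; split=> //; apply/eqP.
Qed.

(** Equality says that the nonnegative function [f], the defect of the pointwise bound in $p$-th
    powers, has integral zero over $\Omega$; finiteness of the integrals allows the subtraction. *)
Lemma self_conc_ratio_eq_ae T : hs_nonzero T ->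
  self_conc_ratio p Omega T = (leb2 R d.+1 Omega `^ p^-1)%E ->
  {ae leb2 R d.+1, forall z, Omega z ->
    Normc.normc (op_conv T (op_check T) z) = hs_norm T ^+ 2}.
Proof.
move=> nT; have [hT _] := nT; have n0 := hs_norm_gt0 E nT.
have N0 : 0 < hs_norm T ^+ 2 by rewrite exprn_gt0.
set n2 := hs_norm T ^+ 2 in N0 *.
have If := conc_integral_fin p_ge1 mOmega Omega_fin E hT hT.
have Of : leb2 R d.+1 Omega \is a fin_num by rewrite ge0_fin_numE.
rewrite /self_conc_ratio concentrationE -/n2 inver gt_eqF// -(fineK If) -(fineK Of).
rewrite !poweR_EFin -EFinM => -[e].
set I := fine (conc_integral _ _ _ _) in e; set l := fine (leb2 _ _ _) in e.
have I0 : 0 <= I by rewrite fine_ge0// conc_integral_ge0.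
have l0 : 0 <= l by rewrite fine_ge0.
have IE : I = n2 `^ p * l.
  have : I `^ p^-1 = n2 * l `^ p^-1 by rewrite -e mulrC divfK// gt_eqF.
  move=> /(congr1 (fun r => r `^ p)).
  by rewrite powRM ?powR_ge0 ?ltW// -!powRrM mulVf ?gt_eqF// !powRr1.
pose g z := (Normc.normc (op_conv T (op_check T) z) `^ p)%:E : \bar R.
pose f z := (n2 `^ p - Normc.normc (op_conv T (op_check T) z) `^ p)%:E : \bar R.
have ub z : Normc.normc (op_conv T (op_check T) z) <= n2.
  by rewrite /n2 expr2; exact: (normc_op_conv E z hT hT).
have mg := measurable_conc p (Omega := Omega) E hT hT.
have mf : measurable_fun Omega f.
  apply/measurable_EFinP; apply: measurable_funB; first exact: measurable_cst.
  exact/measurable_EFinP.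
have f0 z : Omega z -> (0 <= f z)%E.
  move=> _; rewrite lee_fin subr_ge0; apply: ge0_ler_powR (ub z); first exact: ltW.
    by rewrite nnegrE normc_ge0.
  by rewrite nnegrE ltW.
have g0 z : Omega z -> (0 <= g z)%E by rewrite lee_fin powR_ge0.
have sum : (\int[leb2 R d.+1]_(z in Omega) g z + \int[leb2 R d.+1]_(z in Omega) f z =
    \int[leb2 R d.+1]_(z in Omega) g z)%E.
  rewrite -(ge0_integralD _ mOmega g0 mg f0 mf).
  under eq_integral do rewrite /g /f -EFinD addrC subrK.
  by rewrite (integral_cst (leb2 R d.+1) mOmega (n2 `^ p)%:E) -[RHS](fineK If) -/I IE EFinM fineK.
have F0 : (\int[leb2 R d.+1]_(z in Omega) `|f z| = 0)%E.
  transitivity (\int[leb2 R d.+1]_(z in Omega) f z)%E.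
    by apply: eq_integral => z; rewrite inE => Oz; rewrite gee0_abs// f0.
  apply: (@adde_cancel0 R (\int[leb2 R d.+1]_(z in Omega) g z)%E _ _ _ (esym sum)).
    exact: integral_ge0.
  by rewrite -ge0_fin_numE//; exact: integral_ge0.
have := (ae_eq_integral_abs (leb2 R d.+1) mOmega mf).1 F0.
apply: filterS => z /[apply] -[] /eqP; rewrite subr_eq0 => /eqP h.
have := congr1 (fun r => r `^ p^-1) h.
by rewrite /= -!powRrM mulfV ?gt_eqF// !powRr1// ?normc_ge0// ltW.
Qed.

(** The equality case of Cauchy--Schwarz; comparing norms shows that the factor is unimodular. *)
Lemma op_conv_norm_eq T z : hs_nonzero T ->
  Normc.normc (op_conv T (op_check T) z) = hs_norm T ^+ 2 ->
  exists2 c : R[i], Normc.normc c = 1 &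
    T = (fun u => c *: alpha z (adjoint T) u).
Proof.
move=> nT; have [hT _] := nT; have n0 := hs_norm_gt0 E nT.
have oe0 := proj2_sig E.
have hA := hs_adjoint oe0 hT; have haA := hs_alpha E z hA.
have nA : hs_norm (alpha z (adjoint T)) = hs_norm T.
  by rewrite (hs_norm_alpha E z hA) (hs_norm_adjoint E hT).
rewrite (op_convE E T z hT) (adjoint_alpha E z hT) expr2 -{2}nA => e.
have naA : hs_nonzero (alpha z (adjoint T)).
  by apply: (hs_norm_nonzero E haA); rewrite nA.
have [c cE] := hs_cauchy_schwarz_eq E nT naA e.
exists c; last exact: cE.
have := congr1 (@hs_norm R d.+1) cE; rewrite (hs_norm_scale E c haA) nA.
have := lt0r_neq0 n0; move: (hs_norm T) (Normc.normc c) => n r nn h.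
by apply: (mulIf nn); rewrite mul1r -h.
Qed.

Lemma self_conc_ratio_neq T : hs_nonzero T ->
  self_conc_ratio p Omega T <> (leb2 R d.+1 Omega `^ p^-1)%E.
Proof.
move=> nT /(self_conc_ratio_eq_ae nT) /ae_two_points[z [w [_ _ qz qw zw]]].
have [hT _] := nT; have hA := hs_adjoint (proj2_sig E) hT.
have [c c1 e] := op_conv_norm_eq nT qz; have [c' c1' e'] := op_conv_norm_eq nT qw.
have A0 := alpha_proportional_eq0 E zw hA c1 c1' e e'.
have := hs_norm_gt0 E nT; rewrite -(hs_norm_adjoint E hT) A0 (hs_norm0 E).
by rewrite ltxx.
Qed.

End NotAttained.

Local Close Scope complex_scope.

(** The finiteness clause shows that the extended values are real numbers, so the convergence clause
    is continuity of a real functional. *)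
Theorem proposition1p2 (R : realType) (d : nat) (d_gt0 : (0 < d)%N)
    (p : R) (p_ge1 : 1 <= p)
    (Omega : set (phase R d)) (mOmega : measurable Omega)
    (Omega_gt0 : (0 < leb2 R d Omega)%E) (Omega_fin : (leb2 R d Omega < +oo)%E)
    (S : L2 R d -> L2 R d) (hS : hilbert_schmidt S) :
  [/\
    exists T0, hs_nonzero T0 /\
      conc_ratio p Omega S T0
        = ereal_sup [set conc_ratio p Omega S T | T in @hs_nonzero R d],

    (forall T, hilbert_schmidt T -> concentration p Omega S T \is a fin_num) /\
    (forall (T_ : nat -> L2 R d -> L2 R d) (T : L2 R d -> L2 R d),
      (forall n, hilbert_schmidt (T_ n)) -> hilbert_schmidt T ->
      weakly_converges T_ T ->
      concentration p Omega S (T_ n) @[n --> \oo] --> concentration p Omega S T),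

    ereal_sup [set self_conc_ratio p Omega T | T in @hs_nonzero R d]
      = (leb2 R d Omega `^ p^-1)%E &

    ~ exists T0, hs_nonzero T0 /\
      self_conc_ratio p Omega T0
        = ereal_sup [set self_conc_ratio p Omega T | T in @hs_nonzero R d]].
Proof.
(* The orthonormal basis used throughout is the one that [hilbert_schmidt S] provides. *)
have [_ [e [oe _]]] := hS; pose E : onb R d := exist _ e oe.
split.
- exact: (conc_ratio_sup_attained p_ge1 mOmega Omega_fin E hS).
- split=> [T hT|T_ T hT_ hT].
    exact: (concentration_fin p_ge1 mOmega Omega_fin E hS hT).
  exact: (concentration_cvg p_ge1 mOmega Omega_fin E hT_ hT hS).
- exact: (self_conc_ratio_sup p_ge1 mOmega Omega_fin E).
rewrite (self_conc_ratio_sup p_ge1 mOmega Omega_fin E) => -[T0 [nT0]].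
(* Positive dimension provides the first coordinate along which the half spaces are cut. *)
case: d d_gt0 Omega mOmega Omega_gt0 Omega_fin S hS e oe E T0 nT0
  => // n _ Om mOm Om0 Omf S' _ _ _ E' T0 nT0.
exact: (self_conc_ratio_neq p_ge1 mOm Om0 Omf E' nT0).
Qed.
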